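(* Let $K$ be a field, $\mathcal{Q}$ a finite quiver, and $\Lambda=K\mathcal{Q}/I$, where $I$ is an admissible ideal in $K\mathcal{Q}$. Let $\mathcal{H}$ be the homological heart of $\mathcal{Q}$ and let $\Gamma$ be the algebra associated to $(\mathcal{H},\Lambda)$. Let $t$ be the length of the longest path in $\mathcal{Q}$ having support contained in $\mathcal{H}^+\cup\mathcal{H}^-\cup\mathcal{H}^o$. Then: (1) $\operatorname{gl.dim}(\Lambda)$ is finite if and only if $\operatorname{gl.dim}(\Gamma)$ is finite. (2) $\operatorname{fin.dim}(\Lambda)$ is finite if and only if $\operatorname{fin.dim}(\Gamma)$ is finite. (3) If $M$ and $N$ are $\Lambda$-modules and $\ell\ge 2t+3$, then $\operatorname{Ext}^{\ell}_{\Lambda}(M,N)$ is naturally isomorphic to $\operatorname{Ext}^{\ell-2t-2}_{\Gamma}(A_M,B_N)$, where $A_M=\Omega^{t+1}(M)/(\Omega^{t+1}(M))^+$ and $B_N=(\Omega^{-t-1}(N))_-$.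
   Context: Modules are right modules; the product $ab$ of arrows means first $a$ then $b$. An ideal $I$ of $K\mathcal{Q}$ is admissible if $J^n\subseteq I\subseteq J^2$ for some $n\ge 2$, where $J$ is the ideal generated by the arrows. All subquivers are full, hence determined by their vertex sets; unions and intersections of subquivers are the full subquivers on the unions and intersections of vertex sets. Homological heart: let $X$ be the set of vertices lying on a nontrivial oriented cycle of $\mathcal{Q}$, and let $Y$ be the union of $X$ with the set of vertices occurring in some path of $\mathcal{Q}$ whose origin and terminus are in $X$. The homological heart $\mathcal{H}$ is the full subquiver with vertex set $Y$. For a full subquiver $\mathcal{L}$: $\mathcal{L}^+$ (resp. $\mathcal{L}^-$) is the full subquiver on the vertices $v\notin\mathcal{L}_0$ such that there is a path from a vertex of $\mathcal{L}$ to $v$ (resp. from $v$ to a vertex of $\mathcal{L}$); $\mathcal{L}^o$ is the full subquiver on the vertices $v\notin\mathcal{L}_0$ such that there are no paths in either direction between $v$ and any vertex of $\mathcal{L}$. The subquiver $\mathcal{H}^+\cup\mathcal{H}^-\cup\mathcal{H}^o$ contains no oriented cycles; set $t=0$ if it is empty. The algebra associated to $(\mathcal{L},\Lambda)$ is $\Lambda/\langle e'_{\mathcal{L}}\rangle$, where $e'_{\mathcal{L}}$ is the sum of the vertices not in $\mathcal{L}$ and $\langle\cdot\rangle$ denotes the two-sided ideal generated. The finitistic dimension $\operatorname{fin.dim}$ of a finite dimensional algebra is the supremum of the projective dimensions of finitely generated modules having finite projective dimension. A $\Lambda$-module $C$ has support contained in a subquiver $\mathcal{L}$ if $Cv=0$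 for every vertex $v\notin\mathcal{L}_0$. For a $\Lambda$-module $C$, $C^+$ is the largest submodule of $C$ having support contained in $\mathcal{H}^+$, and $C_-$ is the smallest submodule of $C$ such that $C/C_-$ has support contained in $\mathcal{H}^-$. $\Omega^n(L)$ denotes the $n$-th syzygy in a minimal projective $\Lambda$-resolution of $L$ and $\Omega^{-n}(L)$ the $n$-th cosyzygy in a minimal injective $\Lambda$-coresolution. The modules $A_M$ and $B_N$ have support contained in $\mathcal{H}$ and so are regarded as $\Gamma$-modules. *)

(* Defs.v *)
From HB Require Import structures.
From mathcomp Require Import all_boot all_algebra generic_quotient ring_quotient.
From mathcomp Require Import boolp classical_sets finmap monalg.

Set Implicit Arguments.
Unset Strict Implicit.
Unset Printing Implicit Defensive.

Import GRing.Theory.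
Local Open Scope ring_scope.
Local Open Scope quotient_scope.
Local Open Scope classical_set_scope.

(* Left R-modules are lmodType R and right R-modules are lmodType R^c, with x a
   rendered as (a : R^c) *: x. Rings may be zero: the homological heart of an
   acyclic quiver is empty. *)

Section Ideals.
Variable R : pzRingType.

Definition is_ideal (I : set R) : Prop :=
  [/\ I 0, forall x y, I x -> I y -> I (x - y)
    & forall a x, I x -> I (a * x) /\ I (x * a)].

Record ideal := Ideal {
  ideal_set :> R -> Prop;
  ideal_axiom : is_ideal ideal_set }.

Lemma smallest_ideal (S : set R) : is_ideal (smallest is_ideal S).
Proof.
split=> [I [[]] //|x y Sx Sy I II|a x Sx].
  by have [[_ IB _] _] := II; apply: IB; [exact: Sx | exact: Sy].
by split=> I II; have [[_ _ IM] _] := II; have [] := IM a x (Sx I II).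
Qed.

Definition ideal_gen (S : set R) : ideal := Ideal (smallest_ideal S).

Lemma setT_ideal : is_ideal [set: R]. Proof. by []. Qed.

Definition ideal_mul (I J : ideal) : ideal :=
  ideal_gen [set z | exists x y, [/\ I x, J y & z = x * y]].

Fixpoint ideal_exp (I : ideal) (n : nat) : ideal :=
  if n is m.+1 then ideal_mul (ideal_exp I m) I else Ideal setT_ideal.

Variable I : ideal.

Definition ideal_mem : {pred R} := fun x => `[< I x >].

Lemma ideal_memP x : reflect (I x) (x \in ideal_mem).
Proof. exact: asboolP. Qed.

Lemma ideal_mem_zmod : zmod_closed ideal_mem.
Proof.
have [I0 IB _] := ideal_axiom I.
by split=> [|x y /ideal_memP Ix /ideal_memP Iy]; apply/ideal_memP; auto.
Qed.
HB.instance Definition _ := GRing.isZmodClosed.Build R ideal_mem ideal_mem_zmod.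

Lemma ideal_memMl a x : x \in ideal_mem -> a * x \in ideal_mem.
Proof.
have [_ _ IM] := ideal_axiom I.
by move=> /ideal_memP /(IM a)[? _]; apply/ideal_memP.
Qed.

Lemma ideal_memMr a x : x \in ideal_mem -> x * a \in ideal_mem.
Proof.
have [_ _ IM] := ideal_axiom I.
by move=> /ideal_memP /(IM a)[_ ?]; apply/ideal_memP.
Qed.

Definition quot_ring : Type := {ideal_quot ideal_mem}.
HB.instance Definition _ := GRing.Zmodule.on quot_ring.
HB.instance Definition _ := EqQuotient.on quot_ring.

Definition quot_one : quot_ring := \pi_quot_ring 1.
Definition quot_mul (x y : quot_ring) : quot_ring :=
  \pi_quot_ring (repr x * repr y).

Lemma quot_eqP (x y : R) :
  (\pi_quot_ring x = \pi_quot_ring y) <-> (x - y \in ideal_mem).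
Proof. rewrite Quotient.idealrBE; exact: (rwP eqP). Qed.

Lemma quot_piM (x y : R) :
  quot_mul (\pi_quot_ring x) (\pi_quot_ring y) = \pi_quot_ring (x * y).
Proof.
apply/quot_eqP; set x' := repr _; set y' := repr _.
have hx : x' - x \in ideal_mem by apply/quot_eqP; rewrite reprK.
have hy : y' - y \in ideal_mem by apply/quot_eqP; rewrite reprK.
have -> : x' * y' - x * y = x' * (y' - y) + (x' - x) * y.
  by rewrite mulrBr mulrBl addrA subrK.
exact: rpredD (ideal_memMl x' hy) (ideal_memMr y hx).
Qed.

Lemma quot_piD (x y : R) :
  \pi_quot_ring x + \pi_quot_ring y = \pi_quot_ring (x + y).
Proof. by rewrite [RHS]Quotient.pi_add. Qed.

Lemma quot_mulA : associative quot_mul.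
Proof.
move=> x y z; rewrite -[x]reprK -[y]reprK -[z]reprK.
set a := repr x; set b := repr y; set c := repr z.
by rewrite (quot_piM b c) (quot_piM a b) (quot_piM a) (quot_piM _ c) mulrA.
Qed.
Lemma quot_mul1 : left_id quot_one quot_mul.
Proof. by move=> x; rewrite -[x]reprK quot_piM mul1r. Qed.
Lemma quot_1mul : right_id quot_one quot_mul.
Proof. by move=> x; rewrite -[x]reprK quot_piM mulr1. Qed.
Lemma quot_mulDl : left_distributive quot_mul +%R.
Proof.
move=> x y z; rewrite -[x]reprK -[y]reprK -[z]reprK.
set a := repr x; set b := repr y; set c := repr z.
rewrite quot_piD (quot_piM _ c) (quot_piM a c) (quot_piM b c) quot_piD.
by rewrite mulrDl.
Qed.
Lemma quot_mulDr : right_distributive quot_mul +%R.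
Proof.
move=> x y z; rewrite -[x]reprK -[y]reprK -[z]reprK.
set a := repr x; set b := repr y; set c := repr z.
rewrite quot_piD (quot_piM a) (quot_piM a b) (quot_piM a c) quot_piD.
by rewrite mulrDr.
Qed.
HB.instance Definition _ := GRing.Zmodule_isPzRing.Build quot_ring
  quot_mulA quot_mul1 quot_1mul quot_mulDl quot_mulDr.

End Ideals.

Section Submod.
Variables (R : pzRingType) (M : lmodType R).

Section Def.
Variable S : submodClosed M.
Definition submod : Type := {x : M | x \in S}.
HB.instance Definition _ := SubChoice.on submod.
HB.instance Definition _ := [SubChoice_isSubLmodule of submod by <:].

(* over a ring, closure under scaling by -1 makes S a subgroup *)
Definition submod_zpred : {pred M} := mem S.
Fact submod_zmod_closed : zmod_closed submod_zpred.
Proof.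
split=> [|x y xS yS]; first exact: (rpred0 S).
by rewrite -scaleN1r; apply: (rpredD (S := S) xS); apply: (rpredZ (s := S)).
Qed.
HB.instance Definition _ :=
  GRing.isZmodClosed.Build M submod_zpred submod_zmod_closed.

Definition quotmod : Type := {ideal_quot submod_zpred}.
HB.instance Definition _ := GRing.Zmodule.on quotmod.
HB.instance Definition _ := EqQuotient.on quotmod.

Definition quotmod_scale (a : R) (x : quotmod) : quotmod :=
  \pi_quotmod (a *: repr x).

Lemma quotmod_eqP (x y : M) :
  (\pi_quotmod x = \pi_quotmod y) <-> (x - y \in S).
Proof.
rewrite -[x - y \in S]/(x - y \in submod_zpred) Quotient.idealrBE.
exact: (rwP eqP).
Qed.

Lemma quotmod_piZ a (x : M) :
  quotmod_scale a (\pi_quotmod x) = \pi_quotmod (a *: x).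
Proof.
apply/quotmod_eqP; rewrite -scalerBr; apply: (rpredZ (s := S)).
by apply/quotmod_eqP; rewrite reprK.
Qed.

Lemma quotmod_piD (x y : M) :
  \pi_quotmod x + \pi_quotmod y = \pi_quotmod (x + y).
Proof. by rewrite [RHS]Quotient.pi_add. Qed.

Fact quotmod_scaleA a b x :
  quotmod_scale a (quotmod_scale b x) = quotmod_scale (a * b) x.
Proof.
rewrite -[x]reprK (quotmod_piZ b) (quotmod_piZ a) (quotmod_piZ (a * b)).
by rewrite scalerA.
Qed.
Fact quotmod_scale1 : left_id 1 quotmod_scale.
Proof. by move=> x; rewrite -[x]reprK quotmod_piZ scale1r. Qed.
Fact quotmod_scaleDr : right_distributive quotmod_scale +%R.
Proof.
move=> a x y; rewrite -[x]reprK -[y]reprK.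
by rewrite quotmod_piD 3!quotmod_piZ quotmod_piD scalerDr.
Qed.
Fact quotmod_scaleDl x : {morph quotmod_scale^~ x : a b / a + b}.
Proof.
by move=> a b; rewrite -[x]reprK !quotmod_piZ quotmod_piD scalerDl.
Qed.
HB.instance Definition _ := GRing.Zmodule_isLmodule.Build R quotmod
  quotmod_scaleA quotmod_scale1 quotmod_scaleDr quotmod_scaleDl.

Definition quotmod_pi (x : M) : quotmod := \pi_quotmod x.
Fact quotmod_pi_linear : linear quotmod_pi.
Proof.
move=> a x y; rewrite /quotmod_pi -quotmod_piD; congr (_ + _).
by rewrite -quotmod_piZ.
Qed.
HB.instance Definition _ :=
  GRing.isLinear.Build R M quotmod _ quotmod_pi quotmod_pi_linear.

End Def.
End Submod.

Section SubmodConstructions.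
Variable R : pzRingType.

Section Kernel.
Variables (M N : lmodType R) (f : {linear M -> N}).
Definition ker_sub : {pred M} := fun x => f x == 0.
Fact ker_submod : submod_closed ker_sub.
Proof.
split=> [|a x y /eqP fx /eqP fy]; apply/eqP; first exact: linear0.
by rewrite linearP fx fy scaler0 addr0.
Qed.
HB.instance Definition _ := GRing.isSubmodClosed.Build R M ker_sub ker_submod.

Definition im_sub : {pred N} := fun y => `[< exists x, f x = y >].
Fact im_submod : submod_closed im_sub.
Proof.
split=> [|a x y /asboolP[x' <-] /asboolP[y' <-]]; apply/asboolP.
  by exists 0; rewrite linear0.
by exists (a *: x' + y'); rewrite linearP.
Qed.
HB.instance Definition _ := GRing.isSubmodClosed.Build R N im_sub im_submod.

Variable S : submodClosed N.
Definition preim_sub : {pred M} := fun x => f x \in S.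
Fact preim_submod : submod_closed preim_sub.
Proof.
split=> [|a x y fx fy]; rewrite unfold_in /preim_sub ?linear0 ?rpred0 //.
by rewrite linearP; apply: (rpredD (S := S)) => //; apply: (rpredZ (s := S)).
Qed.
HB.instance Definition _ :=
  GRing.isSubmodClosed.Build R M preim_sub preim_submod.
End Kernel.

Section Lattice.
Variables (M : lmodType R) (P : submodClosed M -> Prop).

Definition submod_inter : {pred M} :=
  fun x => `[< forall S : submodClosed M, P S -> x \in S >].
Fact submod_inter_submod : submod_closed submod_inter.
Proof.
split=> [|a x y /asboolP Ix /asboolP Iy]; apply/asboolP => S PS.
  exact: rpred0.
by apply: (rpredD (S := S)); [apply: (rpredZ (s := S)); exact: Ix | exact: Iy].
Qed.
HB.instance Definition _ :=
  GRing.isSubmodClosed.Build R M submod_inter submod_inter_submod.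
End Lattice.

(* the smallest submodule containing every S with P S *)
Definition submod_sum (M : lmodType R) (P : submodClosed M -> Prop) :
    submodClosed M :=
  submod_inter (fun T : submodClosed M =>
    forall S : submodClosed M, P S -> {subset S <= T}).

Section Maps.
Variables (M N : lmodType R) (f : {linear M -> N}).
Variables (S : submodClosed M) (T : submodClosed N).
Hypothesis fST : forall x, x \in S -> f x \in T.

Definition submod_map (x : submod S) : submod T :=
  exist (fun y => y \in T) (f (\val x)) (fST (valP x)).
Fact submod_map_linear : linear submod_map.
Proof. by move=> a x y; apply: val_inj; rewrite /= linearP. Qed.
HB.instance Definition _ :=
  GRing.isLinear.Build R (submod S) (submod T) _ submod_map submod_map_linear.

Definition quotmod_map_fun (x : quotmod S) : quotmod T :=
  quotmod_pi T (f (repr x)).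
Lemma quotmod_map_pi x : quotmod_map_fun (quotmod_pi S x) = quotmod_pi T (f x).
Proof.
apply/quotmod_eqP; rewrite -linearB; apply: fST.
by apply/quotmod_eqP; rewrite reprK.
Qed.
Fact quotmod_map_linear : linear quotmod_map_fun.
Proof.
move=> a x y; rewrite -[x]reprK -[y]reprK.
rewrite -/(quotmod_pi S (repr x)) -/(quotmod_pi S (repr y)) -linearP.
by rewrite 3!quotmod_map_pi 2!linearP.
Qed.
Definition quotmod_map : {linear quotmod S -> quotmod T} :=
  HB.pack quotmod_map_fun (GRing.isLinear.Build R (quotmod S) (quotmod T) _
    quotmod_map_fun quotmod_map_linear).
End Maps.

End SubmodConstructions.

Section Hom.
Variables (R : pzRingType) (M N : lmodType R).

Definition hom : Type := {linear M -> N}.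
Definition hom_fun (f : hom) : {linear M -> N} := f.
HB.instance Definition _ := gen_eqMixin hom.
HB.instance Definition _ := gen_choiceMixin hom.

Lemma hom_eq (f g : hom) : hom_fun f =1 hom_fun g -> f = g.
Proof.
rewrite /hom_fun; move: f g => [f [[f1] [f2]]] [g [[g1] [g2]]] /= /funext fg.
case: _ / fg g1 g2 => g1 g2.
by rewrite (Prop_irrelevance f1 g1) (Prop_irrelevance f2 g2).
Qed.

Definition hom_zero : hom := \0 : {linear M -> N}.
Definition hom_opp (f : hom) : hom := \- hom_fun f : {linear M -> N}.
Definition hom_add (f g : hom) : hom :=
  hom_fun f \+ hom_fun g : {linear M -> N}.
Fact hom_addA : associative hom_add.
Proof. by move=> f g h; apply: hom_eq => x /=; rewrite addrA. Qed.
Fact hom_addC : commutative hom_add.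
Proof. by move=> f g; apply: hom_eq => x /=; rewrite addrC. Qed.
Fact hom_add0 : left_id hom_zero hom_add.
Proof. by move=> f; apply: hom_eq => x /=; rewrite add0r. Qed.
Fact hom_addN : left_inverse hom_zero hom_opp hom_add.
Proof. by move=> f; apply: hom_eq => x /=; rewrite addNr. Qed.
HB.instance Definition _ :=
  GRing.isZmodule.Build hom hom_addA hom_addC hom_add0 hom_addN.
End Hom.

Section Homological.
Variable R : pzRingType.

Definition projective (P : lmodType R) : Prop :=
  forall (M N : lmodType R) (g : {linear M -> N}) (f : {linear P -> N}),
    (forall y, exists x, g x = y) ->
    exists h : {linear P -> M}, forall x, g (h x) = f x.

Definition injective_mod (E : lmodType R) : Prop :=
  forall (M N : lmodType R) (i : {linear M -> N}) (f : {linear M -> E}),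
    injective i -> exists h : {linear N -> E}, forall x, h (i x) = f x.

Definition superfluous (M : lmodType R) (S : submodClosed M) : Prop :=
  forall T : submodClosed M,
    (forall x, exists s t, [/\ s \in S, t \in T & x = s + t]) ->
    forall x, x \in T.

Definition essential (M : lmodType R) (S : submodClosed M) : Prop :=
  forall T : submodClosed M,
    (forall x, x \in S -> x \in T -> x = 0) -> forall x, x \in T -> x = 0.

Definition finitely_generated (M : lmodType R) : Prop :=
  exists (n : nat) (g : 'I_n -> M),
    forall x, exists c : 'I_n -> R, x = \sum_(i < n) c i *: g i.

(* ... -> P 1 -> P 0 -> M -> 0 *)
Record proj_res (M : lmodType R) := ProjRes {
  pr_obj :> nat -> lmodType R;
  pr_aug : {linear pr_obj 0%N -> M};
  pr_d : forall n, {linear pr_obj n.+1 -> pr_obj n};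
  pr_projective : forall n, projective (pr_obj n);
  pr_aug_surj : forall y, exists x, pr_aug x = y;
  pr_exact0 : forall x, pr_aug x = 0 <-> exists y, pr_d 0%N y = x;
  pr_exact : forall n x, pr_d n x = 0 <-> exists y, pr_d n.+1 y = x }.

(* 0 -> N -> E 0 -> E 1 -> ... *)
Record inj_cores (N : lmodType R) := InjCores {
  ic_obj :> nat -> lmodType R;
  ic_coaug : {linear N -> ic_obj 0%N};
  ic_d : forall n, {linear ic_obj n -> ic_obj n.+1};
  ic_injective : forall n, injective_mod (ic_obj n);
  ic_coaug_inj : injective ic_coaug;
  ic_exact0 : forall x, ic_d 0%N x = 0 <-> exists y, ic_coaug y = x;
  ic_exact : forall n x, ic_d n.+1 x = 0 <-> exists y, ic_d n y = x }.

(* The augmentation is counted as the differential leaving P 0 *)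
Definition pr_tgt (M : lmodType R) (P : proj_res M) (n : nat) : lmodType R :=
  if n is m.+1 then P m else M.
Definition pr_bd (M : lmodType R) (P : proj_res M) (n : nat) :
  {linear P n -> pr_tgt P n} :=
  match n with 0%N => pr_aug P | m.+1 => pr_d P m end.

Definition ic_src (N : lmodType R) (E : inj_cores N) (n : nat) : lmodType R :=
  if n is m.+1 then E m else N.
Definition ic_cobd (N : lmodType R) (E : inj_cores N) (n : nat) :
  {linear ic_src E n -> E n} :=
  match n with 0%N => ic_coaug E | m.+1 => ic_d E m end.

(* the map from P n to the image of pr_bd P n is a projective cover for all n *)
Record min_proj_res (M : lmodType R) := MinProjRes {
  mpr_res :> proj_res M;
  mpr_min : forall n, superfluous (ker_sub (pr_bd mpr_res n)) }.

(* E n is an injective hull of the image of ic_cobd E n for all n *)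
Record min_inj_cores (N : lmodType R) := MinInjCores {
  mic_cores :> inj_cores N;
  mic_min : forall n, essential (im_sub (ic_cobd mic_cores n)) }.

Definition syzygy (M : lmodType R) (P : proj_res M) (n : nat) : lmodType R :=
  if n is m.+1 then submod (ker_sub (pr_bd P m)) else M.

Definition cosyzygy (N : lmodType R) (E : inj_cores N) (n : nat) : lmodType R :=
  if n is m.+1 then quotmod (im_sub (ic_cobd E m)) else N.

(* projective dimension at most n *)
Definition pd_le (M : lmodType R) (n : nat) : Prop :=
  exists P : proj_res M, forall k, (n < k)%N -> forall x : P k, x = 0.

(* A supremum of values in {0, 1, ..., oo} is finite iff some natural number
   bounds all of them *)
Definition gldim_finite : Prop := exists n, forall M : lmodType R, pd_le M n.

Definition findim_finite : Prop :=
  exists n, forall M : lmodType R,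
    finitely_generated M -> (exists k, pd_le M k) -> pd_le M n.

Section ChainMaps.

Definition pr_tgt_map (M M' : lmodType R) (P : proj_res M) (P' : proj_res M')
    (f : {linear M -> M'}) (c : forall n, {linear P n -> P' n}) (n : nat) :
  {linear pr_tgt P n -> pr_tgt P' n} :=
  match n with 0%N => f | m.+1 => c m end.

Record chain_map (M M' : lmodType R) (P : proj_res M) (P' : proj_res M')
    (f : {linear M -> M'}) := ChainMap {
  cm_fun :> forall n, {linear P n -> P' n};
  cm_comm : forall n x,
    pr_bd P' n (cm_fun n x) = pr_tgt_map f cm_fun n (pr_bd P n x) }.

Definition ic_src_map (N N' : lmodType R) (E : inj_cores N) (E' : inj_cores N')
    (g : {linear N -> N'}) (c : forall n, {linear E n -> E' n}) (n : nat) :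
  {linear ic_src E n -> ic_src E' n} :=
  match n with 0%N => g | m.+1 => c m end.

Record cochain_map (N N' : lmodType R) (E : inj_cores N) (E' : inj_cores N')
    (g : {linear N -> N'}) := CochainMap {
  ccm_fun :> forall n, {linear E n -> E' n};
  ccm_comm : forall n x,
    ccm_fun n (ic_cobd E n x) = ic_cobd E' n (ic_src_map g ccm_fun n x) }.

Section Syzygy.
Variables (M M' : lmodType R) (P : proj_res M) (P' : proj_res M').
Variables (f : {linear M -> M'}) (c : chain_map P P' f).

Lemma cm_ker n x : x \in ker_sub (pr_bd P n) -> c n x \in ker_sub (pr_bd P' n).
Proof. by move=> /eqP hx; apply/eqP; rewrite cm_comm hx linear0. Qed.

Definition syzygy_map (n : nat) : {linear syzygy P n -> syzygy P' n} :=
  match n with 0%N => f | m.+1 => submod_map (@cm_ker m) end.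
End Syzygy.

Section Cosyzygy.
Variables (N N' : lmodType R) (E : inj_cores N) (E' : inj_cores N').
Variables (g : {linear N -> N'}) (c : cochain_map E E' g).

Lemma ccm_im n x :
  x \in im_sub (ic_cobd E n) -> c n x \in im_sub (ic_cobd E' n).
Proof.
move=> /asboolP[y <-]; apply/asboolP.
by exists (ic_src_map g c n y); rewrite ccm_comm.
Qed.

Definition cosyzygy_map (n : nat) : {linear cosyzygy E n -> cosyzygy E' n} :=
  match n as k return {linear cosyzygy E k -> cosyzygy E' k} with
  | 0%N => g | m.+1 => quotmod_map (@ccm_im m) end.
End Cosyzygy.

End ChainMaps.

Section ExtOf.
Variables (M : lmodType R) (P : proj_res M) (N : lmodType R) (n : nat).

Definition cocycle_pred : {pred hom (P n) N} :=
  fun z => `[< forall x, hom_fun z (pr_d P n x) = 0 >].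
Fact cocycle_zmod : zmod_closed cocycle_pred.
Proof.
split=> [|z w /asboolP hz /asboolP hw]; apply/asboolP => x //=.
by rewrite hz hw subr0.
Qed.
HB.instance Definition _ :=
  GRing.isZmodClosed.Build (hom (P n) N) cocycle_pred cocycle_zmod.

Definition cocycle : Type := {z : hom (P n) N | z \in cocycle_pred}.
HB.instance Definition _ := SubChoice.on cocycle.
HB.instance Definition _ := [SubChoice_isSubZmodule of cocycle by <:].
Definition cocycle_fun (z : cocycle) : {linear P n -> N} := hom_fun (\val z).

End ExtOf.

Definition is_coboundary (M : lmodType R) (P : proj_res M) (N : lmodType R)
    (n : nat) : {linear P n -> N} -> Prop :=
  match n with
  | 0%N => fun z => forall x, z x = 0
  | m.+1 => fun z =>
      exists y : {linear P m -> N}, forall x, z x = y (pr_d P m x)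
  end.

Section Cohomology.
Variables (M : lmodType R) (P : proj_res M) (n : nat) (N : lmodType R).

Definition coboundary_pred : {pred cocycle P N n} :=
  fun z => `[< is_coboundary (cocycle_fun z) >].
Fact coboundary_zmod : zmod_closed coboundary_pred.
Proof.
rewrite /coboundary_pred; case: n => [|m] /=.
  split=> [|z w /asboolP hz /asboolP hw]; apply/asboolP => x //.
  by rewrite /= hz hw subr0.
split=> [|z w /asboolP[y hy] /asboolP[y' hy']]; apply/asboolP.
  by exists (\0 : {linear P m -> N}) => x.
exists (y \- y' : {linear P m -> N}) => x /=.
by rewrite hy hy'.
Qed.
HB.instance Definition _ :=
  GRing.isZmodClosed.Build (cocycle P N n) coboundary_pred coboundary_zmod.

Definition Ext_of : zmodType := {ideal_quot coboundary_pred}.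

End Cohomology.

Section ExtOfMap.
Variables (M M' : lmodType R) (P : proj_res M) (P' : proj_res M').
Variables (f : {linear M -> M'}) (c : chain_map P P' f).
Variables (N N' : lmodType R) (g : {linear N -> N'}) (n : nat).

Definition cocycle_map_fun (z : cocycle P' N n) : hom (P n) N' :=
  (g \o (cocycle_fun z \o c n) : {linear P n -> N'}).

Fact cocycle_map_subproof z : cocycle_map_fun z \in @cocycle_pred _ P N' n.
Proof.
apply/asboolP => x /=; rewrite -[pr_d P n x]/(pr_bd P n.+1 x).
rewrite -[c n _]/(pr_tgt_map f c n.+1 _) -cm_comm /=.
by have /asboolP -> := valP z; rewrite linear0.
Qed.

Definition cocycle_map (z : cocycle P' N n) : cocycle P N' n :=
  exist (fun z => z \in @cocycle_pred _ P N' n) _ (cocycle_map_subproof z).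

Definition Ext_of_map (xi : Ext_of P' n N) : Ext_of P n N' :=
  \pi_(Ext_of P n N') (cocycle_map (repr xi)).
End ExtOfMap.

End Homological.

Section Free.
Variable R : pzRingType.

(* {malg R[T]} carries a module structure in the library only when R is
   nonzero; the zero ring occurs here, so the scaling is defined anew *)
Definition free_mod (T : choiceType) : Type := {malg R[T]}.

Section FreeModule.
Variable T : choiceType.
HB.instance Definition _ := GRing.Zmodule.on (free_mod T).

Definition free_coeff (g : free_mod T) (k : T) : R := mcoeff k g.
Definition free_gen (k : T) : free_mod T := mkmalgU k 1.
Definition free_scale (a : R) (g : free_mod T) : free_mod T :=
  [malg k in msupp g => a * g@_k].

Lemma free_scaleE a g k : free_coeff (free_scale a g) k = a * free_coeff g k.
Proof. by rewrite /free_coeff mcoeffE; case: msuppP; rewrite ?mulr0. Qed.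
Lemma free_coeffD g h k :
  free_coeff (g + h) k = free_coeff g k + free_coeff h k.
Proof. exact: mcoeffD. Qed.
Lemma free_eqP (g h : free_mod T) :
  (forall k, free_coeff g k = free_coeff h k) -> g = h.
Proof. by move=> gh; apply/malgP. Qed.

Fact free_scaleA a b g : free_scale a (free_scale b g) = free_scale (a * b) g.
Proof. by apply: free_eqP => k; rewrite !free_scaleE mulrA. Qed.
Fact free_scale1 : left_id 1 free_scale.
Proof. by move=> g; apply: free_eqP => k; rewrite free_scaleE mul1r. Qed.
Fact free_scaleDr : right_distributive free_scale +%R.
Proof.
move=> a g h; apply: free_eqP => k.
by rewrite free_coeffD !free_scaleE free_coeffD mulrDr.
Qed.
Fact free_scaleDl g : {morph free_scale^~ g : a b / a + b}.
Proof.
move=> a b; apply: free_eqP => k.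
by rewrite free_coeffD !free_scaleE mulrDl.
Qed.
HB.instance Definition _ := GRing.Zmodule_isLmodule.Build R (free_mod T)
  free_scaleA free_scale1 free_scaleDr free_scaleDl.

Variables (V : lmodType R) (h : T -> V).

(* the linear extension of h *)
Definition free_lift (g : free_mod T) : V :=
  \sum_(k <- msupp g) free_coeff g k *: h k.

Lemma free_liftEw (d : {fset T}) (g : free_mod T) : (msupp g `<=` d)%fset ->
  free_lift g = \sum_(k <- d) free_coeff g k *: h k.
Proof.
move=> le; rewrite /free_lift (big_fset_incl _ le) //= => k _ /mcoeff_outdom.
by rewrite /free_coeff => ->; rewrite scale0r.
Qed.

Fact free_lift_linear : linear free_lift.
Proof.
move=> a x y; set d := (msupp x `|` msupp y `|` msupp (a *: x + y))%fset.
rewrite (@free_liftEw d x); last first.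
  by rewrite /d -fsetUA fsubsetUl.
rewrite (@free_liftEw d y); last first.
  by rewrite /d -fsetUA fsetUCA fsubsetUl.
rewrite (@free_liftEw d (a *: x + y)); last by rewrite /d fsubsetUr.
rewrite scaler_sumr -big_split /=; apply: eq_bigr => k _.
by rewrite free_coeffD free_scaleE scalerDl scalerA.
Qed.
HB.instance Definition _ :=
  GRing.isLinear.Build R (free_mod T) V _ free_lift free_lift_linear.

Lemma free_lift_gen k : free_lift (free_gen k) = h k.
Proof.
rewrite (@free_liftEw [fset k]%fset) ?msuppU_le // big_seq_fset1.
by rewrite /free_coeff mcoeffUU scale1r.
Qed.

Lemma free_ext (u w : {linear free_mod T -> V}) :
  (forall k, u (free_gen k) = w (free_gen k)) -> u =1 w.
Proof.
move=> uw g.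
suff -> : g = \sum_(k <- msupp g) free_coeff g k *: free_gen k.
  by rewrite !linear_sum; apply: eq_bigr => k _; rewrite 2!linearZ uw.
rewrite {1}[g]monalgE; apply: eq_bigr => k _; apply: free_eqP => l.
rewrite free_scaleE /free_coeff /free_gen !mcoeffU.
by rewrite mulrnAr mulr1.
Qed.
End FreeModule.

Lemma free_projective (T : choiceType) : projective (free_mod T).
Proof.
move=> M N g f gsurj; have [s gs] := choice gsurj.
exists (free_lift (fun k => s (f (free_gen k))) : {linear free_mod T -> M}).
apply: (@free_ext T N (g \o free_lift _) f) => k /=.
by rewrite free_lift_gen.
Qed.

Definition free_aug (M : lmodType R) : {linear free_mod M -> M} := free_lift id.
Definition free_map (M M' : lmodType R) (f : {linear M -> M'}) :
  {linear free_mod M -> free_mod M'} := free_lift (fun x : M => free_gen (f x)).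

Lemma free_aug_map (M M' : lmodType R) (f : {linear M -> M'}) x :
  free_aug M' (free_map f x) = f (free_aug M x).
Proof.
apply: (@free_ext M M' (free_aug M' \o free_map f) (f \o free_aug M)) => k /=.
by rewrite /free_map /free_aug 3!free_lift_gen.
Qed.

Fixpoint free_syz (M : lmodType R) (n : nat) : lmodType R :=
  if n is m.+1 then submod (ker_sub (free_aug (free_syz M m))) else M.

Definition free_d (M : lmodType R) (n : nat) :
    {linear free_mod (free_syz M n.+1) -> free_mod (free_syz M n)} :=
  (\val : {linear submod (ker_sub (free_aug (free_syz M n))) ->
            free_mod (free_syz M n)})
    \o free_aug (free_syz M n.+1).

Lemma free_aug_surj (M : lmodType R) y : exists x, free_aug M x = y.
Proof. by exists (free_gen y); exact: free_lift_gen. Qed.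

Lemma free_exact_aug (M : lmodType R) n x :
  free_aug (free_syz M n) x = 0 <-> exists y, free_d M n y = x.
Proof.
split=> [/eqP hx|[y <-]].
  pose z : free_syz M n.+1 := exist (fun x => x \in ker_sub (free_aug _)) x hx.
  by have [y hy] := free_aug_surj z; exists y; rewrite /= hy.
by apply/eqP; exact: (valP (free_aug (free_syz M n.+1) y)).
Qed.

Lemma free_exact (M : lmodType R) n x :
  free_d M n x = 0 <-> exists y, free_d M n.+1 y = x.
Proof.
rewrite -free_exact_aug; split=> hx; last by rewrite /free_d [LHS]/= hx.
by apply: val_inj; rewrite [LHS]hx.
Qed.

Definition free_res (M : lmodType R) : proj_res M :=
  @ProjRes R M (fun n => free_mod (free_syz M n)) (free_aug M) (free_d M)
    (fun n => @free_projective _) (@free_aug_surj M)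
    (@free_exact_aug M 0%N) (@free_exact M).

Section FreeResMap.
Variables (M M' : lmodType R) (f : {linear M -> M'}).

Lemma free_map_ker (A B : lmodType R) (h : {linear A -> B}) x :
  x \in ker_sub (free_aug A) -> free_map h x \in ker_sub (free_aug B).
Proof. by move=> /eqP hx; apply/eqP; rewrite free_aug_map hx linear0. Qed.

Fixpoint free_syz_map (n : nat) : {linear free_syz M n -> free_syz M' n} :=
  match n return {linear free_syz M n -> free_syz M' n} with
  | 0%N => f
  | m.+1 => submod_map (@free_map_ker _ _ (free_syz_map m))
  end.

Definition free_res_map_fun (n : nat) :
  {linear free_res M n -> free_res M' n} := free_map (free_syz_map n).

Fact free_res_map_comm n x :
  pr_bd (free_res M') n (free_res_map_fun n x)
  = pr_tgt_map f free_res_map_fun n (pr_bd (free_res M) n x).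
Proof.
case: n x => [|n] x; first exact: free_aug_map.
by rewrite /= free_aug_map.
Qed.

Definition free_res_map : chain_map (free_res M) (free_res M') f :=
  ChainMap free_res_map_comm.
End FreeResMap.

(* Any projective resolution of M computes Ext; the standard one is strictly
   functorial, so no lifts have to be chosen in Ext_map *)
Definition Ext (n : nat) (M N : lmodType R) : zmodType :=
  Ext_of (free_res M) n N.

Definition Ext_map (n : nat) (M M' N N' : lmodType R)
    (f : {linear M -> M'}) (g : {linear N -> N'}) : Ext n M' N -> Ext n M N' :=
  @Ext_of_map R _ _ _ _ f (free_res_map f) _ _ g n.

End Free.

Section Descend.
Variables (R : pzRingType) (I : ideal R).

Definition annihilated (C : lmodType R^c) : Prop :=
  forall (a : R) (x : C), I a -> (a : R^c) *: x = 0.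

(* a right R-module killed by I is a right R/I-module, on the same carrier *)
Definition descend (C : lmodType R^c) (hC : annihilated C) : Type := C.

Section Module.
Variables (C : lmodType R^c) (hC : annihilated C).
HB.instance Definition _ := GRing.Zmodule.on (descend hC).

Definition descend_scale (a : (quot_ring I)^c) (x : descend hC) : descend hC :=
  (repr (a : quot_ring I) : R^c) *: (x : C).

Lemma descend_scale_pi (a : R) x :
  descend_scale (\pi_(quot_ring I) a) x = (a : R^c) *: (x : C).
Proof.
apply/eqP; rewrite -subr_eq0 -[X in X == _]scalerBl; apply/eqP/hC.
by apply/ideal_memP/quot_eqP; rewrite reprK.
Qed.

Fact descend_scaleA a b x :
  descend_scale a (descend_scale b x) = descend_scale (a * b) x.
Proof.
have -> : a * b =
    \pi_(quot_ring I) (repr (b : quot_ring I) * repr (a : quot_ring I)).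
  by rewrite -quot_piM !reprK.
by rewrite descend_scale_pi /descend_scale scalerA.
Qed.
Fact descend_scale1 : left_id 1 descend_scale.
Proof. by move=> x; rewrite [LHS](descend_scale_pi 1) scale1r. Qed.
Fact descend_scaleDr : right_distributive descend_scale +%R.
Proof. by move=> a x y; rewrite /descend_scale -scalerDr. Qed.
Fact descend_scaleDl x : {morph descend_scale^~ x : a b / a + b}.
Proof.
move=> a b; have -> : a + b =
    \pi_(quot_ring I) (repr (a : quot_ring I) + repr (b : quot_ring I)).
  by rewrite -quot_piD !reprK.
by rewrite descend_scale_pi /descend_scale scalerDl.
Qed.
HB.instance Definition _ := GRing.Zmodule_isLmodule.Build (quot_ring I)^c
  (descend hC) descend_scaleA descend_scale1 descend_scaleDr descend_scaleDl.
End Module.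

Section Map.
Variables (C D : lmodType R^c) (hC : annihilated C) (hD : annihilated D).
Variable f : {linear C -> D}.

Definition descend_fun (x : descend hC) : descend hD := f x.
Fact descend_fun_linear : linear descend_fun.
Proof. by move=> a x y; rewrite /descend_fun linearP. Qed.
Definition descend_map : {linear descend hC -> descend hD} :=
  HB.pack descend_fun (GRing.isLinear.Build _ (descend hC) (descend hD) _
    descend_fun descend_fun_linear).
End Map.
End Descend.

Record quiver := Quiver {
  vertex : finType;
  arrow : finType;
  source : arrow -> vertex;
  target : arrow -> vertex }.

Section Paths.
Variable Q : quiver.

Fixpoint is_walk (u : vertex Q) (s : seq (arrow Q)) : bool :=
  if s is a :: s' then (source a == u) && is_walk (target a) s' else true.

Definition qpath : Type := {p : vertex Q * seq (arrow Q) | is_walk p.1 p.2}.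
HB.instance Definition _ := SubChoice.on qpath.

Definition origin (p : qpath) : vertex Q := (\val p).1.
Definition arrows (p : qpath) : seq (arrow Q) := (\val p).2.
Definition walk_end (u : vertex Q) (s : seq (arrow Q)) : vertex Q :=
  last u (map (@target Q) s).
Definition terminus (p : qpath) : vertex Q := walk_end (origin p) (arrows p).
Definition path_vertices (p : qpath) : seq (vertex Q) :=
  origin p :: map (@target Q) (arrows p).
Definition path_length (p : qpath) : nat := size (arrows p).

Definition triv_path (v : vertex Q) : qpath :=
  exist (fun p => is_walk p.1 p.2) (v, [::]) isT.

Fact arrow_path_subproof (a : arrow Q) : is_walk (source a) [:: a].
Proof. by rewrite /= eqxx. Qed.
Definition arrow_path (a : arrow Q) : qpath :=
  exist (fun p => is_walk p.1 p.2) (source a, [:: a]) (arrow_path_subproof a).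

(* pq is first p then q; insub always succeeds in the first branch *)
Definition path_comp (p q : qpath) : option qpath :=
  if terminus p == origin q then insub (origin p, arrows p ++ arrows q)
  else None.

Lemma is_walk_cat u s s' :
  is_walk u (s ++ s') = is_walk u s && is_walk (walk_end u s) s'.
Proof. by elim: s u => //= a s IH u; rewrite IH andbA. Qed.

Lemma walk_end_cat u s s' : walk_end u (s ++ s') = walk_end (walk_end u s) s'.
Proof. by rewrite /walk_end map_cat last_cat. Qed.

Lemma path_compP p q r :
  path_comp p q = Some r <->
  terminus p = origin q /\ \val r = (origin p, arrows p ++ arrows q).
Proof.
rewrite /path_comp; case: eqP => [e|ne]; last by split=> // -[].
split=> [|[_ vr]]; first by case: insubP => //= r' _ vr' [<-].
by rewrite -vr valK.
Qed.

Lemma path_comp_ex p q :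
  terminus p = origin q -> exists r, path_comp p q = Some r.
Proof.
move=> e; have hw : is_walk (origin p) (arrows p ++ arrows q).
  by rewrite is_walk_cat (valP p) /= -/(terminus p) e; exact: (valP q).
exists (exist (fun p => is_walk p.1 p.2) (origin p, arrows p ++ arrows q) hw).
exact/path_compP.
Qed.

Lemma path_comp_origin p q r : path_comp p q = Some r -> origin r = origin p.
Proof. by rewrite /origin => /path_compP[_ ->]. Qed.

Lemma path_comp_terminus p q r :
  path_comp p q = Some r -> terminus r = terminus q.
Proof.
move=> /path_compP[e vr].
by rewrite /terminus /origin /arrows vr /= walk_end_cat -/(terminus p) e.
Qed.

Lemma path_comp_arrows p q r :
  path_comp p q = Some r -> arrows r = arrows p ++ arrows q.
Proof. by rewrite /arrows => /path_compP[_ ->]. Qed.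

Lemma path_compA p q r :
  obind (path_comp^~ r) (path_comp p q) = obind (path_comp p) (path_comp q r).
Proof.
case E1: (path_comp p q) => [u|]; case E2: (path_comp q r) => [v|] //=.
- have e2 : terminus q = origin r by have [] := (path_compP _ _ _).1 E2.
  have [w E3] : exists w, path_comp u r = Some w.
    by apply: path_comp_ex; rewrite (path_comp_terminus E1).
  rewrite E3; apply/esym/path_compP; split.
    rewrite (path_comp_origin E2); by have [] := (path_compP _ _ _).1 E1.
  have [_ ->] := (path_compP _ _ _).1 E3.
  rewrite (path_comp_origin E1) (path_comp_arrows E1) (path_comp_arrows E2).
  by rewrite catA.
- case E3: (path_comp u r) => [w|] //.
  have [e _] := (path_compP _ _ _).1 E3.
  have [] := @path_comp_ex q r; last by rewrite E2.
  by rewrite -(path_comp_terminus E1).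
- case E3: (path_comp p v) => [w|] //.
  have [e _] := (path_compP _ _ _).1 E3.
  have [] := @path_comp_ex p q; last by rewrite E1.
  by rewrite -(path_comp_origin E2).
Qed.

Lemma path_comp_trivl v p :
  path_comp (triv_path v) p = if v == origin p then Some p else None.
Proof.
case: eqP => [e|ne]; last by rewrite /path_comp /terminus /=; case: eqP.
apply/path_compP; split; first exact: e.
rewrite -[origin (triv_path v)]/v e /= /origin /arrows.
exact: surjective_pairing.
Qed.
Lemma path_comp_trivr v p :
  path_comp p (triv_path v) = if v == terminus p then Some p else None.
Proof.
case: eqP => [e|ne]; last by rewrite /path_comp /=; case: eqP => // /esym.
apply/path_compP; split; first by rewrite e.
rewrite [arrows (triv_path v)]/= cats0 /origin /arrows.
exact: surjective_pairing.
Qed.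

End Paths.

(* Ring laws from the multiplication table of a basis of paths; the product is
   kept abstract so that unification does not unfold it *)
Section PathLaws.
Variables (K : fieldType) (Q : quiver) (V : zmodType).
Variables (term : K -> qpath Q -> V) (mul : V -> V -> V).
Hypothesis term_ind : forall P : V -> Prop,
  P 0 -> (forall x y, P x -> P y -> P (x + y)) ->
  (forall a p, P (term a p)) -> forall x, P x.
Hypothesis mulDl : left_distributive mul +%R.
Hypothesis mulDr : right_distributive mul +%R.
Hypothesis mul0l : forall x, mul 0 x = 0.
Hypothesis mul0r : forall x, mul x 0 = 0.
Hypothesis mulUU : forall a b p q,
  mul (term a p) (term b q) =
  if path_comp p q is Some r then term (a * b) r else 0.

Lemma path_lawA : associative mul.
Proof.
move=> x y z; move: x; apply: term_ind => [|x x' hx hx'|a p].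
- by rewrite !mul0l.
- by rewrite !mulDl hx hx'.
move: y; apply: term_ind => [|y y' hy hy'|b q].
- by rewrite mul0l mul0r mul0l.
- by rewrite mulDl !mulDr hy hy' mulDl.
move: z; apply: term_ind => [|z z' hz hz'|c r].
- by rewrite !mul0r.
- by rewrite !mulDr hz hz'.
rewrite !mulUU; have := path_compA p q r.
case: (path_comp p q) => [u|]; case: (path_comp q r) => [v|] /= h.
- by rewrite !mulUU h mulrA.
- by rewrite mul0r mulUU h.
- by rewrite mul0l mulUU -h.
- by rewrite mul0r mul0l.
Qed.

Let one := \sum_(v : vertex Q) term 1 (triv_path v).

Lemma path_law1l : left_id one mul.
Proof.
apply: term_ind => [|x x' hx hx'|a p]; first exact: mul0r.
  by rewrite mulDr hx hx'.
rewrite (big_morph (mul^~ (term a p)) (fun x y => mulDl x y _) (mul0l _)).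
rewrite (bigD1 (origin p)) //= big1 => [|v nv].
  by rewrite mulUU path_comp_trivl eqxx mul1r addr0.
by rewrite mulUU path_comp_trivl (negPf nv).
Qed.

Lemma path_law1r : right_id one mul.
Proof.
apply: term_ind => [|x x' hx hx'|a p]; first exact: mul0l.
  by rewrite mulDl hx hx'.
rewrite (big_morph (mul (term a p)) (mulDr _) (mul0r _)).
rewrite (bigD1 (terminus p)) //= big1 => [|v nv].
  by rewrite mulUU path_comp_trivr eqxx mulr1 addr0.
by rewrite mulUU path_comp_trivr (negPf nv).
Qed.
End PathLaws.

Section PathAlgebra.
Variables (K : fieldType) (Q : quiver).

(* finite formal linear combinations of paths *)
Definition path_alg : Type := {malg K[qpath Q]}.
HB.instance Definition _ := GRing.Lmodule.on path_alg.

Definition path_term (c : K) (p : qpath Q) : path_alg := << c *g p >>.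
Definition path_elt (p : qpath Q) : path_alg := path_term 1 p.
Definition opath_elt (c : K) (o : option (qpath Q)) : path_alg :=
  if o is Some p then path_term c p else 0.

Definition path_one : path_alg := \sum_(v : vertex Q) path_elt (triv_path v).
Definition path_mul (x y : path_alg) : path_alg :=
  \sum_(p <- msupp x) \sum_(q <- msupp y)
    opath_elt (x@_p * y@_q) (path_comp p q).

Lemma opath_elt0 o : opath_elt 0 o = 0.
Proof. by case: o => //= p; rewrite /path_term monalgU0. Qed.
Lemma opath_eltD a b o : opath_elt (a + b) o = opath_elt a o + opath_elt b o.
Proof. by case: o => /= [p|]; rewrite /path_term ?monalgUD ?addr0. Qed.

Lemma path_mulw (d e : {fset qpath Q}) (x y : path_alg) :
  (msupp x `<=` d)%fset -> (msupp y `<=` e)%fset ->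
  path_mul x y = \sum_(p <- d) \sum_(q <- e)
    opath_elt (x@_p * y@_q) (path_comp p q).
Proof.
move=> hd he; rewrite /path_mul (big_fset_incl _ hd) /= => [|p _ /mcoeff_outdom xp].
  apply: eq_bigr => p _; rewrite (big_fset_incl _ he) //= => q _ /mcoeff_outdom yq.
  by rewrite yq mulr0 opath_elt0.
by rewrite big1 // => q _; rewrite xp mul0r opath_elt0.
Qed.

Fact path_mulDl : left_distributive path_mul +%R.
Proof.
move=> x y z; set d := (msupp x `|` msupp y)%fset.
rewrite (@path_mulw d (msupp z) x) ?fsubsetUl //.
rewrite (@path_mulw d (msupp z) y) ?fsubsetUr //.
rewrite (@path_mulw d (msupp z) (x + y)) ?msuppD_le //.
rewrite -big_split /=; apply: eq_bigr => p _; rewrite -big_split /=.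
by apply: eq_bigr => q _; rewrite mcoeffD mulrDl opath_eltD.
Qed.

Fact path_mulDr : right_distributive path_mul +%R.
Proof.
move=> x y z; set d := (msupp y `|` msupp z)%fset.
rewrite (@path_mulw (msupp x) d x y) ?fsubsetUl //.
rewrite (@path_mulw (msupp x) d x z) ?fsubsetUr //.
rewrite (@path_mulw (msupp x) d x (y + z)) ?msuppD_le //.
rewrite -big_split /=; apply: eq_bigr => p _; rewrite -big_split /=.
by apply: eq_bigr => q _; rewrite mcoeffD mulrDr opath_eltD.
Qed.

Lemma path_mul0l x : path_mul 0 x = 0.
Proof. by rewrite /path_mul msupp0 big_seq_fset0. Qed.
Lemma path_mul0r x : path_mul x 0 = 0.
Proof. by rewrite /path_mul msupp0 big1 // => p _; rewrite big_seq_fset0. Qed.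

Lemma path_mulUU a b p q :
  path_mul (path_term a p) (path_term b q) = opath_elt (a * b) (path_comp p q).
Proof.
rewrite (@path_mulw [fset p]%fset [fset q]%fset) ?msuppU_le //.
by rewrite !big_seq_fset1 !mcoeffUU.
Qed.

Lemma path_alg_ind (P : path_alg -> Prop) :
  P 0 -> (forall x y, P x -> P y -> P (x + y)) ->
  (forall a p, P (path_term a p)) -> forall x, P x.
Proof.
move=> P0 PD PU x; rewrite [x]monalgE; elim/big_ind: _ => // p _; exact: PU.
Qed.

Definition path_mulA : associative path_mul :=
  path_lawA path_alg_ind path_mulDl path_mulDr path_mul0l path_mul0r path_mulUU.
Definition path_mul1l : left_id path_one path_mul :=
  path_law1l path_alg_ind path_mulDl path_mulDr path_mul0l path_mul0r path_mulUU.
Definition path_mul1r : right_id path_one path_mul :=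
  path_law1r path_alg_ind path_mulDl path_mulDr path_mul0l path_mul0r path_mulUU.
HB.instance Definition _ := GRing.Zmodule_isPzRing.Build path_alg
  path_mulA path_mul1l path_mul1r path_mulDl path_mulDr.

Definition arrow_ideal : ideal path_alg :=
  ideal_gen [set x | exists a : arrow Q, x = path_elt (arrow_path a)].

(* A two-sided ideal of the ring KQ is automatically a K-subspace, as K acts
   through multiples of 1 *)
Definition admissible (I : ideal path_alg) : Prop :=
  exists n : nat, [/\ (2 <= n)%N,
    forall x, ideal_exp arrow_ideal n x -> I x
    & forall x, I x -> ideal_exp arrow_ideal 2 x].

End PathAlgebra.

Section Subquivers.
Variable Q : quiver.
Implicit Types (L : set (vertex Q)) (p : qpath Q).

Definition cycle_vertices : set (vertex Q) :=
  [set v | exists p, [/\ (0 < path_length p)%N, origin p = terminus p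
                       & v \in path_vertices p]].

Definition heart : set (vertex Q) :=
  cycle_vertices `|`
  [set v | exists p, [/\ cycle_vertices (origin p), cycle_vertices (terminus p)
                       & v \in path_vertices p]].

Definition sub_plus L : set (vertex Q) :=
  [set v | ~ L v /\ exists p, L (origin p) /\ terminus p = v].
Definition sub_minus L : set (vertex Q) :=
  [set v | ~ L v /\ exists p, origin p = v /\ L (terminus p)].
Definition sub_o L : set (vertex Q) :=
  [set v | ~ L v /\ forall p, ~ (L (origin p) /\ terminus p = v) /\
                              ~ (origin p = v /\ L (terminus p))].

Definition supported_path L p : Prop := forall v, v \in path_vertices p -> L v.

Definition longest_path_length L (t : nat) : Prop :=
  (L = set0 /\ t = 0%N) \/
  ((exists p, supported_path L p /\ path_length p = t) /\
   (forall p, supported_path L p -> (path_length p <= t)%N)).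

End Subquivers.
Arguments cycle_vertices : clear implicits.
Arguments heart : clear implicits.

Section BoundQuiver.
Variables (K : fieldType) (Q : quiver) (I : ideal (path_alg K Q)).

Definition bound_alg : pzRingType := quot_ring I.

Definition vertex_elt (v : vertex Q) : bound_alg :=
  \pi_(quot_ring I) (path_elt K (triv_path v)).

Definition compl_idem (L : set (vertex Q)) : bound_alg :=
  \sum_(v : vertex Q | v \notin L) vertex_elt v.

Definition compl_ideal (L : set (vertex Q)) : ideal bound_alg :=
  ideal_gen [set compl_idem L].

Definition assoc_alg (L : set (vertex Q)) : pzRingType :=
  quot_ring (compl_ideal L).

Definition supported (L : set (vertex Q)) (C : lmodType bound_alg^c) : Prop :=
  forall v, ~ L v -> forall x : C, (vertex_elt v : bound_alg^c) *: x = 0.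

Lemma supported_annihilated (L : set (vertex Q)) (C : lmodType bound_alg^c) :
  supported L C -> annihilated (compl_ideal L) C.
Proof.
move=> hC a x Ia.
pose J : set bound_alg := fun a => forall y : C, (a : bound_alg^c) *: y = 0.
suff JI : is_ideal J /\ [set compl_idem L] `<=` J by apply: (Ia J).
split; last first.
  move=> _ -> y; rewrite [LHS]scaler_suml big1 // => v vL.
  by apply: hC; apply: contraNnot vL => vL; rewrite in_setE.
split=> [y|b c Jb Jc y|b c Jc]; first exact: scale0r.
  by rewrite [LHS]scalerBl Jb Jc subr0.
split=> y; first by rewrite -[_ *: _](scalerA (c : bound_alg^c) b) Jc.
by rewrite -[_ *: _](scalerA (b : bound_alg^c) c) Jc scaler0.
Qed.

Definition as_assoc_mod (L : set (vertex Q)) (C : lmodType bound_alg^c)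
    (hC : supported L C) : lmodType (assoc_alg L)^c :=
  descend (supported_annihilated hC).

Definition as_assoc_map (L : set (vertex Q)) (C D : lmodType bound_alg^c)
    (hC : supported L C) (hD : supported L D) (f : {linear C -> D}) :
    {linear as_assoc_mod hC -> as_assoc_mod hD} :=
  descend_map _ _ f.

End BoundQuiver.

Section HeartParts.
Variables (K : fieldType) (Q : quiver) (I : ideal (path_alg K Q)).
Local Notation Lam := (bound_alg I).

(* C^+: the sum of all submodules supported in H^+, which is the largest one *)
Definition mod_plus (C : lmodType Lam^c) : submodClosed C :=
  submod_sum (fun S : submodClosed C =>
    supported (sub_plus (heart Q)) (submod S)).

(* C_-: the intersection of all S with C/S supported in H^-, which is the
   smallest one *)
Definition mod_minus (C : lmodType Lam^c) : submodClosed C :=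
  submod_inter (fun S : submodClosed C =>
    supported (sub_minus (heart Q)) (quotmod S)).

Section Functoriality.
Variables (C D : lmodType Lam^c) (f : {linear C -> D}).

Lemma mod_plus_map x : x \in mod_plus C -> f x \in mod_plus D.
Proof.
move=> /asboolP hx; apply/asboolP => T hT.
apply: (hx (preim_sub f T)) => S hS y yS.
pose fS := f \o (\val : {linear submod S -> C}).
have yfS : f y \in im_sub fS by apply/asboolP; exists (exist _ y yS).
apply: (hT (im_sub fS)) yfS => v vL [z zfS]; apply: val_inj.
have [s hs] : exists s, fS s = z by apply/asboolP.
rewrite [LHS]/= -hs -linearZ (hS v vL s); exact: linear0.
Qed.

Lemma mod_minus_map x : x \in mod_minus C -> f x \in mod_minus D.
Proof.
move=> /asboolP hx; apply/asboolP => S hS; apply: (hx (preim_sub f S)).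
move=> v vL z; rewrite -[z]reprK -[\pi_(quotmod _) _]/(quotmod_pi _ (repr z)).
rewrite -linearZ -[RHS](linear0 (quotmod_pi (preim_sub f S))).
apply/quotmod_eqP; rewrite subr0 -[_ \in _]/(f _ \in S) linearZ /=.
have := hS v vL (quotmod_pi S (f (repr z))).
rewrite -linearZ -[RHS](linear0 (quotmod_pi S)) => /quotmod_eqP.
by rewrite subr0.
Qed.

End Functoriality.

Definition A_mod (t : nat) (M : lmodType Lam^c) (P : proj_res M) :
    lmodType Lam^c :=
  quotmod (mod_plus (syzygy P t.+1)).

Definition B_mod (t : nat) (N : lmodType Lam^c) (E : inj_cores N) :
    lmodType Lam^c :=
  submod (mod_minus (cosyzygy E t.+1)).

Definition A_map (t : nat) (M M' : lmodType Lam^c)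
    (P : proj_res M) (P' : proj_res M') (f : {linear M -> M'})
    (c : chain_map P P' f) : {linear A_mod t P -> A_mod t P'} :=
  quotmod_map (@mod_plus_map _ _ (syzygy_map c t.+1)).

Definition B_map (t : nat) (N N' : lmodType Lam^c)
    (E : inj_cores N) (E' : inj_cores N') (g : {linear N -> N'})
    (d : cochain_map E E' g) : {linear B_mod t E -> B_mod t E'} :=
  submod_map (@mod_minus_map _ _ (cosyzygy_map d t.+1)).

End HeartParts.

(* Main.v *)
(** Write H+ and H- for the vertices strictly after and strictly before the heart H,
   and U for the union of H and H+.  The set U is closed under successors, and the
   paths avoiding H have length at most t.

   Sending a module X to X/X+ is an exact functor; on modules supported on U it
   takes values in Gamma-modules and preserves projectives.  A Lambda-module has,
   after t+1 steps of a resolution whose terms are minimal outside U, a syzygy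
   supported on U, and a module supported on H+ has projective dimension at most
   t+1.  If X is supported on U and X/X+ is projective over Gamma, then lifting an
   idempotent yields a cover of X whose kernel is supported on H+.  Hence the
   Lambda-dimension of X and the Gamma-dimension of X/X+ differ by a bounded
   amount, which gives (1) and (2).

   For (3), the tail of a minimal projective resolution P of M is supported on U,
   so its quotient by P+ is a Gamma-projective resolution of A_M.  Dually, the
   cosyzygy Y of N is supported on the union of H and H-, hence Hom(P_k, Y) is
   Hom over Gamma from P_k/P_k+ to Y_- = B_N.  Dimension shifting in N does the rest. *)

Require Import Defs.
From HB Require Import structures.
From mathcomp Require Import all_boot all_algebra generic_quotient.
From mathcomp Require Import boolp classical_sets finmap monalg.

Set Implicit Arguments.
Unset Strict Implicit.
Unset Printing Implicit Defensive.

Import GRing.Theory.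
Local Open Scope ring_scope.
Local Open Scope quotient_scope.
Local Open Scope classical_set_scope.

(** * Linear maps, submodules and quotients *)

Section LinearMaps.
Variable R : pzRingType.
Implicit Types M N A B C E : lmodType R.

(** Statements about supports reduce to the vertex idempotents. As [H+] is successor-closed, [X+] is
    cut out by [x e_v = 0] for [v] outside [H+]; as a vector space [X/X+] is thus the sum of the
    [X e_v] over these [v], and exactness is read off from that. The modules in (1) are arbitrary,
    so no projective covers are invoked: covers are generated by homogeneous vectors forming a basis
    over [K], which makes them minimal at the vertices to be removed, and Schanuel's lemma disposes
    of the choices. For (2) the same covers preserve finite generation. The number [t+1] counts the
    lengths [0, ..., t] of paths avoiding [H]: each syzygy removes the vertices attached to one
    length. In (3), [t+1] degrees are spent on cosyzygies of [N] and [t+1] on truncating the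
    resolution of [M]; the bound [2t+3] keeps the remaining degree positive. This matters because
    shifting from [Hom] to [Ext^1] is onto but not injective. *)

Definition mk_linear M N (f : M -> N) (hf : linear f) : {linear M -> N} :=
  HB.pack f (GRing.isLinear.Build R M N _ f hf).

Lemma linear_injP M N (f : {linear M -> N}) :
  (forall x, f x = 0 -> x = 0) -> injective f.
Proof.
move=> h x y e; apply/eqP; rewrite -subr_eq0; apply/eqP/h.
by rewrite linearB e subrr.
Qed.

Lemma quotmod_pi_surj M (S : submodClosed M) q :
  exists x, quotmod_pi S x = q.
Proof. by exists (repr q); exact: reprK. Qed.

Lemma quotmod_pi_eq0 M (S : submodClosed M) x :
  quotmod_pi S x = 0 <-> x \in S.
Proof.
rewrite -(linear0 (quotmod_pi S)); split=> [/quotmod_eqP|h]; rewrite ?subr0 //.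
by apply/quotmod_eqP; rewrite subr0.
Qed.

Lemma quotmod_lift M N (S : submodClosed M) (f : {linear M -> N}) :
  (forall x, x \in S -> f x = 0) ->
  exists h : {linear quotmod S -> N}, forall x, h (quotmod_pi S x) = f x.
Proof.
move=> hf; pose h (q : quotmod S) := f (repr q).
have hpi x : h (quotmod_pi S x) = f x.
  apply/eqP; rewrite -subr_eq0 -linearB; apply/eqP/hf.
  by apply/quotmod_eqP; exact: reprK.
have hl : linear h.
  move=> a p q; have [x <-] := quotmod_pi_surj p.
  by have [y <-] := quotmod_pi_surj q; rewrite -linearP !hpi linearP.
by exists (mk_linear hl).
Qed.

Lemma linear_corestrict A B C (i : {linear B -> C}) (f : {linear A -> C}) :
  injective i -> (forall a, exists b, i b = f a) ->
  exists h : {linear A -> B}, forall a, i (h a) = f a.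
Proof.
move=> ii /choice[h hh]; have hl : linear h.
  by move=> a x y; apply: ii; rewrite linearP !hh linearP.
by exists (mk_linear hl).
Qed.

Definition in_submod M (S : submodClosed M) x (hx : x \in S) : submod S :=
  exist (fun y => y \in S) x hx.

Lemma linear_to_submod A M (S : submodClosed M) (f : {linear A -> M}) :
  (forall a, f a \in S) ->
  exists h : {linear A -> submod S}, forall a, \val (h a) = f a.
Proof.
move=> fS; have [|h hh] := @linear_corestrict A (submod S) M \val f val_inj.
  by move=> a; exists (in_submod (fS a)).
by exists h.
Qed.

(** Both maps factor through [A / ker d], where [d] becomes injective; so injectivity of [E] also
    serves along maps with a kernel. *)
Lemma injective_extension A B E (d : {linear A -> B}) (f : {linear A -> E}) :
  injective_mod E -> (forall a, d a = 0 -> f a = 0) ->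
  exists h : {linear B -> E}, forall a, h (d a) = f a.
Proof.
move=> injE df.
have [i hi] : exists i : {linear quotmod (ker_sub d) -> B},
    forall a, i (quotmod_pi _ a) = d a.
  by apply: quotmod_lift => x /eqP.
have [g hg] : exists g : {linear quotmod (ker_sub d) -> E},
    forall a, g (quotmod_pi _ a) = f a.
  by apply: quotmod_lift => x /eqP /df.
have [|h hh] := injE _ _ i g.
  apply: linear_injP => q; have [a <-] := quotmod_pi_surj q.
  by rewrite hi => da; apply/quotmod_pi_eq0/eqP.
by exists h => a; rewrite -hi hh hg.
Qed.

Lemma linear_inverse M N (f : {linear M -> N}) :
  injective f -> (forall y, exists x, f x = y) ->
  exists g : {linear N -> M}, cancel f g /\ cancel g f.
Proof.
move=> fi fs; have [g hg] := @linear_corestrict N M N f idfun fi fs.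
by exists g; split=> [x|x]; [apply: fi; rewrite hg | exact: hg].
Qed.

End LinearMaps.

(** * Projective dimension *)

Section ProjectiveDimension.
Variable R : pzRingType.
Implicit Types M N A B C P Q X Z : lmodType R.

Lemma projective_retract P Q (i : {linear P -> Q}) (r : {linear Q -> P}) :
  cancel i r -> projective Q -> projective P.
Proof.
move=> ir pQ M N g f gs; have [h hh] := pQ M N g (f \o r) gs.
by exists (h \o i) => x /=; rewrite hh /= ir.
Qed.

Lemma projective_prod P Q : projective P -> projective Q ->
  projective (P * Q)%type.
Proof.
move=> pP pQ M N g f gs.
have inl_lin : linear (fun p : P => (p, 0) : (P * Q)%type).
  by move=> a x y; congr pair; rewrite /= scaler0 addr0.
have inr_lin : linear (fun q : Q => (0, q) : (P * Q)%type).
  by move=> a x y; congr pair; rewrite /= scaler0 addr0.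
have [h1 hh1] := pP M N g (f \o mk_linear inl_lin) gs.
have [h2 hh2] := pQ M N g (f \o mk_linear inr_lin) gs.
exists ((h1 \o fst) \+ (h2 \o snd)) => -[p q] /=.
rewrite linearD hh1 hh2 /= -linearD; congr (f _); congr pair;
  by rewrite /= ?addr0 ?add0r.
Qed.

Lemma projective_zero P : (forall x : P, x = 0) -> projective P.
Proof.
move=> P0 M N g f _; exists \0 => x /=.
by rewrite (P0 x) !linear0.
Qed.

Definition short_exact Z P M (i : {linear Z -> P}) (g : {linear P -> M}) :=
  [/\ injective i, forall y, exists x, g x = y
    & forall x, g x = 0 <-> exists z, i z = x].

Lemma short_exact_ker P M (g : {linear P -> M}) :
  (forall y, exists x, g x = y) ->
  short_exact (\val : {linear submod (ker_sub g) -> P}) g.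
Proof.
move=> gs; split=> //; first exact: val_inj.
move=> x; split=> [gx|[[z hz] <-]]; last exact/eqP.
by exists (in_submod (S := ker_sub g) (introT eqP gx)).
Qed.

Lemma projective_section P M (g : {linear P -> M}) : projective M ->
  (forall y, exists x, g x = y) -> exists s : {linear M -> P}, cancel s g.
Proof. by move=> pM gs; have [s hs] := pM P M g idfun gs; exists s. Qed.

(** For a section [s] of [g], the map [x - s (g x)] retracts [P] onto [Z]. *)
Lemma projective_kernel Z P M (i : {linear Z -> P}) (g : {linear P -> M}) :
  short_exact i g -> projective P -> projective M -> projective Z.
Proof.
move=> [ii gs ex] pP pM; have [s sg] := projective_section pM gs.
have [|r hr] := @linear_corestrict _ P Z P i (idfun \- (s \o g)) ii.
  by move=> p; apply/ex; rewrite /= linearB /= sg subrr.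
apply: (@projective_retract _ _ i r) pP => z; apply: ii; rewrite hr /=.
by have -> : g (i z) = 0; [apply/ex; exists z | rewrite linear0 subr0].
Qed.

Lemma projective_extension Z P M (i : {linear Z -> P}) (g : {linear P -> M}) :
  short_exact i g -> projective Z -> projective M -> projective P.
Proof.
move=> [ii gs ex] pZ pM; have [s sg] := projective_section pM gs.
have [|r hr] := @linear_corestrict _ P Z P i (idfun \- (s \o g)) ii.
  by move=> p; apply/ex; rewrite /= linearB /= sg subrr.
have to_lin : linear (fun p => (r p, g p) : (Z * M)%type).
  by move=> a x y; rewrite !linearP.
pose from : {linear (Z * M)%type -> P} := (i \o fst) \+ (s \o snd).
apply: (@projective_retract _ _ (mk_linear to_lin) from).
  by move=> p; rewrite /from /= hr /= subrK.
exact: projective_prod.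
Qed.

(** Projective dimension by recursion on one syzygy, which suits induction better than whole
    resolutions. [pd_leP] identifies it with [pd_le], and [schanuel] shows that the choice of syzygy
    is immaterial. *)
Fixpoint pdim n M : Prop :=
  if n is m.+1 then
    exists Z P (i : {linear Z -> P}) (g : {linear P -> M}),
      [/\ short_exact i g, projective P & pdim m Z]
  else projective M.

Lemma pdim_iso n M N (f : {linear M -> N}) :
  injective f -> (forall y, exists x, f x = y) -> pdim n M -> pdim n N.
Proof.
move=> fi fs; case: n => [|n] /=.
  have [g [fg gf]] := linear_inverse fi fs.
  exact: (@projective_retract _ _ g f).
move=> [Z [P [i [g [[ii gs ex] pP pZ]]]]]; exists Z, P, i, (f \o g); split=> //.
split=> // [y|x] /=.
  by have [m <-] := fs y; have [x <-] := gs m; exists x.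
by rewrite -ex; split=> [|->]; rewrite ?linear0 // -[RHS](linear0 f) => /fi.
Qed.

(** The extension splits. From left to right, [P] is added to a cover of [Z]; from right to left, a
    cover [F] of [X] is restricted to the kernel of [F -> P]. The syzygy [Y] is the same in both
    cases. *)
Lemma pdim_ext_proj n Z X P (i : {linear Z -> X}) (g : {linear X -> P}) :
  short_exact i g -> projective P -> pdim n Z <-> pdim n X.
Proof.
move=> ex pP; case: n => [|n] /=.
  split=> h; first exact: projective_extension ex h pP.
  exact: projective_kernel ex h pP.
have [ii gs ig] := ex; have gi z : g (i z) = 0 by apply/ig; exists z.
split=> [[Y [F [j [f [[ji fs jf] pF pY]]]]]|[Y [F [j [f [[ji fs jf] pF pY]]]]]].
  have [s sg] := projective_section pP gs.
  have j'_lin : linear (fun y => (j y, 0) : (F * P)%type).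
    by move=> a x y; rewrite linearP; congr pair; rewrite /= scaler0 addr0.
  exists Y, (F * P)%type, (mk_linear j'_lin), (((i \o f) \o fst) \+ (s \o snd)).
  split=> //; last exact: projective_prod.
  split=> [x y [/ji]|x|[u p]] //=.
    have [|z hz] := (ig (x - s (g x))).1; first by rewrite linearB /= sg subrr.
    by have [u hu] := fs z; exists (u, g x); rewrite /= hu hz subrK.
  split=> [e|[y [<- <-]]]; last first.
    by have -> : f (j y) = 0; [apply/jf; exists y | rewrite !linear0 addr0].
  have p0 : p = 0 by rewrite -(sg p) -[RHS](linear0 g) -e linearD /= gi add0r.
  move: e; rewrite p0 linear0 addr0 -[RHS](linear0 i) => /ii /jf[y <-].
  by exists y.
have exF : short_exact (\val : {linear submod (ker_sub (g \o f)) -> F}) (g \o f).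
  apply: short_exact_ker => y; have [x <-] := gs y.
  by have [u <-] := fs x; exists u.
have [|j' hj'] := @linear_to_submod _ Y F (ker_sub (g \o f)) j.
  move=> y; apply/eqP => /=.
  by have -> : f (j y) = 0; [apply/jf; exists y | rewrite linear0].
have [|f' hf'] := @linear_corestrict _ (submod (ker_sub (g \o f))) Z X i
    (f \o \val) ii.
  by move=> [u hu] /=; apply/ig; exact/eqP.
exists Y, (submod (ker_sub (g \o f))), j', f'; split=> //; last first.
  exact: projective_kernel exF pF pP.
split=> [x y e|z|u].
- by apply: ji; rewrite -!hj' e.
- have [u hu] := fs (i z).
  have gfu : u \in ker_sub (g \o f) by apply/eqP; rewrite /= hu gi.
  by exists (in_submod gfu); apply: ii; rewrite hf'.
- have -> : f' u = 0 <-> f (\val u) = 0.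
    rewrite -[f (\val u)]hf'; split=> [->|]; first exact: linear0.
    by rewrite -[RHS](linear0 i) => /ii.
  rewrite jf; split=> [[y hy]|[y <-]]; exists y; rewrite -?hj' //.
  by apply: val_inj; rewrite hj'.
Qed.

Section Schanuel.
Variables (M Z P Z' P' : lmodType R).
Variables (i : {linear Z -> P}) (g : {linear P -> M}).
Variables (i' : {linear Z' -> P'}) (g' : {linear P' -> M}).
Hypotheses (ex : short_exact i g) (ex' : short_exact i' g').

Let diff : {linear (P * P')%type -> M} := (g \o fst) \- (g' \o snd).
Let pullback := submod (ker_sub diff).

Lemma pullback_short_exact :
  exists j : {linear Z' -> pullback},
    short_exact j (fst \o (\val : {linear pullback -> _})).
Proof.
have [ii gs ig] := ex; have [ii' gs' ig'] := ex'.
have in_lin : linear (fun z => (0, i' z) : (P * P')%type).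
  by move=> a x y; rewrite linearP; congr pair; rewrite /= scaler0 addr0.
have [|j hj] := @linear_to_submod _ Z' _ (ker_sub diff) (mk_linear in_lin).
  move=> z; apply/eqP; rewrite /= linear0 sub0r.
  by have -> : g' (i' z) = 0; [apply/ig'; exists z | rewrite oppr0].
exists j; split=> [x y e|p|[[p p'] /= hp]].
- by have := congr1 (fun u => (\val u).2) e; rewrite /= !hj => /ii'.
- have [p' hp'] := gs' (g p).
  have h : (p, p') \in ker_sub diff by apply/eqP; rewrite /= hp' subrr.
  by exists (in_submod h).
- have e : g p = g' p' by apply/eqP; rewrite -subr_eq0.
  split=> [/= p0|[z /(congr1 \val)]]; last by rewrite hj => -[].
  have [|z hz] := (ig' p').1; first by rewrite -e p0 linear0.
  by exists z; apply: val_inj; rewrite hj /= p0 hz.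
Qed.

End Schanuel.

(** The pullback of the two covers is an extension of [P] by [Z'] and, after swapping the factors,
    of [P'] by [Z]; [pdim_ext_proj] applies to both. *)
Lemma schanuel n M Z P Z' P' (i : {linear Z -> P}) (g : {linear P -> M})
    (i' : {linear Z' -> P'}) (g' : {linear P' -> M}) :
  short_exact i g -> short_exact i' g' -> projective P -> projective P' ->
  pdim n Z -> pdim n Z'.
Proof.
move=> ex ex' pP pP' pZ.
have [j exj] := pullback_short_exact ex ex'.
have [k exk] := pullback_short_exact ex' ex.
apply/(pdim_ext_proj n exj pP).
have := (pdim_ext_proj n exk pP').1 pZ.
set D := ker_sub _; set D' := ker_sub _.
have sw_lin : linear (fun u : submod D => ((\val u).2, (\val u).1) : (P * P')%type).
  by move=> a x y.
have [|s hs] := @linear_to_submod _ _ _ D' (mk_linear sw_lin).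
  move=> [[p' p] h]; have /= hp := eqP h; apply/eqP => /=.
  by rewrite -[RHS]oppr0 -hp opprB.
apply: (@pdim_iso n _ _ s) => [x y e|[[p p'] h']].
  have := congr1 \val e; rewrite !hs /= => -[e2 e1]; apply: val_inj.
  by rewrite [\val x]surjective_pairing [\val y]surjective_pairing e1 e2.
have h : (p', p) \in D.
  by have /= hp := eqP h'; apply/eqP; rewrite /= -[RHS]oppr0 -hp opprB.
by exists (in_submod h); apply: val_inj; rewrite hs.
Qed.

Lemma pdim_syzygyS n Z P M (i : {linear Z -> P}) (g : {linear P -> M}) :
  short_exact i g -> projective P -> pdim n.+1 M -> pdim n Z.
Proof.
move=> ex pP [Z' [P' [i' [g' [ex' pP' pZ']]]]].
exact: schanuel ex' ex pP' pP pZ'.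
Qed.

Lemma pdim_weaken n M : pdim n M -> pdim n.+1 M.
Proof.
elim: n M => [|n IH] M /=; last first.
  by move=> [Z [P [i [g [ex pP /IH pZ]]]]]; exists Z, P, i, g.
move=> pM; exists (submod (ker_sub (idfun : {linear M -> M}))), M, \val, idfun.
split=> //; first by apply: short_exact_ker => y; exists y.
by apply: projective_zero => -[x hx]; apply: val_inj; exact/eqP.
Qed.

Lemma pdim_syzygy n Z P M (i : {linear Z -> P}) (g : {linear P -> M}) :
  short_exact i g -> projective P -> pdim n M -> pdim n Z.
Proof. by move=> ex pP /pdim_weaken; exact: pdim_syzygyS ex pP. Qed.

Section Splice.
Variables (Z P M : lmodType R) (i : {linear Z -> P}) (g : {linear P -> M}).
Hypotheses (ex : short_exact i g) (pP : projective P).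
Variable F : proj_res Z.

Definition splice_obj n : lmodType R := if n is m.+1 then F m else P.
Definition splice_d n : {linear splice_obj n.+1 -> splice_obj n} :=
  match n with 0%N => i \o pr_aug F | m.+1 => pr_d F m end.

Lemma splice_projective n : projective (splice_obj n).
Proof. by case: n => // n; exact: pr_projective. Qed.

Lemma splice_exact0 x : g x = 0 <-> exists y, splice_d 0 y = x.
Proof.
have [ii gs ->] := ex; split=> [[z <-]|[y <-]]; last by exists (pr_aug F y).
by have [y <-] := pr_aug_surj F z; exists y.
Qed.

Lemma splice_exact n x :
  splice_d n x = 0 <-> exists y, splice_d n.+1 y = x.
Proof.
have [ii _ _] := ex; case: n x => [|n] x /=; last exact: pr_exact.
rewrite -pr_exact0; split=> [|->]; last exact: linear0.
by rewrite -[RHS](linear0 i) => /ii.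
Qed.

Definition splice : proj_res M :=
  @ProjRes R M splice_obj g splice_d splice_projective
    (let: And3 _ gs _ := ex in gs) splice_exact0 splice_exact.
End Splice.

Section TailResolution.
Variables (M : lmodType R) (F : proj_res M).

Lemma tail_aug : exists a : {linear F 1%N -> submod (ker_sub (pr_aug F))},
  forall x, \val (a x) = pr_d F 0 x.
Proof. by apply: linear_to_submod => x; apply/eqP/pr_exact0; exists x. Qed.

Definition tail_aug_map := projT1 (cid tail_aug).
Lemma tail_augE x : \val (tail_aug_map x) = pr_d F 0 x.
Proof. exact: (projT2 (cid tail_aug)). Qed.

Lemma tail_aug_surj y : exists x, tail_aug_map x = y.
Proof.
have [x hx] := (pr_exact0 (p := F) (\val y)).1 (eqP (valP y)).
by exists x; apply: val_inj; rewrite tail_augE.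
Qed.

Lemma tail_exact0 x : tail_aug_map x = 0 <-> exists y, pr_d F 1 y = x.
Proof.
rewrite -pr_exact -tail_augE; split=> [-> //|h].
by apply: val_inj; rewrite h.
Qed.

Definition tail_res : proj_res (submod (ker_sub (pr_aug F))) :=
  @ProjRes R _ (fun n => F n.+1) tail_aug_map (fun n => pr_d F n.+1)
    (fun n => @pr_projective _ _ F n.+1) tail_aug_surj tail_exact0
    (fun n => @pr_exact _ _ F n.+1).
End TailResolution.

Section ZeroTail.
Variable M : lmodType R.
Hypothesis pM : projective M.
Let O : lmodType R := submod (ker_sub (idfun : {linear M -> M})).

Lemma zero_tail_eq0 (x : O) : x = 0.
Proof. by apply: val_inj; exact: (eqP (valP x)). Qed.

Definition stalk_obj n : lmodType R := if n is m.+1 then O else M.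
Definition stalk_d n : {linear stalk_obj n.+1 -> stalk_obj n} := \0.

Lemma stalk_projective n : projective (stalk_obj n).
Proof. by case: n => // n; exact: projective_zero zero_tail_eq0. Qed.

Lemma stalk_exact0 (x : M) : idfun x = 0 <-> exists y, stalk_d 0 y = x.
Proof. by split=> [/= -> | [y <-]] //; exists 0. Qed.

Lemma stalk_exact n x : stalk_d n x = 0 <-> exists y, stalk_d n.+1 y = x.
Proof. by split=> // _; exists 0; rewrite [LHS]linear0 [RHS]zero_tail_eq0. Qed.

Definition stalk_res : proj_res M :=
  @ProjRes R M stalk_obj idfun stalk_d stalk_projective
    (fun y => ex_intro _ y erefl) stalk_exact0 stalk_exact.
End ZeroTail.

Lemma pd_leP M n : pd_le M n <-> pdim n M.
Proof.
split; elim: n M => [|n IH] M.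
- move=> [F F0]; apply: (@pdim_iso 0 _ _ (pr_aug F)).
  + apply: linear_injP => x /pr_exact0[y <-].
    by rewrite (F0 1%N isT y) linear0.
  + exact: pr_aug_surj.
  + exact: pr_projective.
- move=> [F F0]; exists (submod (ker_sub (pr_aug F))), (F 0%N), \val, (pr_aug F).
  split; [exact: short_exact_ker (@pr_aug_surj _ _ F) | exact: pr_projective |].
  by apply: IH; exists (tail_res F) => k nk; exact: (F0 k.+1 nk).
- by move=> pM; exists (stalk_res pM) => -[//|k] _ x; exact: zero_tail_eq0.
- move=> [Z [P [i [g [ex pP /IH[F F0]]]]]].
  by exists (splice ex pP F) => -[//|k] nk x; exact: (F0 k nk x).
Qed.

End ProjectiveDimension.

(** * Independence of Ext from the resolution *)

Definition mk_additive (U V : zmodType) (f : U -> V) (hf : zmod_morphism f) :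
    {additive U -> V} :=
  HB.pack f (GRing.isZmodMorphism.Build U V f hf).

Section ExtComparison.
Variable R : pzRingType.
Implicit Types M N : lmodType R.

Lemma pr_bd_exact M (P : proj_res M) n x :
  pr_bd P n x = 0 <-> exists y, pr_d P n y = x.
Proof. by case: n x => [|n] x; [exact: pr_exact0 | exact: pr_exact]. Qed.

Lemma pr_bd_d M (P : proj_res M) n x : pr_bd P n (pr_d P n x) = 0.
Proof. by apply/pr_bd_exact; exists x. Qed.

(** Both maps are corestricted to the image of [d], so [d] need not be onto. *)
Lemma projective_lift (A B C : lmodType R) (d : {linear B -> C})
    (f : {linear A -> C}) :
  projective A -> (forall x, exists y, d y = f x) ->
  exists h : {linear A -> B}, forall x, d (h x) = f x.
Proof.
move=> pA hf.
have [|d' hd'] := @linear_to_submod R B C (im_sub d) d.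
  by move=> b; apply/asboolP; exists b.
have [|f' hf'] := @linear_to_submod R A C (im_sub d) f.
  by move=> a; apply/asboolP.
have [|h hh] := pA _ _ d' f'.
  move=> [y hy]; have /asboolP[x dx] := hy.
  by exists x; apply: val_inj; rewrite hd'.
by exists h => x; rewrite -hd' hh hf'.
Qed.

Section Class.
Variables (M N : lmodType R) (P : proj_res M).

Definition ext_class n (z : cocycle P N n) : Ext_of P n N := \pi_(Ext_of P n N) z.

Lemma ext_class_surj n (xi : Ext_of P n N) : exists z, ext_class z = xi.
Proof. by exists (repr xi); exact: reprK. Qed.

Lemma ext_class_eqP n (z w : cocycle P N n) :
  ext_class z = ext_class w <-> z - w \in @coboundary_pred R M P n N.
Proof. rewrite Quotient.idealrBE; exact: (rwP eqP). Qed.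

Lemma ext_classB n (z w : cocycle P N n) :
  ext_class (z - w) = ext_class z - ext_class w.
Proof.
rewrite /ext_class; apply/esym; rewrite -[RHS]/(\pi_(Ext_of P n N) (z - w)).
by rewrite Quotient.pi_add Quotient.pi_opp.
Qed.

(** In positive degree a coboundary is a map factoring through the differential, whereas degree [0]
    has its own clause; hence the degrees [n.+1] in the comparison results below. *)
Lemma ext_class_eqSP n (z w : cocycle P N n.+1) :
  ext_class z = ext_class w <->
  exists y : {linear P n -> N},
    forall x, cocycle_fun z x - cocycle_fun w x = y (pr_d P n x).
Proof. by rewrite ext_class_eqP; split=> [/asboolP|h]; last exact/asboolP. Qed.

Lemma cocycle_d n (z : cocycle P N n) x : cocycle_fun z (pr_d P n x) = 0.
Proof. by have /asboolP := valP z. Qed.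

Lemma cocycle_funB n (z w : cocycle P N n) x :
  cocycle_fun (z - w) x = cocycle_fun z x - cocycle_fun w x.
Proof. by []. Qed.

Lemma mk_cocycle n (z : {linear P n -> N}) : (forall x, z (pr_d P n x) = 0) ->
  exists w : cocycle P N n, forall x, cocycle_fun w x = z x.
Proof.
move=> hz; have h : (z : Defs.hom (P n) N) \in @cocycle_pred R M P N n by apply/asboolP.
by exists (exist (fun z => z \in @cocycle_pred R M P N n) (z : Defs.hom (P n) N) h).
Qed.

End Class.

Lemma Ext_of_map_class M M' (P : proj_res M) (P' : proj_res M')
    (f : {linear M -> M'}) (c : chain_map P P' f) N N' (g : {linear N -> N'})
    n (z : cocycle P' N n.+1) :
  Ext_of_map c g (ext_class z) = ext_class (cocycle_map c g z).
Proof.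
have /ext_class_eqSP[y hy] : ext_class (repr (ext_class z)) = ext_class z.
  exact: reprK.
apply/ext_class_eqSP; exists (g \o (y \o c n)) => x /=.
rewrite -linearB hy; congr (g (y _)).
exact: (cm_comm c (n := n.+1) x).
Qed.

(** The conclusion only says that the remaining defect is a cycle. By exactness it is then a
    boundary, which is what lets the next component be lifted, and a cocycle vanishes on it, which
    is all that [Ext] needs. *)
Lemma chain_map_homotopy M M' (P : proj_res M) (P' : proj_res M')
    (f1 f2 : {linear M -> M'}) (c1 : chain_map P P' f1) (c2 : chain_map P P' f2)
    n :
  f1 =1 f2 -> exists h : {linear pr_tgt P n -> P' n},
    forall x, pr_bd P' n (c1 n x - c2 n x - h (pr_bd P n x)) = 0.
Proof.
move=> e; elim: n => [|n [h hh]].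
  by exists \0 => x; rewrite /= subr0 linearB !(cm_comm _ (n := 0%N)) /= e subrr.
have [|h' hh'] := @projective_lift _ _ _ (pr_d P' n)
    ((c1 n \- c2 n) \- (h \o pr_bd P n)) (@pr_projective _ _ P n).
  by move=> x; apply/pr_bd_exact; exact: hh.
exists h' => x; rewrite !linearB !(cm_comm _ (n := n.+1)) /= hh' /=.
by rewrite pr_bd_d linear0 subr0 subrr.
Qed.

Lemma Ext_of_map_homotopy M M' (P : proj_res M) (P' : proj_res M')
    (f1 f2 : {linear M -> M'}) (c1 : chain_map P P' f1) (c2 : chain_map P P' f2)
    N N' (g1 g2 : {linear N -> N'}) n (xi : Ext_of P' n.+1 N) :
  f1 =1 f2 -> g1 =1 g2 -> Ext_of_map c1 g1 xi = Ext_of_map c2 g2 xi.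
Proof.
move=> e eg; have [z <-] := ext_class_surj xi; rewrite !Ext_of_map_class.
have [h hh] := chain_map_homotopy c1 c2 n.+1 e.
apply/ext_class_eqSP; exists (g1 \o (cocycle_fun z \o h)) => x /=.
have /pr_bd_exact[y hy] := hh x.
have := cocycle_d z y; rewrite hy !linearB => /eqP; rewrite subr_eq0 => /eqP <-.
by rewrite linearB -eg.
Qed.

Section Composition.
Variables (M M' M'' : lmodType R).
Variables (P : proj_res M) (P' : proj_res M') (P'' : proj_res M'').
Variables (f : {linear M -> M'}) (f' : {linear M' -> M''}).
Variables (c : chain_map P P' f) (c' : chain_map P' P'' f').

Lemma chain_map_comp_comm n x :
  pr_bd P'' n ((c' n \o c n) x) =
  pr_tgt_map (f' \o f) (fun n => c' n \o c n) n (pr_bd P n x).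
Proof. by case: n x => [|n] x; rewrite /= !(cm_comm _ _) /=. Qed.

Definition chain_map_comp : chain_map P P'' (f' \o f) :=
  ChainMap chain_map_comp_comm.

Lemma Ext_of_map_comp N N' N'' (g : {linear N -> N'}) (g' : {linear N' -> N''})
    n (xi : Ext_of P'' n.+1 N) :
  Ext_of_map c g' (Ext_of_map c' g xi) = Ext_of_map chain_map_comp (g' \o g) xi.
Proof.
have [z <-] := ext_class_surj xi; rewrite !Ext_of_map_class.
by apply/ext_class_eqSP; exists \0 => x /=; rewrite subrr.
Qed.
End Composition.

Lemma chain_map_id_comm M (P : proj_res M) n x :
  pr_bd P n (idfun x) = pr_tgt_map idfun (fun n => idfun) n (pr_bd P n x).
Proof. by case: n x. Qed.

Definition chain_map_id M (P : proj_res M) : chain_map P P idfun :=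
  ChainMap (@chain_map_id_comm M P).

Lemma Ext_of_map_id M (P : proj_res M) (f : {linear M -> M})
    (c : chain_map P P f) N (g : {linear N -> N}) n (xi : Ext_of P n.+1 N) :
  f =1 id -> g =1 id -> Ext_of_map c g xi = xi.
Proof.
move=> ef eg; rewrite (Ext_of_map_homotopy c (chain_map_id P) (g2 := idfun) xi ef eg).
have [z <-] := ext_class_surj xi; rewrite Ext_of_map_class.
by apply/ext_class_eqSP; exists \0 => x /=; rewrite subrr.
Qed.

Section Lifting.
Variables (M M' : lmodType R) (P : proj_res M) (P' : proj_res M').
Variable f : {linear M -> M'}.

(** Choosing the next lift requires the compatibility of the previous one, so lift, map below and
    proof travel together through the recursion. *)
Let stage n := {p : {linear pr_tgt P n -> pr_tgt P' n} * {linear P n -> P' n} |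
  forall x, pr_bd P' n (p.2 x) = p.1 (pr_bd P n x)}.

Lemma chain_map_start : exists c : {linear P 0%N -> P' 0%N},
  forall x, pr_aug P' (c x) = f (pr_aug P x).
Proof.
apply: (@pr_projective _ _ P 0%N _ _ (pr_aug P') (f \o pr_aug P)).
exact: pr_aug_surj.
Qed.

Lemma chain_map_step n (s : stage n) : exists c : {linear P n.+1 -> P' n.+1},
  forall x, pr_d P' n (c x) = (projT1 s).2 (pr_d P n x).
Proof.
apply: (@projective_lift _ _ _ (pr_d P' n) ((projT1 s).2 \o pr_d P n)).
  exact: pr_projective.
by move=> x; apply/pr_bd_exact; rewrite (projT2 s) pr_bd_d linear0.
Qed.

Fixpoint chain_map_stage n : stage n :=
  match n with
  | 0%N => exist _ (f, projT1 (cid chain_map_start)) (projT2 (cid chain_map_start))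
  | m.+1 =>
    let s := chain_map_stage m in
    exist (fun p : {linear pr_tgt P m.+1 -> pr_tgt P' m.+1} * {linear P m.+1 -> P' m.+1} =>
             forall x, pr_bd P' m.+1 (p.2 x) = p.1 (pr_bd P m.+1 x))
          ((projT1 s).2, projT1 (cid (chain_map_step s)))
          (projT2 (cid (chain_map_step s)))
  end.

Lemma chain_map_lift_comm n x :
  pr_bd P' n ((projT1 (chain_map_stage n)).2 x) =
  pr_tgt_map f (fun n => (projT1 (chain_map_stage n)).2) n (pr_bd P n x).
Proof.
by rewrite (projT2 (chain_map_stage n)); case: n x.
Qed.

Definition chain_map_lift : chain_map P P' f := ChainMap chain_map_lift_comm.
End Lifting.

Lemma Ext_of_map_additive M M' (P : proj_res M) (P' : proj_res M')
    (f : {linear M -> M'}) (c : chain_map P P' f) N N' (g : {linear N -> N'}) n :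
  zmod_morphism (@Ext_of_map R M M' P P' f c N N' g n.+1).
Proof.
move=> xi xi'; have [z <-] := ext_class_surj xi.
have [w <-] := ext_class_surj xi'; rewrite -ext_classB !Ext_of_map_class.
rewrite -ext_classB; apply/ext_class_eqSP; exists \0 => x /=.
by rewrite linearB subrr.
Qed.

Section Comparison.
Variables (M : lmodType R) (P P' : proj_res M) (N : lmodType R) (n : nat).

Definition ext_compare : {additive Ext_of P' n.+1 N -> Ext_of P n.+1 N} :=
  mk_additive (Ext_of_map_additive (chain_map_lift P P' idfun)
                 (idfun : {linear N -> N}) (n := n)).

End Comparison.

Lemma ext_compare_bij M (P P' : proj_res M) N n :
  bijective (ext_compare P P' N n).
Proof.
by exists (ext_compare P' P N n) => xi;
  rewrite [LHS]Ext_of_map_comp; apply: Ext_of_map_id.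
Qed.

(** Both composites are induced by chain maps over [f], so homotopy invariance identifies them. *)
Lemma ext_compare_natural M M' (P1 P2 : proj_res M) (P1' P2' : proj_res M')
    (f : {linear M -> M'}) (c1 : chain_map P1 P1' f) (c2 : chain_map P2 P2' f)
    N N' (g : {linear N -> N'}) n (xi : Ext_of P2' n.+1 N) :
  ext_compare P1 P2 N' n (Ext_of_map c2 g xi) =
  Ext_of_map c1 g (ext_compare P1' P2' N n xi).
Proof.
rewrite [LHS]Ext_of_map_comp [RHS]Ext_of_map_comp.
exact: Ext_of_map_homotopy.
Qed.

End ExtComparison.

(** The isomorphisms below arise from choices of lifts, so they are given as relations between
    cocycles. Compatibility with subtraction, together with the matching of coboundaries, turns a
    relation total on both sides into a bijection of classes. *)
Lemma ext_correspondence (R R' : pzRingType) (M N : lmodType R)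
    (M' N' : lmodType R') (P : proj_res M) (P' : proj_res M') n n'
    (r : cocycle P N n -> cocycle P' N' n' -> Prop) :
  (forall x y x' y', r x y -> r x' y' -> r (x - x') (y - y')) ->
  (forall x, exists y, r x y) -> (forall y, exists x, r x y) ->
  (forall x y, r x y -> x \in @coboundary_pred R M P n N <->
                        y \in @coboundary_pred R' M' P' n' N') ->
  exists phi : {additive Ext_of P n N -> Ext_of P' n' N'},
    bijective phi /\ forall x y, r x y -> phi (ext_class x) = ext_class y.
Proof.
move=> rB rl rr rc.
have req x y x' y' : r x y -> r x' y' ->
    ext_class x = ext_class x' <-> ext_class y = ext_class y'.
  by move=> h h'; rewrite !ext_class_eqP; apply: rc; apply: rB.
have [s hs] := choice rl; have [s' hs'] := choice rr.
pose phi (xi : Ext_of P n N) := ext_class (s (repr xi)).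
pose psi (xi : Ext_of P' n' N') := ext_class (s' (repr xi)).
have phiE x y : r x y -> phi (ext_class x) = ext_class y.
  move=> h; apply/(req _ _ _ _ (hs _) h); exact: reprK.
have psiE x y : r x y -> psi (ext_class y) = ext_class x.
  move=> h; apply/(req _ _ _ _ (hs' _) h); exact: reprK.
have phiB : zmod_morphism phi.
  move=> xi xi'; have [x <-] := ext_class_surj xi.
  have [x' <-] := ext_class_surj xi'.
  by rewrite -ext_classB (phiE _ _ (rB _ _ _ _ (hs x) (hs x'))) ext_classB
     (phiE _ _ (hs x)) (phiE _ _ (hs x')).
exists (mk_additive phiB); split=> //.
exists psi => xi; have [x <-] := ext_class_surj xi; rewrite /=.
  by rewrite (phiE _ _ (hs x)) (psiE _ _ (hs x)).
by rewrite (psiE _ _ (hs' x)) (phiE _ _ (hs' x)).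
Qed.

(** * Dimension shifting along an injective coresolution *)

Section DimensionShift.
Variable R : pzRingType.
Implicit Types M N : lmodType R.

Lemma pr_d_d M (P : proj_res M) n x : pr_d P n (pr_d P n.+1 x) = 0.
Proof. by apply/pr_exact; exists x. Qed.

Lemma cosyzygy_emb_ex N (E : inj_cores N) k :
  exists i : {linear cosyzygy E k.+1 -> E k.+1},
    forall x, i (quotmod_pi (im_sub (ic_cobd E k)) x) = ic_d E k x.
Proof.
apply: (@quotmod_lift _ _ _ (im_sub (ic_cobd E k)) (ic_d E k)) => x /asboolP[y <-].
case: k y {x} => [|k] y; first by apply/ic_exact0; exists y.
by apply/ic_exact; exists y.
Qed.

(** With the quotient maps these embeddings give the sequences [0 -> cosyzygy E k -> E k -> cosyzygy
    E k.+1 -> 0] along which degrees are shifted. *)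
Definition cosyzygy_emb N (E : inj_cores N) k : {linear cosyzygy E k -> E k} :=
  match k with
  | 0%N => ic_coaug E
  | m.+1 => projT1 (cid (cosyzygy_emb_ex E m))
  end.

Lemma cosyzygy_embE N (E : inj_cores N) k x :
  cosyzygy_emb E k.+1 (quotmod_pi (im_sub (ic_cobd E k)) x) = ic_d E k x.
Proof. exact: (projT2 (cid (cosyzygy_emb_ex E k))). Qed.

Lemma cosyzygy_emb_inj N (E : inj_cores N) k : injective (cosyzygy_emb E k).
Proof.
case: k => [|k]; first exact: ic_coaug_inj.
apply: linear_injP => q.
have [x <-] := @quotmod_pi_surj _ _ (im_sub (ic_cobd E k)) q.
rewrite cosyzygy_embE => dx; apply/quotmod_pi_eq0/asboolP.
case: k x dx {q} => [|k] x dx; first exact: (ic_exact0 x).1 dx.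
exact: (ic_exact x).1 dx.
Qed.

Lemma cosyzygy_emb_im N (E : inj_cores N) k x :
  (exists y, cosyzygy_emb E k y = x) <-> quotmod_pi (im_sub (ic_cobd E k)) x = 0.
Proof.
rewrite quotmod_pi_eq0; case: k x => [|k] x.
  by split=> [h|/asboolP]; first exact/asboolP.
split=> [[y <-]|/asboolP[y <-]].
  have [z <-] := @quotmod_pi_surj _ _ (im_sub (ic_cobd E k)) y.
  by apply/asboolP; exists z; rewrite cosyzygy_embE.
by exists (quotmod_pi _ y); rewrite cosyzygy_embE.
Qed.

Lemma cosyzygy_map_pi N N' (E : inj_cores N) (E' : inj_cores N')
    (g : {linear N -> N'}) (e : cochain_map E E' g) k x :
  cosyzygy_map e k.+1 (quotmod_pi (im_sub (ic_cobd E k)) x) =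
  quotmod_pi (im_sub (ic_cobd E' k)) (e k x).
Proof. exact: (quotmod_map_pi (@ccm_im _ _ _ _ _ _ e k) x). Qed.

Lemma cosyzygy_emb_map N N' (E : inj_cores N) (E' : inj_cores N')
    (g : {linear N -> N'}) (e : cochain_map E E' g) k x :
  cosyzygy_emb E' k (cosyzygy_map e k x) = e k (cosyzygy_emb E k x).
Proof.
case: k x => [|k] x; first by rewrite /= -(ccm_comm e (n := 0%N) x).
have [y <-] := @quotmod_pi_surj _ _ (im_sub (ic_cobd E k)) x.
rewrite cosyzygy_map_pi !cosyzygy_embE.
by rewrite -[ic_d E k y]/(ic_cobd E k.+1 y) (ccm_comm e (n := k.+1)).
Qed.

Section Connecting.
Variables (M N : lmodType R) (P : proj_res M) (E : inj_cores N) (j k : nat).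

(** The connecting homomorphism read on cocycles, from degree [j.+1] to [j.+2]: lift [u] to [E k],
    compose with the differential, and read the result in [cosyzygy E k]. *)
Definition connecting (z : cocycle P (cosyzygy E k) j.+2)
    (u : cocycle P (cosyzygy E k.+1) j.+1) : Prop :=
  exists w : {linear P j.+1 -> E k},
    (forall x, quotmod_pi (im_sub (ic_cobd E k)) (w x) = cocycle_fun u x) /\
    (forall x, cosyzygy_emb E k (cocycle_fun z x) = w (pr_d P j.+1 x)).

Lemma connectingB z u z' u' : connecting z u -> connecting z' u' ->
  connecting (z - z') (u - u').
Proof.
move=> [w [wu wz]] [w' [wu' wz']]; exists (w \- w'); split=> x /=.
  by rewrite linearB /= wu wu'.
by rewrite linearB wz wz'.
Qed.

(** [Ext] into the injective [E k] vanishes in positive degree: [z], viewed in [E k], extends along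
    the differential, and the extension modulo [cosyzygy E k] is the cocycle sought. *)
Lemma connecting_total z : exists u, connecting z u.
Proof.
have [x|w hw] := @injective_extension _ _ _ (E k) (pr_d P j.+1)
    (cosyzygy_emb E k \o cocycle_fun z) (@ic_injective _ _ E k).
  by move=> /pr_exact[y <-] /=; rewrite cocycle_d linear0.
have [|u hu] := @mk_cocycle _ _ (cosyzygy E k.+1) P _
    (quotmod_pi (im_sub (ic_cobd E k)) \o w).
  by move=> x; rewrite /= hw; apply/cosyzygy_emb_im; exists (cocycle_fun z x).
by exists u, w; split=> x; rewrite ?hu ?hw.
Qed.

Lemma connecting_surj u : exists z, connecting z u.
Proof.
have [w hw] := @pr_projective _ _ P j.+1 _ _
   (quotmod_pi (im_sub (ic_cobd E k))) (cocycle_fun u) (@quotmod_pi_surj _ _ _).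
have [|z hz] := @linear_corestrict _ _ _ _ (cosyzygy_emb E k)
    (w \o pr_d P j.+1) (@cosyzygy_emb_inj _ E k).
  by move=> x; apply/cosyzygy_emb_im; rewrite /= hw cocycle_d.
have [|z' hz'] := @mk_cocycle _ _ _ P _ z.
  move=> x; apply: (@cosyzygy_emb_inj _ E k).
  by rewrite hz /= pr_d_d !linear0.
exists z', w; split=> x; first exact: hw.
by have -> : cocycle_fun z' x = z x by exact: hz'; rewrite hz.


Qed.

Lemma connecting_coboundary z u : connecting z u ->
  z \in @coboundary_pred R M P j.+2 (cosyzygy E k) <->
  u \in @coboundary_pred R M P j.+1 (cosyzygy E k.+1).
Proof.
move=> [w [wu wz]]; split=> /asboolP[y hy]; apply/asboolP.
  (* On boundaries [w] agrees with the embedded [y], so their difference factors through the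
     differential; the factor [h] yields the primitive of [u]. *)
  have [x|h hh] := @injective_extension _ _ _ (E k) (pr_d P j)
    (w \- (cosyzygy_emb E k \o y)) (@ic_injective _ _ E k).
    by move=> /pr_exact[t <-] /=; rewrite -wz hy subrr.
  exists (quotmod_pi (im_sub (ic_cobd E k)) \o h) => x /=.
  rewrite hh /= linearB /= wu.
  suff -> : quotmod_pi (im_sub (ic_cobd E k)) (cosyzygy_emb E k (y x)) = 0.
    by rewrite subr0.
  by apply/cosyzygy_emb_im; exists (y x).
have [h hh] := @pr_projective _ _ P j _ _
   (quotmod_pi (im_sub (ic_cobd E k))) y (@quotmod_pi_surj _ _ _).
have [|t ht] := @linear_corestrict _ _ _ _ (cosyzygy_emb E k)
    (w \- (h \o pr_d P j)) (@cosyzygy_emb_inj _ E k).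
  by move=> x; apply/cosyzygy_emb_im; rewrite /= linearB /= wu hy hh subrr.
exists t => x; apply: (@cosyzygy_emb_inj _ E k).
by rewrite wz ht /= pr_d_d linear0 subr0.
Qed.

Lemma connecting_iso :
  exists phi : {additive Ext_of P j.+2 (cosyzygy E k) ->
                         Ext_of P j.+1 (cosyzygy E k.+1)},
    bijective phi /\
    forall z u, connecting z u -> phi (ext_class z) = ext_class u.
Proof.
apply: ext_correspondence.
- exact: connectingB.
- exact: connecting_total.
- exact: connecting_surj.
- exact: connecting_coboundary.
Qed.

End Connecting.

Lemma connecting_natural M M' N N' (P : proj_res M) (P' : proj_res M')
    (E : inj_cores N) (E' : inj_cores N') (f : {linear M -> M'})
    (g : {linear N -> N'}) (c : chain_map P P' f) (e : cochain_map E E' g) j k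
    (z : cocycle P' (cosyzygy E k) j.+2) u :
  connecting z u ->
  connecting (cocycle_map c (cosyzygy_map e k) z)
             (cocycle_map c (cosyzygy_map e k.+1) u).
Proof.
move=> [w [wu wz]]; exists (e k \o (w \o c j.+1)); split=> x.
  by rewrite /= -cosyzygy_map_pi wu.
rewrite [LHS]cosyzygy_emb_map wz /=; congr (e k (w _)).
exact: (cm_comm c (n := j.+2) x).
Qed.

(* Degrees and cosyzygy indices are kept abstract, so that these isomorphisms
   compose without casts between propositionally equal degrees. *)
Definition natural_shift d a n b : Prop :=
  exists Phi : forall M N (P : proj_res M) (E : inj_cores N),
      {additive Ext_of P d (cosyzygy E a) -> Ext_of P n (cosyzygy E b)},
    (forall M N P E, bijective (Phi M N P E)) /\
    (forall M M' N N' (P : proj_res M) (P' : proj_res M') (E : inj_cores N)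
       (E' : inj_cores N') (f : {linear M -> M'}) (g : {linear N -> N'})
       (c : chain_map P P' f) (e : cochain_map E E' g)
       (xi : Ext_of P' d (cosyzygy E a)),
      Phi M N' P E' (Ext_of_map c (cosyzygy_map e a) xi) =
      Ext_of_map c (cosyzygy_map e b) (Phi M' N P' E xi)).

Lemma natural_shift_refl d a : natural_shift d a d a.
Proof.
exists (fun M N P E => idfun); split=> // M N P E.
by exists idfun.
Qed.

Lemma natural_shift_trans d a n b m c :
  natural_shift d a n b -> natural_shift n b m c -> natural_shift d a m c.
Proof.
move=> [F [Fb Fn]] [G [Gb Gn]].
exists (fun M N P E => G M N P E \o F M N P E); split=> [M N P E|].
  exact: (bij_comp (Gb _ _ _ _) (Fb _ _ _ _)).
by move=> M M' N N' P P' E E' f g h e xi; rewrite /= Fn Gn.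
Qed.

Lemma natural_shift1 j k : natural_shift j.+2 k j.+1 k.+1.
Proof.
exists (fun M N P E => projT1 (cid (connecting_iso P E j k))).
split=> [M N P E|M M' N N' P P' E E' f g c e xi].
  by have [] := projT2 (cid (connecting_iso P E j k)).
have [_ h] := projT2 (cid (connecting_iso P E' j k)).
have [_ h'] := projT2 (cid (connecting_iso P' E j k)).
have [z <-] := ext_class_surj xi; have [u zu] := connecting_total z.
rewrite (h' _ _ zu) !Ext_of_map_class; apply: h.
exact: connecting_natural.
Qed.

Lemma natural_shift_iter j k : natural_shift (k + j.+1) 0 j.+1 k.
Proof.
elim: k j => [|k IH] j; first exact: natural_shift_refl.
rewrite addSnnS; apply: natural_shift_trans (IH j.+1) _.
exact: natural_shift1.
Qed.

End DimensionShift.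

(** * Restriction of scalars, bases and finite generation *)

Definition restrict (S R : pzRingType) (f : {rmorphism S -> R})
  (M : lmodType R) : Type := M.

Section RestrictionOfScalars.
Variables (S R : pzRingType) (f : {rmorphism S -> R}).
Local Notation restrict := (restrict f).

Section Module.
Variable M : lmodType R.
HB.instance Definition _ := GRing.Zmodule.on (restrict M).

Definition restrict_scale (a : S) (x : restrict M) : restrict M :=
  f a *: (x : M).

Fact restrict_scaleA a b x :
  restrict_scale a (restrict_scale b x) = restrict_scale (a * b) x.
Proof. by rewrite /restrict_scale scalerA rmorphM. Qed.
Fact restrict_scale1 : left_id 1 restrict_scale.
Proof. by move=> x; rewrite /restrict_scale rmorph1 scale1r. Qed.
Fact restrict_scaleDr : right_distributive restrict_scale +%R.
Proof. by move=> a x y; rewrite /restrict_scale scalerDr. Qed.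
Fact restrict_scaleDl x : {morph restrict_scale^~ x : a b / a + b}.
Proof. by move=> a b; rewrite /restrict_scale rmorphD scalerDl. Qed.
HB.instance Definition _ := GRing.Zmodule_isLmodule.Build S (restrict M)
  restrict_scaleA restrict_scale1 restrict_scaleDr restrict_scaleDl.
End Module.

Section Map.
Variables (M N : lmodType R) (g : {linear M -> N}).
Definition restrict_fun (x : restrict M) : restrict N := g x.
Fact restrict_fun_linear : linear restrict_fun.
Proof. by move=> a x y; rewrite /restrict_fun linearP. Qed.
Definition restrict_map : {linear restrict M -> restrict N} :=
  mk_linear restrict_fun_linear.
End Map.
End RestrictionOfScalars.

(** * Spans and bases in vector spaces of arbitrary dimension *)

Section VectorSpaces.
Variable K : fieldType.
Implicit Types V W : lmodType K.

Inductive kspan V (A : set V) : V -> Prop :=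
| kspan0 : kspan A 0
| kspanZD c a x : A a -> kspan A x -> kspan A (c *: a + x).

Lemma kspanD V (A : set V) x y : kspan A x -> kspan A y -> kspan A (x + y).
Proof.
move=> hx hy; elim: hx => [|c a z Aa _ IH]; first by rewrite add0r.
by rewrite -addrA; apply: kspanZD.
Qed.

Lemma kspanZ V (A : set V) c x : kspan A x -> kspan A (c *: x).
Proof.
elim=> [|d a z Aa _ IH]; first by rewrite scaler0; exact: kspan0.
by rewrite scalerDr scalerA; apply: kspanZD.
Qed.

Lemma kspan_sub V (A : set V) x y : kspan A x -> kspan A y -> kspan A (x - y).
Proof. by move=> hx hy; rewrite -scaleN1r; apply/kspanD/kspanZ. Qed.

Lemma kspan_mem V (A : set V) x : A x -> kspan A x.
Proof.
by move=> Ax; rewrite -[x]scale1r -[_ *: _]addr0; apply/kspanZD/kspan0.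
Qed.

Lemma kspan_le V (A B : set V) x : (forall a, A a -> kspan B a) ->
  kspan A x -> kspan B x.
Proof.
move=> AB; elim=> [|c a z /AB Ba _ IH]; first exact: kspan0.
exact/kspanD/IH/kspanZ.
Qed.

Lemma kspanS V (A B : set V) x : A `<=` B -> kspan A x -> kspan B x.
Proof. by move=> AB; apply: kspan_le => a /AB; exact: kspan_mem. Qed.

Lemma kspanU1 V (A : set V) a x : kspan (A `|` [set a]) x ->
  exists c, kspan A (x - c *: a).
Proof.
elim=> [|d b z Ab _ [c hc]].
  by exists 0; rewrite scale0r subrr; exact: kspan0.
case: Ab => [Ab|->].
  by exists c; rewrite -addrA; apply: kspanZD.
by exists (d + c); rewrite scalerDl opprD addrACA subrr add0r.
Qed.

Definition kindep V (B : set V) := forall b, B b -> ~ kspan (B `\ b) b.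

(** A combination involves finitely many vectors, and along a chain they all lie in one member. The
    first alternative covers an empty chain. *)
Lemma kspan_chain V (B0 : set V) (F : set (set V)) b x :
  total_on F subset -> kspan ((B0 `|` \bigcup_(A in F) A) `\ b) x ->
  kspan (B0 `\ b) x \/ exists2 A, F A & kspan ((B0 `|` A) `\ b) x.
Proof.
move=> Ftot; elim=> [|c a z [Ba ab] _ IH]; first by left; exact: kspan0.
have mono A A' : A `<=` A' -> (B0 `|` A) `\ b `<=` (B0 `|` A') `\ b.
  by move=> AA'; apply: setSD; exact: setUS.
case: Ba => [Ba|[A FA Aa]].
  case: IH => [h|[A FA h]]; first by left; apply: kspanZD.
  by right; exists A => //; apply: kspanZD => //; split=> //; left.
right; case: IH => [h|[A' FA' h]].
  exists A => //; apply: kspanZD; first by split=> //; right.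
  by apply: kspanS h; apply: setSD; left.
case: (Ftot A A' FA FA') => AA'.
  by exists A' => //; apply: kspanZD => //; split=> //; right; exact: AA'.
exists A => //; apply: kspanZD; first by split=> //; right.
exact: kspanS (mono _ _ AA') h.
Qed.

Lemma kindepU1 V (B : set V) g : kindep B -> ~ kspan B g ->
  kindep (B `|` [set g]).
Proof.
move=> iB ng b Bb; case: (pselect (b = g)) => [->|bg] hb.
  by apply: ng; apply: kspanS hb => x [[] // ->].
have {}Bb : B b by case: Bb.
have [|c hc] := @kspanU1 _ (B `\ b) g b.
  by apply: kspanS hb => x [[Bx|->] xb]; [left | right].
have [c0|c0] := eqVneq c 0.
  by apply: (iB b Bb); rewrite c0 scale0r subr0 in hc.
apply: ng; rewrite -[g](scalerK c0) ; apply: kspanZ.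
rewrite -[c *: g](subKr b); apply: kspan_sub; first exact: kspan_mem.
by apply: kspanS hc; exact: subDsetl.
Qed.

(** Zorn's lemma, the dimension being arbitrary. Taking the new vectors from [G] keeps them
    homogeneous, and finite in number if [G] is finite; [B0] allows a prescribed vector to be a
    basis element. *)
Lemma basis_extension V (B0 G : set V) : kindep B0 -> (forall x, kspan G x) ->
  exists B, [/\ B0 `<=` B, B `<=` B0 `|` G, kindep B & forall x, kspan B x].
Proof.
move=> iB0 spanG; pose P (A : set V) := A `<=` G /\ kindep (B0 `|` A).
have [F FP Ftot|A [[AG iA] maxA]] := @Zorn_bigcup V P.
  split=> [x [A FA Ax]|b Bb]; first by have [AG _] := FP A FA; exact: AG.
  move=> /(kspan_chain Ftot)[h|[A FA h]].
    case: Bb => [Bb|[A FA Ab]]; first exact: (iB0 b Bb).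
    have [_ iA] := FP A FA; apply: (iA b); first by right.
    by apply: kspanS h; apply: setSD; left.
  have [_ iA] := FP A FA.
  case: Bb => [Bb|[A' FA' Ab]]; first by apply: (iA b) => //; left.
  case: (Ftot A A' FA FA') => AA'.
    have [_ iA'] := FP A' FA'; apply: (iA' b); first by right.
    by apply: kspanS h; apply: setSD; exact: setUS.
  by apply: (iA b) => //; right; exact: AA'.
exists (B0 `|` A); split=> [x|||x]; [by left | exact: setUS | by [] |].
apply: kspan_le (spanG x) => g Gg; apply: contrapT => ng.
have Ag : ~ A g by move=> Ag; apply: ng; apply: kspan_mem; right.
apply: (maxA (A `|` [set g])).
  by split=> [y Ay|/(_ g) h]; [left | apply/Ag/h; right].
split=> [y [/AG|->] //|]; rewrite setUA; exact: kindepU1.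
Qed.

Lemma kindep_free V (B : set V) : kindep B ->
  injective (free_lift (fun b : {x : V | `[< B x >]} => \val b)).
Proof.
move=> iB; apply: linear_injP => g g0; apply: free_eqP => k.
rewrite [RHS]mcoeff0; apply/eqP/negP => /negP gk.
have ks : k \in msupp g by rewrite -mcoeff_neq0.
have Bk : B (\val k) by apply/asboolP; exact: (valP k).
apply: (iB _ Bk); suff h : kspan (B `\ \val k) (free_coeff g k *: \val k).
  have := kspanZ (free_coeff g k)^-1 h.
  by rewrite scalerA mulVf // scale1r.
move: g0; rewrite /= /free_lift (big_fsetD1 k) //= => /eqP.
rewrite addr_eq0 => /eqP ->; rewrite -scaleN1r; apply: kspanZ.
rewrite big_seq; elim/big_rec: _ => [|i x]; first exact: kspan0.
rewrite in_fsetD1 => /andP[ik _] IH; apply: kspanZD => //.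
split; first exact: (asboolP _ (valP i)).
by move=> /= e; move/eqP: ik; apply; exact: val_inj.
Qed.

(** A relation among the lifts [w b] maps to the same relation among independent vectors. It makes
    the kernel of a cover vanish wherever the cover is spanned by its generators. *)
Lemma kindep_lift V W (B : set V) (w : {x : V | `[< B x >]} -> W)
    (f : {linear W -> V}) : kindep B -> (forall b, f (w b) = \val b) ->
  forall y, kspan (range w) y -> f y = 0 -> y = 0.
Proof.
move=> /kindep_free iB fw y hy.
have [g <-] : exists g, free_lift w g = y.
  elim: hy => [|c _ z [b _ <-] _ [g <-]]; first by exists 0; exact: linear0.
  by exists (c *: free_gen K b + g); rewrite linearP /= free_lift_gen.
have e : free_lift (fun b : {x : V | `[< B x >]} => \val b) g = f (free_lift w g).
  by apply: (free_ext (w := f \o free_lift w)) => b /=; rewrite !free_lift_gen.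
rewrite -e => h; have -> : g = 0 by apply: iB; rewrite h linear0.
exact: linear0.
Qed.

End VectorSpaces.

(** * Finite generation and subspaces *)

Section FiniteGeneration.

Lemma finitely_generatedP (R : pzRingType) (M : lmodType R) :
  finitely_generated M <-> exists s : seq M,
    forall S : submodClosed M, {subset s <= S} -> forall x, x \in S.
Proof.
split=> [[n [g hg]]|[s hs]].
  exists (codom g) => S gS x; have [c ->] := hg x.
  by apply: rpred_sum => i _; apply: rpredZ; apply: gS; exact: codom_f.
pose n := size s; pose g (i : 'I_n) := s`_i.
pose S : {pred M} := fun x => `[< exists c : 'I_n -> R, x = \sum_(i < n) c i *: g i >].
have S_sub : submod_closed S.
  split=> [|a x y /asboolP[c ->] /asboolP[d ->]]; apply/asboolP.
    by exists (fun=> 0); rewrite big1 // => i _; rewrite scale0r.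
  exists (fun i => a * c i + d i); rewrite scaler_sumr -big_split /=.
  by apply: eq_bigr => i _; rewrite scalerDl scalerA.
pose S' : submodClosed M := HB.pack S (GRing.isSubmodClosed.Build R M S S_sub).
exists n, g => x; apply/asboolP; apply: (hs S') => y ys; apply/asboolP.
have iy : (index y s < n)%N by rewrite index_mem.
exists (fun i => if i == Ordinal iy then 1 else 0).
rewrite (bigD1 (Ordinal iy)) //= eqxx scale1r /g nth_index // big1 ?addr0 //.
by move=> i /negPf ->; rewrite scale0r.
Qed.

Lemma finitely_generated_surj (R : pzRingType) (M N : lmodType R)
    (f : {linear M -> N}) : (forall y, exists x, f x = y) ->
  finitely_generated M -> finitely_generated N.
Proof.
move=> fs [n [g hg]]; exists n, (f \o g) => y; have [x <-] := fs y.
have [c ->] := hg x; exists c; rewrite linear_sum; apply: eq_bigr => i _.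
by rewrite linearZ.
Qed.

(** Induction on a list spanning the image: the vectors expressible without its head [a] form a
    subspace handled by induction, and one [w0] with a nonzero coefficient at [a], if there is any,
    generates the rest. *)
Lemma finitely_generated_subspace (K : fieldType) (V W : lmodType K)
    (i : {linear W -> V}) : injective i ->
  finitely_generated V -> finitely_generated W.
Proof.
move=> ii [n [g hg]].
have {hg} : forall w, kspan [set` codom g] (i w).
  move=> w; have [c ->] := hg (i w); elim/big_rec: _ => [|k x _ hx].
    exact: kspan0.
  by apply: kspanZD => //; exact: codom_f.
elim: (codom g) W i ii => [|a s IH] W i ii hs; apply/finitely_generatedP.
  exists [::] => S _ w; suff -> : w = 0 by exact: rpred0.
  by apply: ii; rewrite linear0; elim: (hs w) => [|c x z []].
pose T : {pred W} := fun w => `[< kspan [set` s] (i w) >].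
have T_sub : submod_closed T.
  split=> [|c x y /asboolP hx /asboolP hy]; apply/asboolP.
    by rewrite linear0; exact: kspan0.
  by rewrite linearP; exact/kspanD/hy/kspanZ.
pose T' : submodClosed W := HB.pack T (GRing.isSubmodClosed.Build K W T T_sub).
have fgT : finitely_generated (submod T').
  apply: (IH _ (i \o \val)) => [|w]; first exact: inj_comp ii val_inj.
  exact: (asboolP _ (valP w)).
have hs' w : exists c, kspan [set` s] (i w - c *: a).
  apply: kspanU1; apply: kspanS (hs w) => x /=.
  by rewrite inE => /orP[/eqP ->|xs]; [right | left].
have uP : exists u : seq W, forall S : submodClosed W, {subset u <= S} ->
    forall x, x \in T' -> x \in S.
  have /finitely_generatedP[v hv] := fgT.
  exists (map \val v) => S vS x xT.
  apply: (hv (preim_sub \val S) _ (in_submod xT)) => y yv.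
  by apply: vS; apply: map_f.
have [v hv] := uP.
have [[w0 [c [c0 hc]]]|none] :=
    pselect (exists w c, c != 0 /\ kspan [set` s] (i w - c *: a)); last first.
  exists v => S vS w; apply: (hv S vS); apply/asboolP.
  have [c hc] := hs' w; have [c0|c0] := eqVneq c 0.
    by rewrite c0 scale0r subr0 in hc.
  by exfalso; apply: none; exists w, c.
exists (w0 :: v) => S wvS w; have [d hd] := hs' w.
have w0S : w0 \in S by apply: wvS; exact: mem_head.
rewrite -[w](subrK ((d / c) *: w0)); apply: rpredD; last exact: rpredZ.
apply: hv => [x xv|]; first by apply: wvS; rewrite inE xv orbT.
apply/asboolP; rewrite linearB linearZ /=.
have -> : i w - (d / c) *: i w0 = (i w - d *: a) - (d / c) *: (i w0 - c *: a).
  by rewrite scalerBr scalerA divfK // opprB addrA subrK.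
exact/kspan_sub/kspanZ.
Qed.

End FiniteGeneration.

(** * Paths and modules supported on sets of vertices *)

Section QuiverPaths.
Variable Q : quiver.
Implicit Types (L U D : set (vertex Q)) (p q r : qpath Q).

Lemma path_concat p q : terminus p = origin q -> exists r,
  [/\ origin r = origin p, terminus r = terminus q,
      path_length r = (path_length p + path_length q)%N
    & forall v, v \in path_vertices r ->
        v \in path_vertices p \/ v \in path_vertices q].
Proof.
move=> e; have [r hr] := path_comp_ex e; exists r; split.
- exact: path_comp_origin hr.
- exact: path_comp_terminus hr.
- by rewrite /path_length (path_comp_arrows hr) size_cat.
move=> v; rewrite /path_vertices (path_comp_origin hr) (path_comp_arrows hr).
rewrite map_cat -cat_cons mem_cat => /orP[vp|vq]; first by left.
by right; rewrite inE vq orbT.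
Qed.

Lemma walk_split (o u : vertex Q) s : u \in o :: map (@target Q) s ->
  exists s1 s2, s = s1 ++ s2 /\ walk_end o s1 = u.
Proof.
elim: s o => [|a s IH] o /=.
  by rewrite inE => /eqP ->; exists [::], [::].
rewrite inE => /orP[/eqP ->|/IH[s1 [s2 [-> e]]]]; first by exists [::], (a :: s).
by exists (a :: s1), s2.
Qed.

Lemma path_split p u : u \in path_vertices p -> exists q r,
  [/\ origin q = origin p, terminus q = u, origin r = u
    & terminus r = terminus p].
Proof.
move=> /walk_split[s1 [s2 [e eu]]].
have := valP p; rewrite /= -/(origin p) -/(arrows p) e is_walk_cat.
move=> /andP[w1]; rewrite eu => w2.
exists (exist (fun z => is_walk z.1 z.2) (origin p, s1) w1).
exists (exist (fun z => is_walk z.1 z.2) (u, s2) w2); split=> //.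
by rewrite /terminus e walk_end_cat eu.
Qed.

Lemma origin_path_vertices p : origin p \in path_vertices p.
Proof. exact: mem_head. Qed.

Lemma terminus_path_vertices p : terminus p \in path_vertices p.
Proof. exact: mem_last. Qed.

Definition succ_closed L := forall p, L (origin p) -> L (terminus p).
Definition pred_closed L := forall p, L (terminus p) -> L (origin p).

Lemma succ_closedC L : succ_closed L -> pred_closed (~` L).
Proof. by move=> h p hn hp; apply/hn/h. Qed.

Lemma pred_closedC L : pred_closed L -> succ_closed (~` L).
Proof. by move=> h p hn hp; apply/hn/h. Qed.

Lemma pred_closed_supported L p : pred_closed L -> L (terminus p) ->
  supported_path L p.
Proof. by move=> h Lp v /path_split[_ [r [_ _ <- e]]]; apply: h; rewrite e. Qed.

Lemma succ_closed_supported L p : succ_closed L -> L (origin p) ->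
  supported_path L p.
Proof. by move=> h Lp v /path_split[q [_ [e <- _ _]]]; apply: h; rewrite e. Qed.

End QuiverPaths.

(** [P] is the direct sum of the [R w_t], realised as the image of an idempotent endomorphism of the
    free module on [T], hence a retract of that module. *)
Lemma idempotent_projective (R : pzRingType) (T : choiceType) (w : T -> R) :
  (forall t, w t * w t = w t) ->
  exists (P : lmodType R) (b : T -> P),
    [/\ projective P, forall t, w t *: b t = b t,
        forall D : P -> Prop, D 0 -> (forall a t y, D y -> D (a *: b t + y)) ->
          forall y, D y
      & forall (M : lmodType R) (x : T -> M), (forall t, w t *: x t = x t) ->
          exists f : {linear P -> M}, forall t, f (b t) = x t].
Proof.
move=> ww; pose eps : {linear free_mod R T -> free_mod R T} :=
  free_lift (fun t => w t *: free_gen R t).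
have epsK y : eps (eps y) = eps y.
  apply: (free_ext (u := eps \o eps)) => t /=.
  by rewrite /eps free_lift_gen linearZ /= free_lift_gen scalerA ww.
have inP y : eps y \in im_sub eps by apply/asboolP; exists y.
pose b t : submod (im_sub eps) := in_submod (inP (free_gen R t)).
have bE t : \val (b t) = w t *: free_gen R t by rewrite /= /eps free_lift_gen.
exists (submod (im_sub eps)), b; split.
- have [r hr] := linear_to_submod inP.
  apply: (@projective_retract _ _ _ \val r); last exact: free_projective.
  move=> y; apply: val_inj; rewrite hr.
  by have /asboolP[z hz] := valP y; rewrite -[RHS]hz -[RHS]epsK hz.
- by move=> t; apply: val_inj; rewrite -[LHS]/(w t *: \val (b t)) bE scalerA ww.
- move=> D D0 DD y; have /asboolP[g hg] := valP y.
  have -> : y = \sum_(k <- msupp g) free_coeff g k *: b k.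
    apply: val_inj; rewrite -hg raddf_sum; apply: eq_bigr => k _.
    by rewrite -[RHS]/(_ *: \val (b k)) bE.
  by elim/big_rec: _ => // k x _; exact: DD.
- move=> M x wx; exists (free_lift x \o \val) => t.
  by rewrite -[LHS]/(free_lift x (\val (b t))) bE linearZ /= free_lift_gen.
Qed.

(* All that is used of the opposite [R] of a bound quiver algebra.  Multiplication
   in [R] is reversed, so [fr_e v * a * fr_e u] is [u a v] in the algebra: it is
   spanned by the paths from [u] to [v], hence a scalar multiple of the vertex
   [u = v], or zero, when only trivial paths go from [u] to [v]. *)
Record frame (K : fieldType) (R : pzRingType) (Q : quiver) := Frame {
  fr_scal : {rmorphism K -> R};
  fr_e : vertex Q -> R;
  fr_comm : forall c a, fr_scal c * a = a * fr_scal c;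
  fr_fin : exists n (g : 'I_n -> R), forall a, exists c : 'I_n -> K,
    a = \sum_(i < n) fr_scal (c i) * g i;
  fr_sum : \sum_v fr_e v = 1;
  fr_idem : forall v, fr_e v * fr_e v = fr_e v;
  fr_orth : forall u v, u != v -> fr_e u * fr_e v = 0;
  fr_path : forall u v a,
    (forall p, origin p = u -> terminus p = v -> path_length p = 0%N) ->
    exists c, fr_e v * a * fr_e u = fr_scal c * (fr_e v * fr_e u) }.

(** * Modules over an algebra with vertex idempotents *)

Section Frame.
Variables (K : fieldType) (R : pzRingType) (Q : quiver) (F : frame K R Q).
Local Notation scal := (fr_scal F).
Local Notation e := (fr_e F).
Implicit Types (M N P X Z : lmodType R) (L C U D : set (vertex Q)).

Definition supp L M := forall v, ~ L v -> forall x : M, e v *: x = 0.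

Lemma decompose M (x : M) : x = \sum_v e v *: x.
Proof. by rewrite -scaler_suml fr_sum scale1r. Qed.

Lemma eq0_local M (x : M) : (forall v, e v *: x = 0) -> x = 0.
Proof. by move=> h; rewrite [x]decompose big1. Qed.

Lemma scale_idem M v (x : M) : e v *: (e v *: x) = e v *: x.
Proof. by rewrite scalerA fr_idem. Qed.

Lemma scale_orth M u v (x : M) : u != v -> e u *: (e v *: x) = 0.
Proof. by move=> uv; rewrite scalerA fr_orth // scale0r. Qed.

Lemma scalC M c a (x : M) : a *: (scal c *: x) = scal c *: (a *: x).
Proof. by rewrite !scalerA fr_comm. Qed.

Lemma scale_path M u v a (x : M) :
  (forall p, origin p = u -> terminus p = v -> path_length p = 0%N) ->
  exists c, e v *: (a *: (e u *: x)) =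
            if u == v then scal c *: (e v *: x) else 0.
Proof.
move=> /(fr_path F a)[c h]; exists c; rewrite !scalerA h.
case: eqVneq => [->|uv]; first by rewrite fr_idem.
by rewrite fr_orth 1?eq_sym // mulr0 scale0r.
Qed.

Lemma scale_nopath M u v a (x : M) :
  (forall p, origin p = u -> terminus p <> v) -> e v *: (a *: (e u *: x)) = 0.
Proof.
move=> h; have [|c ->] := @scale_path M u v a x; first by move=> p /h.
by case: eqVneq => // uv; case: (h (triv_path u)).
Qed.

(** The algebra moves a vector at [u] only to vertices reachable from [u], so the vectors living on
    a successor-closed set are stable. *)
Lemma succ_closed_part C M : succ_closed C -> exists T : submodClosed M,
  forall x, x \in T <-> forall v, ~ C v -> e v *: x = 0.
Proof.
move=> sC; pose T : {pred M} := fun x => `[< forall v, ~ C v -> e v *: x = 0 >].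
have T_sub : submod_closed T.
  split=> [|a x y /asboolP hx /asboolP hy]; apply/asboolP => v Cv.
    by rewrite scaler0.
  rewrite scalerDr hy // addr0 [x]decompose !scaler_sumr big1 // => u _.
  have [Cu|/hx ->] := pselect (C u); last by rewrite !scaler0.
  by apply: scale_nopath => p op tp; apply: Cv; rewrite -tp; apply: sC; rewrite op.
pose T' : submodClosed M := HB.pack T (GRing.isSubmodClosed.Build R M T T_sub).
exists T' => x.
by split=> [/asboolP|h]; last exact/asboolP.
Qed.

Lemma supp_mono L L' M : L `<=` L' -> supp L M -> supp L' M.
Proof. by move=> LL' h v hv; apply: h => /LL'. Qed.

Lemma finitely_generated_scal M :
  finitely_generated M <-> finitely_generated (restrict scal M).
Proof.
split=> [[n [g hg]]|[n [g hg]]]; last first.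
  by exists n, g => x; have [c ->] := hg x; exists (scal \o c).
apply/finitely_generatedP; have [m [h hh]] := fr_fin F.
exists [seq h j *: g i | i <- enum 'I_n, j <- enum 'I_m] => S hS x.
have [c ->] := hg x; apply: rpred_sum => i _; have [d ->] := hh (c i).
rewrite scaler_suml; apply: rpred_sum => j _; rewrite -scalerA.
apply: (rpredZ (s := S)); apply: hS; apply: allpairs_f; exact: mem_enum.
Qed.

(** Over a finite dimensional algebra finitely generated means finite dimensional over [K], which
    passes to submodules. *)
Lemma finitely_generated_inj M N (f : {linear M -> N}) : injective f ->
  finitely_generated N -> finitely_generated M.
Proof.
move=> fi /finitely_generated_scal h; apply/finitely_generated_scal.
exact: (@finitely_generated_subspace _ _ _ (restrict_map scal f) fi h).
Qed.

(** The case distinction lets a single cover construction serve arbitrary modules and preserve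
    finite generation. *)
Lemma homogeneous_span M : exists G : set (restrict scal M),
  [/\ forall x, G x -> exists v, e v *: (x : M) = x, forall x, kspan G x
    & finitely_generated M -> exists s : seq (restrict scal M), G = [set` s]].
Proof.
have [/finitely_generated_scal fg|nfg] := pselect (finitely_generated M).
  have [n [g hg]] := fg.
  pose s : seq (restrict scal M) :=
    [seq e v *: (g i : M) | i <- enum 'I_n, v <- enum (vertex Q)].
  exists [set` s]; split=> [x /allpairsP[[i v] [_ _ ->]]|x|_]; last by exists s.
    by exists v; rewrite /= scale_idem.
  have [c ->] := hg x; elim/big_rec: _ => [|i y _ hy]; first exact: kspan0.
  apply: kspanD => //; apply: kspanZ; rewrite [g i](@decompose M).
  elim/big_rec: _ => [|v z _ hz]; first exact: kspan0.
  apply: kspanD => //; apply: kspan_mem.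
  by apply: allpairs_f; exact: mem_enum.
exists [set x | exists v, e v *: (x : M) = x]; split=> // x.
rewrite [x](@decompose M); elim/big_rec: _ => [|v z _ hz]; first exact: kspan0.
by apply: kspanD => //; apply: kspan_mem; exists v; rewrite scale_idem.
Qed.

(* The cover is minimal on the vertices of [L' \ L] because its generators form
   a basis of [M] over the field; this is why its kernel vanishes there. *)
Lemma layer_cover L L' M : succ_closed L' -> supp L' M ->
  (forall p, L' (origin p) -> L' (terminus p) -> ~ L (terminus p) ->
     path_length p = 0%N) ->
  exists Z P (i : {linear Z -> P}) (g : {linear P -> M}),
    [/\ short_exact i g, projective P, supp L' P, supp L Z
      & finitely_generated M -> finitely_generated Z].
Proof.
move=> sL' sM triv; have [G [Ghom Gspan Gfin]] := homogeneous_span M.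
have i0 : kindep (set0 : set (restrict scal M)) by [].
have [B [_ BG iB spanB]] := basis_extension i0 Gspan.
pose T := {x : restrict scal M | `[< B x >]}.
have hw (t : T) : exists v, e v *: (\val t : M) = \val t.
  by have /asboolP/BG[//|/Ghom] := valP t.
have {hw}[w hw] := choice hw.
have wL' t : L' (w t).
  apply: contrapT => /sM h; have := iB _ (asboolP _ (valP t)); apply.
  by rewrite -(hw t) h; exact: kspan0.
have [P [b [pP wb indP liftP]]] := @idempotent_projective R T (e \o w)
  (fun t => fr_idem F (w t)).
have [g hg] := liftP M _ hw.
have gs y : exists x, g x = y.
  elim: (spanB y) => [|c a x Ba _ [z hz]]; first by exists 0; rewrite linear0.
  have Ba' : `[< B a >] by apply/asboolP.
  pose t : T := exist (fun x => `[< B x >]) a Ba'.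
  by exists (scal c *: b t + z); rewrite linearP hz hg.
have suppP : supp L' P.
  move=> v hv; apply: indP => [|a t y hy]; first by rewrite scaler0.
  rewrite scalerDr hy addr0 -wb; apply: scale_nopath => p op tp.
  by apply: hv; rewrite -tp; apply: sL'; rewrite op; exact: wL'.
(* Within [L'] only trivial paths end at such a [v], so the component of [P] at [v] is spanned over
   [K] by generators, which lift distinct basis vectors of [M]. *)
have spanP v y : L' v -> ~ L v -> kspan (range b : set (restrict scal P)) (e v *: y).
  move=> L'v Lv; move: y; apply: indP => [|a t y hy].
    by rewrite scaler0; exact: kspan0.
  rewrite scalerDr; apply: kspanD => //; rewrite -wb /=.
  have [|c ->] := @scale_path P (w t) v a (b t).
    by move=> p op tp; apply: triv; rewrite ?op ?tp //; exact: wL'.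
  case: eqP => [<-|_]; last exact: kspan0.
  rewrite wb; apply: (@kspanZ _ _ _ c); apply: kspan_mem; by exists t.
exists (submod (ker_sub g)), P, \val, g; split=> //; first exact: short_exact_ker.
  move=> v Lv z; apply: val_inj; rewrite linearZ linear0 /=.
  have [L'v|/suppP ->//] := pselect (L' v).
  have h := @kindep_lift K (restrict scal M) (restrict scal P) B b
    (restrict_map scal g) iB hg (e v *: \val z).
  refine (h (spanP _ _ L'v Lv) _).
  by rewrite [LHS]linearZ (eqP (valP z)) [LHS]scaler0.
move=> fgM; have [s Gs] := Gfin fgM.
apply: (@finitely_generated_inj _ P \val); first exact: val_inj.
apply/finitely_generatedP; exists [seq b t | t <- pmap insub s] => S hS.
apply: indP => [|a t y yS]; first exact: rpred0.
apply: rpredD => //; apply: rpredZ; apply: hS; apply: map_f.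
rewrite mem_pmap_sub; have /asboolP/BG[//|] := valP t.
by rewrite Gs.
Qed.

(** * Removing vertices from the support by syzygies *)

Section Layers.
Variables (U D : set (vertex Q)) (t : nat).
Hypotheses (Usucc : succ_closed U) (UDsucc : succ_closed (U `|` D)).
Hypothesis UD : forall v, D v -> ~ U v.
Hypothesis Dlen : forall p, supported_path D p -> (path_length p <= t)%N.

(** [D] is filtered by the maximal length of a path inside [D] that starts at the vertex. Layer [0]
    adds nothing to [U], since trivial paths have length [0], and layer [t.+1] adds all of [D]. *)
Definition layer k : set (vertex Q) := U `|`
  [set v | D v /\ forall p, origin p = v -> supported_path D p ->
                            (path_length p < k)%N].

Lemma layer_supported p : (U `|` D) (origin p) -> D (terminus p) ->
  supported_path D p.
Proof.
move=> Up Dp v /path_split[q [r [oq tq or tr]]].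
case: (UDsucc (p := q)); rewrite ?oq ?tq // => Uv.
by case: (UD Dp); rewrite -tr; apply: Usucc; rewrite or.
Qed.

Lemma supported_concat L p q r : supported_path L p -> supported_path L q ->
  (forall v, v \in path_vertices r -> v \in path_vertices p \/ v \in path_vertices q) ->
  supported_path L r.
Proof. by move=> hp hq h v /h[/hp|/hq]. Qed.

Lemma layerUD k : layer k `<=` U `|` D.
Proof. by move=> v [Uv|[Dv _]]; [left | right]. Qed.

Lemma layer_succ_closed k : succ_closed (layer k).
Proof.
move=> p hp; have [Ut|Dt] := UDsucc (layerUD hp); first by left.
have supp_p := layer_supported (layerUD hp) Dt.
case: hp => [/Usucc Ut|[Do ho]]; first by case: (UD Dt).
right; split=> // q oq supp_q.
have [|r [or tr lr vr]] := @path_concat Q p q; first by rewrite oq.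
have := ho r or (supported_concat supp_p supp_q vr).
by rewrite lr; apply: leq_ltn_trans; exact: leq_addl.
Qed.

(** A vertex in layer [k.+1] but not in layer [k] starts a path of length at least [k] inside [D];
    prefixing a nontrivial [p] would make it too long for the layer of the origin of [p]. *)
Lemma layer_trivial k p : layer k.+1 (origin p) -> layer k.+1 (terminus p) ->
  ~ layer k (terminus p) -> path_length p = 0%N.
Proof.
move=> ho ht nt; have Dt : D (terminus p).
  by case: ht => [Ut|[]//]; case: nt; left.
have [q [oq supp_q lq]] : exists q, [/\ origin q = terminus p,
    supported_path D q & (k <= path_length q)%N].
  apply: contrapT => h; apply: nt; right; split=> // q oq supp_q.
  by rewrite ltnNge; apply/negP => lq; apply: h; exists q.
have supp_p := layer_supported (layerUD ho) Dt.
have Do : D (origin p) by apply: supp_p; exact: origin_path_vertices.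
case: ho => [Uo|[_ ho]]; first by case: (UD Do).
have [//|r [or tr lr vr]] := @path_concat Q p q.
have := ho r or (supported_concat supp_p supp_q vr).
rewrite lr ltnS => h; apply/eqP; rewrite -leqn0 -(leq_add2r (path_length q)).
exact: leq_trans h lq.
Qed.

Lemma layer0 : layer 0 `<=` U.
Proof.
move=> v [//|[Dv h]].
suff : (path_length (triv_path v) < 0)%N by [].
by apply: h => // u; rewrite inE => /eqP ->.
Qed.

Lemma layer_full : U `|` D `<=` layer t.+1.
Proof. by move=> v [Uv|Dv]; [left | right; split=> // p _ /Dlen]. Qed.

(** [X] is a [k]-th syzygy along covers that each clear one layer. Passing to it costs at most [k]
    in dimension and preserves finiteness of the dimension, as the finitistic case requires. *)
Lemma reduce_layers k M : supp (layer k) M -> exists X,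
  [/\ supp U X, forall n, pdim n X -> pdim (n + k) M,
      forall n, pdim n M -> pdim n X & finitely_generated M -> finitely_generated X].
Proof.
elim: k M => [|k IH] M sM.
  by exists M; split=> // [|n]; [exact: supp_mono layer0 sM | rewrite addn0].
have [Z [P [i [g [ex pP _ sZ fgZ]]]]] :=
  layer_cover (@layer_succ_closed k.+1) sM (@layer_trivial k).
have [X [sX hX1 hX2 fgX]] := IH Z sZ.
exists X; split=> // [n pX|n pM|fgM].
- by rewrite addnS; exists Z, P, i, g; split=> //; exact: hX1.
- by apply: hX2; exact: pdim_syzygy ex pP pM.
- exact/fgX/fgZ.
Qed.

End Layers.

(** The case of equal sets in [layer_cover], where the condition on paths is vacuous. *)
Lemma supported_cover L M : succ_closed L -> supp L M ->
  exists Z P (i : {linear Z -> P}) (g : {linear P -> M}),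
    [/\ short_exact i g, projective P, supp L P & supp L Z].
Proof.
move=> sL sM; have [|Z [P [i [g [ex pP sP sZ _]]]]] := layer_cover sL sM (L := L).
  by move=> p _ h /(_ h).
by exists Z, P, i, g.
Qed.

Section Minimal.
Variables (M N : lmodType R) (g : {linear M -> N}).

(** The components of a vector outside [C] lie in the kernel of [g], so the kernel and the part of
    [M] living on [C] together span [M]. *)
Lemma superfluous_supp C : succ_closed C -> superfluous (ker_sub g) ->
  (forall v x, ~ C v -> e v *: g x = 0) -> supp C M.
Proof.
move=> sC sup hg; have [T TP] := succ_closed_part M sC.
have all_T : forall x, x \in T.
  apply: sup => x; pose y := \sum_(v | v \notin C) e v *: x.
  exists y, (x - y); split; last by rewrite addrC subrK.
    apply/eqP; rewrite linear_sum big1 // => v; rewrite notin_setE => Cv.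
    by rewrite linearZ; exact: hg.
  apply/TP => v Cv; rewrite scalerBr scaler_sumr.
  rewrite (bigD1 v) ?notin_setE //= scale_idem big1 ?addr0 ?subrr // => u /andP[_ uv].
  by rewrite scale_orth // eq_sym.
by move=> v Cv x; have /TP := all_T x; apply.
Qed.

(* A kernel element at an isolated vertex spans a complemented line, which a
   superfluous submodule cannot contain. *)
Lemma superfluous_ker_supp C C' : supp C M -> superfluous (ker_sub g) ->
  (forall p, C (origin p) -> C (terminus p) -> ~ C' (terminus p) ->
     path_length p = 0%N) ->
  forall v x, ~ C' v -> g x = 0 -> e v *: x = 0.
Proof.
move=> sM sup triv v x0 C'v gx0.
have [Cv|/sM -> //] := pselect (C v); set x := e v *: x0.
have [//|/eqP x_neq0] := eqVneq x 0.
have gx : g x = 0 by rewrite /x linearZ /= gx0 scaler0.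
have ix : kindep ([set x] : set (restrict scal M)).
  by move=> _ -> h; apply: x_neq0; elim: h => [//|c a y [] //].
have spanT (y : restrict scal M) : kspan setT y by exact: kspan_mem.
have [B [xB _ iB spanB]] := basis_extension ix spanT.
have Bx : B x by exact: xB.
(* The vectors whose component at [v] does not involve the basis vector [x]. They form a submodule
   because inside the support only trivial paths end at [v]. *)
pose T : {pred M} := fun y =>
  `[< kspan (B `\ (x : restrict scal M)) (e v *: y : restrict scal M) >].
have T_sub : submod_closed T.
  split=> [|a y z /asboolP hy /asboolP hz]; apply/asboolP.
    by rewrite scaler0; exact: kspan0.
  rewrite scalerDr; apply: kspanD => //; rewrite [y]decompose !scaler_sumr.
  elim/big_rec: _ => [|u w _ hw]; first exact: kspan0.
  apply: kspanD => //.
  have [Cu|/sM ->] := pselect (C u); last by rewrite !scaler0; exact: kspan0.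
  have [|c ->] := @scale_path M u v a y.
    by move=> p op tp; apply: triv; rewrite ?op ?tp.
  by case: eqP => _; [exact: (kspanZ c hy) | exact: kspan0].
pose T' : submodClosed M := HB.pack T (GRing.isSubmodClosed.Build R M T T_sub).
have /asboolP : x \in T'.
  apply: sup => y; have [|c hc] := @kspanU1 _ _ (B `\ (x : restrict scal M)) x (e v *: y).
    by apply: kspanS (spanB _) => z Bz; have [->|zx] := pselect (z = x); [right | left].
  exists (scal c *: x), (y - scal c *: x); split.
  - by apply/eqP; rewrite linearZ /= gx scaler0.
  - by apply/asboolP; rewrite scalerBr scalC /x scale_idem; exact: hc.
  - by rewrite addrC subrK.
by rewrite /x scale_idem => h; case: (iB _ Bx).
Qed.

(** The complement of [C] is successor-closed, so the part of [N] living there is a submodule; it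
    meets the image of [g] in [0]. *)
Lemma essential_supp C : pred_closed C -> essential (im_sub g) ->
  (forall v x, ~ C v -> e v *: g x = 0) -> supp C N.
Proof.
move=> pC ess hg; have [T TP] := succ_closed_part N (pred_closedC pC).
move=> v Cv x; apply: (ess T) => [y /asboolP[z <-] /TP hz|].
  by apply: eq0_local => u; have [Cu|/hg //] := pselect (C u); apply: hz => /(_ Cu).
apply/TP => u /contrapT Cu; apply: scale_orth; apply/eqP => uv.
by apply: Cv; rewrite -uv.
Qed.

(** Inside the support only trivial paths start at [v], so [e v *: x] spans a submodule of dimension
    at most one. If it missed the image of [g], that line would meet the image in [0]. *)
Lemma essential_coker_supp C C' : supp C N -> essential (im_sub g) ->
  (forall p, C (terminus p) -> C (origin p) -> ~ C' (origin p) ->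
     path_length p = 0%N) ->
  forall v x, ~ C' v -> exists y, g y = e v *: x.
Proof.
move=> sN ess triv v x C'v.
have [Cv|/sN ->] := pselect (C v); last by exists 0; rewrite linear0.
set y := e v *: x; apply: contrapT => ny.
pose T : {pred N} := fun z => `[< exists c, z = scal c *: y >].
have T_sub : submod_closed T.
  split=> [|a z w /asboolP[c ->] /asboolP[d ->]]; apply/asboolP.
    by exists 0; rewrite rmorph0 scale0r.
  suff [d' hd'] : exists d', a *: y = scal d' *: y.
    by exists (c * d' + d); rewrite scalC hd' scalerA rmorphD rmorphM scalerDl.
  rewrite [a *: y]decompose; elim/big_rec: _ => [|u w' _ [d' ->]].
    by exists 0; rewrite rmorph0 scale0r.
  have [Cu|/sN ->] := pselect (C u); last by exists d'; rewrite add0r.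
  have [|c' ->] := @scale_path N v u a x.
    by move=> p op tp; apply: triv; rewrite ?op ?tp.
  case: eqP => [<-|_]; last by exists d'; rewrite add0r.
  by exists (c' + d'); rewrite rmorphD scalerDl.
pose T' : submodClosed N := HB.pack T (GRing.isSubmodClosed.Build R N T T_sub).
have y0 : y = 0.
  apply: (ess T') => [z /asboolP[z' hz'] /asboolP[c hc]|].
    have [c0|c0] := eqVneq c 0; first by rewrite hc c0 rmorph0 scale0r.
    case: ny; exists (scal c^-1 *: z').
    by rewrite linearZ /= hz' hc scalerA -rmorphM mulVf // rmorph1 scale1r.
  by apply/asboolP; exists 1; rewrite rmorph1 scale1r.
by apply: ny; exists 0; rewrite y0 linear0.
Qed.

End Minimal.

(** * Supports in minimal resolutions and coresolutions *)

Section MinimalResolution.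
Variables (D : set (vertex Q)) (t : nat).
Hypothesis Dlen : forall p, supported_path D p -> (path_length p <= t)%N.

Section Projective.
Hypothesis Dpred : pred_closed D.
Variables (M : lmodType R) (P : min_proj_res M).

(** The vertices where [P k] may live: inside [D] a minimal resolution advances by at least one
    arrow per degree. Beyond degree [t] nothing of [D] is left. *)
Let C k : set (vertex Q) := [set v | ~ D v \/
  exists p, [/\ terminus p = v, supported_path D p & (k <= path_length p)%N]].

Lemma depth_succ_closed k : succ_closed (C k).
Proof.
move=> p hp; have [Dt|nDt] := pselect (D (terminus p)); last by left.
have supp_p := pred_closed_supported Dpred Dt.
have Do : D (origin p) by apply: supp_p; exact: origin_path_vertices.
case: hp => [//|[q [tq supp_q lq]]]; right.
have [//|r [or tr lr vr]] := @path_concat Q q p.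
exists r; split=> //; first exact: supported_concat supp_q supp_p vr.
by rewrite lr; apply: leq_trans lq _; exact: leq_addr.
Qed.

Lemma depth_trivial k p : C k (origin p) -> C k (terminus p) ->
  ~ C k.+1 (terminus p) -> path_length p = 0%N.
Proof.
move=> hp _ nt; have Dt : D (terminus p).
  by apply: contrapT => h; apply: nt; left.
have supp_p := pred_closed_supported Dpred Dt.
have Do : D (origin p) by apply: supp_p; exact: origin_path_vertices.
case: hp => [//|[q [tq supp_q lq]]].
have [//|r [or tr lr vr]] := @path_concat Q q p.
case: (posnP (path_length p)) => // lp; case: nt; right.
exists r; split=> //; first exact: supported_concat supp_q supp_p vr.
by rewrite lr -addn1; exact: leq_add.
Qed.

(** The kernel of the map leaving [P k] lives on [C k.+1]; the next term covers it minimally, and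
    [C k.+1] is successor-closed, so that term lives there too. *)
Lemma min_res_depth k :
  supp (C k) (P k) /\
  forall v x, ~ C k.+1 v -> pr_bd P k x = 0 -> e v *: x = 0.
Proof.
suff h : supp (C k) (P k).
  by split=> //; exact: superfluous_ker_supp h (@mpr_min _ _ P k) (@depth_trivial k).
elim: k => [|k IH]; apply: (superfluous_supp (@depth_succ_closed _) (@mpr_min _ _ P _)).
  move=> v x []; have [Dv|] := pselect (D v); last by left.
  right; exists (triv_path v); split=> //.
  by move=> u; rewrite inE => /eqP ->.
move=> v x Cv.
apply: (superfluous_ker_supp IH (@mpr_min _ _ P k) (@depth_trivial k) Cv).
by case: (k) x => [|k'] x; [apply/pr_exact0 | apply/pr_exact]; exists x.
Qed.

Lemma depth_top k : (t < k)%N -> C k `<=` ~` D.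
Proof.
by move=> tk v [//|[p [_ /Dlen lp kp]]]; have := leq_trans (leq_ltn_trans lp tk) kp;
  rewrite ltnn.
Qed.

Lemma min_res_supp k : supp (~` D) (P (k + t.+1)%N).
Proof.
apply: supp_mono (min_res_depth _).1; apply: depth_top.
by rewrite addnS ltnS leq_addl.
Qed.

Lemma syzygy_supp : supp (~` D) (syzygy P t.+1).
Proof.
move=> v Dv [x hx]; apply: val_inj; rewrite linearZ linear0 /=.
apply: (min_res_depth t).2; last exact/eqP.
by move=> /(depth_top (ltnSn t)).
Qed.

End Projective.

Section Injective.
Hypothesis Dsucc : succ_closed D.
Variables (N : lmodType R) (E : min_inj_cores N).

Let C k : set (vertex Q) := [set v | ~ D v \/
  exists p, [/\ origin p = v, supported_path D p & (k <= path_length p)%N]].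

Lemma height_pred_closed k : pred_closed (C k).
Proof.
move=> p hp; have [Do|nDo] := pselect (D (origin p)); last by left.
have supp_p := succ_closed_supported Dsucc Do.
have Dt : D (terminus p) by apply: supp_p; exact: terminus_path_vertices.
case: hp => [//|[q [oq supp_q lq]]]; right.
have [//|r [or tr lr vr]] := @path_concat Q p q.
exists r; split=> //; first exact: supported_concat supp_p supp_q vr.
by rewrite lr; apply: leq_trans lq _; exact: leq_addl.
Qed.

Lemma height_trivial k p : C k (terminus p) -> C k (origin p) ->
  ~ C k.+1 (origin p) -> path_length p = 0%N.
Proof.
move=> hp _ no; have Do : D (origin p).
  by apply: contrapT => h; apply: no; left.
have supp_p := succ_closed_supported Dsucc Do.
have Dt : D (terminus p) by apply: supp_p; exact: terminus_path_vertices.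
case: hp => [//|[q [oq supp_q lq]]].
have [//|r [or tr lr vr]] := @path_concat Q p q.
case: (posnP (path_length p)) => // lp; case: no; right.
exists r; split=> //; first exact: supported_concat supp_p supp_q vr.
by rewrite lr -add1n; exact: leq_add.
Qed.

(** Dual to [min_res_depth]: the cokernel of the map into [E k] lives on [C k.+1], which is
    predecessor-closed, and the next term is an essential extension of it. *)
Lemma min_cores_height k :
  supp (C k) (E k) /\
  forall v x, ~ C k.+1 v -> exists y, ic_cobd E k y = e v *: x.
Proof.
suff h : supp (C k) (E k).
  by split=> //; exact: essential_coker_supp h (@mic_min _ _ E k) (@height_trivial k).
elim: k => [|k IH]; apply: (essential_supp (@height_pred_closed _) (@mic_min _ _ E _)).
  move=> v x []; have [Dv|] := pselect (D v); last by left.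
  right; exists (triv_path v); split=> //.
  by move=> u; rewrite inE => /eqP ->.
move=> v x Cv.
have [y hy] := essential_coker_supp IH (@mic_min _ _ E k) (@height_trivial k) x Cv.
rewrite -linearZ -hy.
by case: (k) y {hy} => [|k'] y; [apply/ic_exact0 | apply/ic_exact]; exists y.
Qed.

Lemma cosyzygy_supp : supp (~` D) (cosyzygy E t.+1).
Proof.
move=> v Dv q; have [x <-] := @quotmod_pi_surj _ _ (im_sub (ic_cobd E t)) q.
rewrite -linearZ; apply/quotmod_pi_eq0/asboolP.
apply: (min_cores_height t).2 => -[//|[p [_ /Dlen lp tp]]].
by have := leq_trans tp lp; rewrite ltnn.
Qed.

End Injective.
End MinimalResolution.
End Frame.

(** * Bound quiver algebras *)

Section PathAlgebraScalars.
Variables (K : fieldType) (Q : quiver).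
Local Notation A := (path_alg K Q).

Definition path_scal (c : K) : A := \sum_(v : vertex Q) path_term c (triv_path v).

Lemma path_termM a b p q :
  path_term a p * path_term b q = opath_elt (a * b) (path_comp p q) :> A.
Proof. exact: path_mulUU. Qed.

Lemma path_termD a b p : path_term (a + b) p = path_term a p + path_term b p :> A.
Proof. exact: (opath_eltD a b (Some p)). Qed.

Lemma path_scal_term c a p : path_scal c * path_term a p = path_term (c * a) p.
Proof.
rewrite mulr_suml (bigD1 (origin p)) //= big1 => [|v nv].
  by rewrite path_termM path_comp_trivl eqxx addr0.
by rewrite path_termM path_comp_trivl (negPf nv).
Qed.

Lemma path_term_scal c a p : path_term a p * path_scal c = path_term (a * c) p.
Proof.
rewrite mulr_sumr (bigD1 (terminus p)) //= big1 => [|v nv].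
  by rewrite path_termM path_comp_trivr eqxx addr0.
by rewrite path_termM path_comp_trivr (negPf nv).
Qed.

Lemma path_scal_comm c x : path_scal c * x = x * path_scal c.
Proof.
elim/path_alg_ind: x => [|x y hx hy|a p]; first by rewrite mul0r mulr0.
  by rewrite mulrDl mulrDr hx hy.
by rewrite path_scal_term path_term_scal mulrC.
Qed.

Lemma path_scalD a b : path_scal (a + b) = path_scal a + path_scal b.
Proof.
by rewrite -big_split /=; apply: eq_bigr => v _; rewrite path_termD.
Qed.

Lemma path_scalM a b : path_scal (a * b) = path_scal a * path_scal b.
Proof.
by rewrite mulr_sumr; apply: eq_bigr => v _; rewrite path_scal_term.
Qed.

Lemma path_elt_arrow_ideal n (p : qpath Q) : (n <= path_length p)%N ->
  ideal_exp (arrow_ideal K Q) n (path_elt K p).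
Proof.
elim: n p => [|n IH] p //=; rewrite /path_length.
case/lastP e: (arrows p) => [//|s a].
rewrite size_rcons ltnS => ns; have := valP p.
rewrite -/(origin p) -/(arrows p) e -cats1 is_walk_cat => /andP[ws wa].
pose q : qpath Q := exist (fun z => is_walk z.1 z.2) (origin p, s) ws.
have qa : path_comp q (arrow_path a) = Some p.
  apply/path_compP; split.
    by move: wa => /=; rewrite andbT => /eqP.
  by rewrite -/(origin q) cats1 -e; exact: surjective_pairing.
move=> J [_ hJ]; apply: hJ; exists (path_elt K q), (path_elt K (arrow_path a)).
split; first exact: IH.
  by move=> J' [_ hJ']; apply: hJ'; exists a.
by rewrite [RHS]path_termM qa /= mulr1.
Qed.

Lemma short_paths n : exists s : seq (qpath Q), forall p,
  (path_length p < n)%N -> p \in s.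
Proof.
exists (pmap insub (flatten [seq [seq (v, tval s) | v <- enum (vertex Q),
          s <- enum {: m.-tuple (arrow Q)}] | m <- iota 0 n])) => p pn.
rewrite mem_pmap_sub; apply/flattenP.
exists [seq (v, tval s) | v <- enum (vertex Q),
          s <- enum {: (path_length p).-tuple (arrow Q)}].
  by apply: map_f; rewrite mem_iota.
apply/allpairsP; exists (origin p, in_tuple (arrows p)); split.
- exact: mem_enum.
- exact: mem_enum.
- exact: surjective_pairing.
Qed.

End PathAlgebraScalars.

Lemma converse_mulE (B : pzRingType) (x y : B^c) : x * y = (y : B) * (x : B) :> B.
Proof. by []. Qed.

Lemma sandwichD (A : pzRingType) (v u w x y c d : A) :
  v * x * u = c * w -> v * y * u = d * w -> v * (x + y) * u = (c + d) * w.
Proof. by move=> hx hy; rewrite mulrDr !mulrDl hx hy. Qed.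

Section QuotientFrame.
Variables (K : fieldType) (Q : quiver) (B : pzRingType).
Variables (pi : {rmorphism path_alg K Q -> B}) (n : nat).
Hypothesis pi_surj : forall b, exists x, pi x = b.
Hypothesis pi_nil : forall x, ideal_exp (arrow_ideal K Q) n x -> pi x = 0.

Lemma path_quot_ind (D : B -> Prop) : D 0 ->
  (forall x y, D x -> D y -> D (x + y)) -> (forall a p, D (pi (path_term a p))) ->
  forall x, D x.
Proof.
move=> D0 DD Dt b; have [x <-] := pi_surj b.
elim/path_alg_ind: x => [|x y hx hy|a p]; first by rewrite rmorph0.
  by rewrite rmorphD; exact: DD.
exact: Dt.
Qed.

Definition quot_scal (c : K) : B^c := pi (path_scal Q c).

Fact quot_scal_zmod : zmod_morphism quot_scal.
Proof.
move=> a b; apply/(addIr (quot_scal b)); rewrite subrK.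
transitivity (pi (path_scal Q (a - b) + path_scal Q b)); first by rewrite rmorphD.
by rewrite -path_scalD subrK.
Qed.
Fact quot_scal_monoid : monoid_morphism quot_scal.
Proof.
split=> [|a b]; first exact: (rmorph1 pi).
by rewrite converse_mulE /quot_scal -rmorphM -path_scalM mulrC.
Qed.
HB.instance Definition _ :=
  GRing.isZmodMorphism.Build K B^c quot_scal quot_scal_zmod.
HB.instance Definition _ :=
  GRing.isMonoidMorphism.Build K B^c quot_scal quot_scal_monoid.

Lemma quot_scalE c p : quot_scal c * (pi (path_elt K p) : B^c) = pi (path_term c p).
Proof. by rewrite converse_mulE -rmorphM path_term_scal mul1r. Qed.

Lemma quot_comm c (a : B^c) : quot_scal c * a = a * quot_scal c.
Proof.
have [x <-] := pi_surj a.
by rewrite !converse_mulE -!rmorphM path_scal_comm.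
Qed.

(** Paths of length at least [n] die in [B], so the finitely many shorter ones span it. *)
Lemma quot_fin : exists m (g : 'I_m -> B^c), forall a, exists c : 'I_m -> K,
  a = \sum_(i < m) quot_scal (c i) * g i.
Proof.
have [s hs] := short_paths Q n.
exists (size s), (fun i => pi (path_elt K (tnth (in_tuple s) i))).
apply: path_quot_ind => [|x y [c ->] [d ->]|a p].
- by exists (fun=> 0); rewrite big1 // => i _; rewrite rmorph0 mul0r.
- exists (fun i => c i + d i); rewrite -big_split /=.
  by apply: eq_bigr => i _; rewrite rmorphD mulrDl.
have [pn|np] := ltnP (path_length p) n; last first.
  exists (fun=> 0); rewrite big1 => [|i _]; last by rewrite rmorph0 mul0r.
  rewrite -quot_scalE converse_mulE pi_nil ?mul0r //.
  exact: path_elt_arrow_ideal.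
have /(nthP p)[k ks ep] := hs p pn.
have {}ep : tnth (in_tuple s) (Ordinal ks) = p by rewrite (tnth_nth p).
exists (fun i => if i == Ordinal ks then a else 0).
rewrite (bigD1 (Ordinal ks)) // eqxx ep big1 => [|i /negPf ->].
  by rewrite (quot_scalE a p) [RHS]addr0.
by rewrite rmorph0 mul0r.
Qed.

Definition quot_vertex (v : vertex Q) : B^c := pi (path_elt K (triv_path v)).

Lemma quot_vertex_sum : \sum_v quot_vertex v = 1.
Proof. by rewrite -(rmorph_sum pi); exact: (rmorph1 pi). Qed.

Lemma vertex_mul_term u b p :
  (quot_vertex u : B) * pi (path_term b p) =
  if u == origin p then pi (path_term b p) else 0.
Proof.
rewrite -rmorphM path_termM path_comp_trivl.
by case: eqP => _; rewrite /= ?mul1r // rmorph0.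
Qed.

Lemma term_mul_vertex u b p :
  pi (path_term b p) * (quot_vertex u : B) =
  if u == terminus p then pi (path_term b p) else 0.
Proof.
rewrite -rmorphM path_termM path_comp_trivr.
by case: eqP => _; rewrite /= ?mulr1 // rmorph0.
Qed.

Lemma quot_vertex_mul u v :
  quot_vertex u * quot_vertex v = if u == v then quot_vertex u else 0.
Proof.
by rewrite converse_mulE vertex_mul_term eq_sym; case: eqP => // ->.
Qed.

Lemma quot_vertex_path u v (a : B^c) :
  (forall p, origin p = u -> terminus p = v -> path_length p = 0%N) ->
  exists c, quot_vertex v * a * quot_vertex u =
            quot_scal c * (quot_vertex v * quot_vertex u).
Proof.
move=> triv; move: a; apply: path_quot_ind => [|x y [c hc] [d hd]|a p].
- by exists 0; rewrite rmorph0 !mul0r mulr0 mul0r.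
- exists (c + d); have -> : quot_scal (c + d) = quot_scal c + quot_scal d.
    exact: (rmorphD quot_scal).
  exact: sandwichD hc hd.
have [x [ex xv ux]] : exists x : B, [/\ x = pi (path_term a p),
    x * (quot_vertex v : B) = (if v == terminus p then x else 0)
  & (quot_vertex u : B) * x = (if u == origin p then x else 0)].
  exists (pi (path_term a p)); split; first by [].
    exact: (term_mul_vertex v a p).
  exact: (vertex_mul_term u a p).
suff [c hc] : exists c, (quot_vertex u : B) * (x * (quot_vertex v : B)) =
    ((quot_vertex u : B) * (quot_vertex v : B)) * (quot_scal c : B).
  by exists c; move: hc; rewrite ex.
rewrite xv; case: eqP => [tp|_]; last first.
  by exists 0; rewrite (rmorph0 quot_scal) !mulr0.
rewrite ux; case: eqP => [op|_]; last first.
  by exists 0; rewrite (rmorph0 quot_scal) !mulr0.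
have /size0nil p0 := triv p (esym op) (esym tp).
have vu : v = u by rewrite tp /terminus p0 op.
exists a; have pu : p = triv_path u.
  by apply: val_inj; rewrite [LHS]surjective_pairing -/(origin p) -/(arrows p) -op p0.
have -> : (quot_vertex u : B) * (quot_vertex v : B) = quot_vertex u.
  by rewrite vu; have := vertex_mul_term u 1 (triv_path u); rewrite eqxx.
by rewrite ex pu; exact: (esym (quot_scalE a (triv_path u))).
Qed.

Lemma quot_vertex_idem v : quot_vertex v * quot_vertex v = quot_vertex v.
Proof. by rewrite quot_vertex_mul eqxx. Qed.

Lemma quot_vertex_orth u v : u != v -> quot_vertex u * quot_vertex v = 0.
Proof. by rewrite quot_vertex_mul => /negPf ->. Qed.

Definition quot_frame : frame K B^c Q :=
  @Frame K B^c Q quot_scal quot_vertex quot_comm quot_fin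
    quot_vertex_sum quot_vertex_idem quot_vertex_orth quot_vertex_path.

End QuotientFrame.

Section QuotientRing.
Variables (R : pzRingType) (I : ideal R).

Definition quot_pi (x : R) : quot_ring I := \pi_(quot_ring I) x.

Fact quot_pi_zmod : zmod_morphism quot_pi.
Proof.
move=> x y; apply/(addIr (quot_pi y)); rewrite subrK.
exact: etrans (quot_piD I (x - y) y) (congr1 quot_pi (subrK y x)).
Qed.
Fact quot_pi_monoid : monoid_morphism quot_pi.
Proof. by split=> // x y; apply/esym; exact: quot_piM. Qed.
HB.instance Definition _ :=
  GRing.isZmodMorphism.Build R (quot_ring I) quot_pi quot_pi_zmod.
HB.instance Definition _ :=
  GRing.isMonoidMorphism.Build R (quot_ring I) quot_pi quot_pi_monoid.

Lemma quot_pi_surj b : exists x, quot_pi x = b.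
Proof. by exists (repr b); exact: reprK. Qed.

Lemma quot_pi_eq0 x : I x -> quot_pi x = 0.
Proof.
move=> Ix; rewrite -(rmorph0 quot_pi).
by apply/quot_eqP; rewrite subr0; apply/ideal_memP.
Qed.

End QuotientRing.

Lemma bound_frame (K : fieldType) (Q : quiver) (I : ideal (path_alg K Q)) :
  admissible I ->
  exists F : frame K (bound_alg I)^c Q, fr_e F = (fun v => vertex_elt I v).
Proof.
move=> [n [_ hn _]].
pose nil x (h : ideal_exp (arrow_ideal K Q) n x) := quot_pi_eq0 (hn x h).
by exists (@quot_frame K Q (quot_ring I) (@quot_pi _ I) n (@quot_pi_surj _ I) nil).
Qed.

(** * The homological heart *)

Section Heart.
Variable Q : quiver.
Local Notation H := (heart Q).
Local Notation Hp := (sub_plus H).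
Local Notation Hm := (sub_minus H).
Local Notation Ho := (sub_o H).

Lemma path_concat_mid (p q : qpath Q) : terminus p = origin q ->
  exists r, [/\ origin r = origin p, terminus r = terminus q
    & terminus p \in path_vertices r].
Proof.
move=> e; have [r hr] := path_comp_ex e; exists r; split.
- exact: path_comp_origin hr.
- exact: path_comp_terminus hr.
rewrite /path_vertices (path_comp_origin hr) (path_comp_arrows hr) map_cat -cat_cons.
by rewrite mem_cat terminus_path_vertices.
Qed.

Lemma heart_from_cycle v : H v ->
  exists r, cycle_vertices Q (origin r) /\ terminus r = v.
Proof.
case=> [hv|[r [or _ /path_split[r' [_ [o' t' _ _]]]]]].
  by exists (triv_path v).
by exists r'; rewrite o'.
Qed.

Lemma heart_to_cycle v : H v ->
  exists r, origin r = v /\ cycle_vertices Q (terminus r).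
Proof.
case=> [hv|[r [_ tr /path_split[_ [r' [_ _ o' t']]]]]].
  by exists (triv_path v).
by exists r'; rewrite t'.
Qed.

(** Every vertex of the heart is reached from a cycle vertex and reaches one. The composite of [p]
    and [q] thus extends to a path between cycle vertices, which passes through the junction. *)
Lemma heart_convex (p q : qpath Q) : terminus p = origin q ->
  H (origin p) -> H (terminus q) -> H (terminus p).
Proof.
move=> pq /heart_from_cycle[r [or tr]] /heart_to_cycle[s [os ts]].
have [r1 [o1 t1 _]] := path_concat_mid tr.
have [r2 [o2 t2 _]] := path_concat_mid (esym os).
have [|r3 [o3 t3 m3]] := @path_concat_mid r1 r2; first by rewrite t1 o2.
by right; exists r3; rewrite o3 t3 o1 t2 -t1.
Qed.

Lemma heart_plus_succ_closed : succ_closed Hp.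
Proof.
move=> p [nH [q [Hq tq]]]; have [r [or tr _]] := path_concat_mid tq.
split; last by exists r; rewrite or.
by move=> Ht; apply: nH; rewrite -tq; exact: heart_convex tq Hq Ht.
Qed.

Lemma heart_minus_pred_closed : pred_closed Hm.
Proof.
move=> p [nH [q [oq Hq]]]; have [r [or tr _]] := path_concat_mid (esym oq).
split; last by exists r; rewrite tr.
by move=> Ho; apply: nH; exact: heart_convex (esym oq) Ho Hq.
Qed.

Lemma heart_succ_closed : succ_closed (H `|` Hp).
Proof.
move=> p [Hv|hp]; last by right; exact: heart_plus_succ_closed.
have [Ht|nH] := pselect (H (terminus p)); first by left.
by right; split=> //; exists p.
Qed.

Lemma heart_pred_closed : pred_closed (H `|` Hm).
Proof.
move=> p [Hv|hp]; last by right; exact: heart_minus_pred_closed.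
have [Ht|nH] := pselect (H (origin p)); first by left.
by right; split=> //; exists p.
Qed.

Lemma heart_plus_minus v : Hp v -> Hm v -> False.
Proof.
move=> [nH [p [Hp' tp]]] [_ [q [oq Hq]]]; apply: nH; rewrite -tp.
by apply: heart_convex Hp' Hq; rewrite tp oq.
Qed.

Lemma outside_heart v : ~ H v -> (Hp `|` Hm `|` Ho) v.
Proof.
move=> nH; have [hp|np] := pselect (Hp v); first by left; left.
have [hm|nm] := pselect (Hm v); first by left; right.
right; split=> // p; split=> [[op tp]|[op tp]].
  by apply: np; split=> //; exists p.
by apply: nm; split=> //; exists p.
Qed.

Lemma longest_path_lengthP t (L D : set (vertex Q)) p : longest_path_length L t ->
  D `<=` L -> supported_path D p -> (path_length p <= t)%N.
Proof.
move=> ht DL supp_p; have {}supp_p : supported_path L p by move=> v /supp_p /DL.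
(* In the empty case no path is supported, since even a trivial path has a vertex. *)
case: ht => [[L0 _]|[_ /(_ p supp_p)] //].
by have := supp_p _ (origin_path_vertices p); rewrite L0.
Qed.

End Heart.

(** * Modules over a quotient ring *)

Section Descent.
Variables (A : pzRingType) (J : ideal A).

Definition converse_pi (x : A^c) : (quot_ring J)^c := quot_pi J x.

Fact converse_pi_zmod : zmod_morphism converse_pi.
Proof. by move=> x y; exact: (@quot_pi_zmod A J x y). Qed.
Fact converse_pi_monoid : monoid_morphism converse_pi.
Proof. by split=> // x y; exact: ((@quot_pi_monoid A J).2 y x). Qed.
HB.instance Definition _ := GRing.isZmodMorphism.Build A^c (quot_ring J)^c
  converse_pi converse_pi_zmod.
HB.instance Definition _ := GRing.isMonoidMorphism.Build A^c (quot_ring J)^c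
  converse_pi converse_pi_monoid.

Definition inflate (B : lmodType (quot_ring J)^c) : lmodType A^c :=
  restrict converse_pi B.

Lemma inflate_annihilated B : annihilated J (inflate B).
Proof.
move=> a x Ja; have e : (converse_pi a : (quot_ring J)^c) = 0 by exact: quot_pi_eq0.
have h (b : (quot_ring J)^c) : b = 0 -> b *: (x : B) = 0.
  by move=> ->; exact: scale0r.
exact: h e.
Qed.

Lemma descendE (C : lmodType A^c) (hC : annihilated J C) (a : A) (x : descend hC) :
  (quot_pi J a : (quot_ring J)^c) *: x = (a : A^c) *: (x : C) :> C.
Proof. exact: descend_scale_pi. Qed.

Lemma undescend (C D : lmodType A^c) (hC : annihilated J C) (hD : annihilated J D)
    (f : {linear descend hC -> descend hD}) :
  exists g : {linear C -> D}, forall x, g x = f x.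
Proof.
have gl : linear (f : C -> D).
  move=> a x y.
  have e : (a : A^c) *: x + y = (quot_pi J a : (quot_ring J)^c) *: (x : descend hC) + y.
    by congr (_ + _); exact: (esym (descendE (hC := hC) a x)).
  transitivity (f ((quot_pi J a : (quot_ring J)^c) *: (x : descend hC) + y)).
    by rewrite -e.
  rewrite linearP; exact: (congr1 (fun z : D => z + f y) (descendE (hC := hD) a (f x))).
by exists (mk_linear gl).
Qed.

Lemma to_inflate (C : lmodType A^c) (hC : annihilated J C)
    (B : lmodType (quot_ring J)^c)
    (f : {linear descend hC -> B}) :
  exists g : {linear C -> inflate B}, forall x, g x = f x.
Proof.
have gl : linear (f : C -> inflate B).
  move=> a x y.
  transitivity (f ((quot_pi J a : (quot_ring J)^c) *: (x : descend hC) + y)).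
    exact: (congr1 (fun z : C => f (z + y)) (esym (descendE (hC := hC) a x))).
  exact: linearP.
by exists (mk_linear gl).
Qed.

Lemma from_inflate (C : lmodType A^c) (hC : annihilated J C)
    (B : lmodType (quot_ring J)^c)
    (f : {linear C -> inflate B}) :
  exists g : {linear descend hC -> B}, forall x, g x = f x.
Proof.
have gl : linear (f : descend hC -> B).
  move=> a x y; have [a' <-] := quot_pi_surj a.
  transitivity (f ((a' : A^c) *: (x : C) + y)).
    exact: (congr1 (fun z : C => f (z + y)) (descendE (hC := hC) a' x)).
  exact: linearP.
by exists (mk_linear gl).
Qed.

Lemma descend_fg (C : lmodType A^c) (hC : annihilated J C) :
  finitely_generated C -> finitely_generated (descend hC).
Proof.
move=> [n [g hg]]; exists n, g => x; have [c hc] := hg x.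
exists (fun i => quot_pi J (c i)); rewrite hc; apply: eq_bigr => i _.
exact: (esym (descendE (hC := hC) (c i) (g i))).
Qed.

Lemma inflate_fg B : finitely_generated B -> finitely_generated (inflate B).
Proof.
move=> [n [g hg]]; exists n, g => x; have [c hc] := hg x.
exists (fun i => repr (c i : quot_ring J)); rewrite hc.
apply: eq_bigr => i _.
exact: (congr1 (fun a : (quot_ring J)^c => a *: (g i : B))
  (esym (reprK (c i : quot_ring J)))).
Qed.

(** The factorisation hypothesis makes [C] the largest quotient of [P] annihilated by [J]. A lift
    from [P] into an inflated module therefore descends to [C]. *)
Lemma descend_projective (P C : lmodType A^c) (hC : annihilated J C)
    (q : {linear P -> C}) : projective P -> (forall y, exists x, q x = y) ->
  (forall (D : lmodType A^c) (f : {linear P -> D}), annihilated J D ->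
     exists g : {linear C -> D}, forall x, g (q x) = f x) ->
  projective (descend hC).
Proof.
move=> pP qs qfac M N g f gs.
have [f' hf'] := to_inflate f.
have [h hh] := pP (inflate M) (inflate N) (restrict_map converse_pi g) (f' \o q) gs.
have [h' hh'] := qfac _ h (@inflate_annihilated M).
have [k hk] := from_inflate hC h'.
exists k => y; have [x <-] := qs y.
rewrite hk hh'; exact: etrans (hh x) (hf' (q x)).
Qed.

End Descent.

(** * Global and finitistic dimension *)

Lemma frame_compl (K : fieldType) (A : pzRingType) (Q : quiver)
    (F : frame K A^c Q) (L : set (vertex Q)) v : ~ L v ->
  (fr_e F v : A) * \sum_(w | w \notin L) (fr_e F w : A) = fr_e F v.
Proof.
move=> Hv; rewrite mulr_sumr (bigD1 v) ?notin_setE //= big1 => [|w /andP[_ wv]].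
  by rewrite addr0; exact: (fr_idem F v).
exact: (fr_orth F wv).
Qed.

Section HeartModules.
Variables (K : fieldType) (Q : quiver) (I : ideal (path_alg K Q)).
Local Notation Lam := (bound_alg I)^c.
Local Notation Gam := (assoc_alg I (heart Q))^c.
Variable F : frame K Lam Q.
Hypothesis eF : fr_e F = (fun v => vertex_elt I v).
Local Notation e := (fr_e F).
Local Notation H := (heart Q).
Local Notation Hp := (sub_plus H).
Local Notation Hm := (sub_minus H).
Local Notation U := (H `|` Hp).
Implicit Types (L : set (vertex Q)) (C M N P X Z : lmodType Lam).

Lemma suppE L C : supp F L C <-> supported L C.
Proof. by rewrite /supp eF. Qed.

(** Since [H+] is successor-closed, these equations define a submodule, which contains every
    submodule supported on [H+]. All later work uses the equations. *)
Lemma mod_plusP C x : x \in mod_plus C <-> forall v, ~ Hp v -> e v *: x = 0.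
Proof.
have [T TP] := succ_closed_part F C (@heart_plus_succ_closed Q).
rewrite -TP; split=> [/asboolP h|xT].
  apply: h => S /suppE hS y yS; apply/TP => v Hv.
  exact: (congr1 \val (hS v Hv (in_submod yS))).
apply/asboolP => S hS; apply: (hS T _ x xT); apply/suppE => v Hv [y yT].
by apply: val_inj; move/TP: (yT) => /(_ v Hv).
Qed.

(** The complement of [H-] is successor-closed, so the equations define a submodule. It is the
    smallest admissible one: if [C/S] lives on [H-], every component of [x] at another vertex lies
    in [S]. *)
Lemma mod_minusP C x : x \in mod_minus C <-> forall v, Hm v -> e v *: x = 0.
Proof.
split=> [/asboolP h|h].
  have [T TP] := succ_closed_part F C (pred_closedC (@heart_minus_pred_closed Q)).
  have /TP hx : x \in T.
    apply: h; apply/suppE => v Hv q; have [y <-] := quotmod_pi_surj q.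
    rewrite -linearZ; apply/quotmod_pi_eq0/TP => w /contrapT Hw.
    by apply: scale_orth; apply/eqP => wv; apply: Hv; rewrite -wv.
  by move=> v Hv; apply: hx => /(_ Hv).
apply/asboolP => S /suppE hS; rewrite [x](decompose F).
apply: (rpred_sum (S := S)) => v _; have [Hv|Hv] := pselect (Hm v).
  by rewrite h // rpred0.
by apply/quotmod_pi_eq0; rewrite linearZ; exact: hS.
Qed.

Lemma mod_plus_supp C : supp F Hp (submod (mod_plus C)).
Proof. by move=> v Hv [y hy]; apply: val_inj; move/mod_plusP: (hy) => /(_ v Hv). Qed.

Lemma quot_plus_supp C : supp F U C -> supported H (quotmod (mod_plus C)).
Proof.
move=> sC; apply/suppE => v Hv q; have [x <-] := quotmod_pi_surj q.
rewrite -linearZ; apply/quotmod_pi_eq0/mod_plusP => w Hw.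
have [wv|wv] := eqVneq w v; last exact: scale_orth.
by rewrite wv scale_idem sC // => -[//|]; rewrite -wv.
Qed.

Lemma annihilated_supp C : annihilated (compl_ideal I H) C -> supp F H C.
Proof.
move=> hC v Hv x; suff Iv : compl_ideal I H (vertex_elt I v).
  by rewrite eF; exact: hC.
move=> J [[_ _ JM] hJ].
have /(JM (vertex_elt I v))[h _] := hJ _ erefl; move: h.
suff -> : vertex_elt I v * compl_idem I H = vertex_elt I v by [].
by have := frame_compl F Hv; rewrite eF.
Qed.

Definition heart_quot C (sC : supp F U C) : lmodType Gam :=
  as_assoc_mod (quot_plus_supp sC).

(** * Exactness of the passage from X to X/X+ *)

Section Exactness.
Variables (A B : lmodType Lam) (f : {linear A -> B}).

Definition plus_map : {linear quotmod (mod_plus A) -> quotmod (mod_plus B)} :=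
  quotmod_map (@mod_plus_map K Q I A B f).

Lemma plus_map_pi x :
  plus_map (quotmod_pi (mod_plus A) x) = quotmod_pi (mod_plus B) (f x).
Proof. exact: (quotmod_map_pi (@mod_plus_map K Q I A B f) x). Qed.

Lemma plus_map_surj : (forall y, exists x, f x = y) ->
  forall y, exists x, plus_map x = y.
Proof.
move=> fs q; have [y <-] := quotmod_pi_surj q; have [x <-] := fs y.
by exists (quotmod_pi _ x); rewrite plus_map_pi.
Qed.

Lemma plus_map_inj : injective f -> injective plus_map.
Proof.
move=> fi; apply: linear_injP => q; have [x <-] := quotmod_pi_surj q.
rewrite plus_map_pi => /quotmod_pi_eq0/mod_plusP h.
apply/quotmod_pi_eq0/mod_plusP => v Hv; apply: fi.
by rewrite linear0 linearZ; exact: h.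
Qed.
End Exactness.

Lemma plus_map_square (A B B' C : lmodType Lam) (f : {linear A -> B})
    (g : {linear B -> C}) (f' : {linear A -> B'}) (g' : {linear B' -> C}) :
  (forall x, g (f x) = g' (f' x)) ->
  forall q, plus_map g (plus_map f q) = plus_map g' (plus_map f' q).
Proof.
move=> h q; have [x <-] := quotmod_pi_surj q.
by rewrite !plus_map_pi h.
Qed.

Lemma plus_map_exact (A B C : lmodType Lam) (f : {linear A -> B})
    (g : {linear B -> C}) : (forall x, g x = 0 <-> exists y, f y = x) ->
  forall x, plus_map g x = 0 <-> exists y, plus_map f y = x.
Proof.
move=> ex q; split=> [|[p <-]]; last first.
  have [y <-] := quotmod_pi_surj p; rewrite !plus_map_pi.
  have -> : g (f y) = 0 by apply/ex; exists y.
  exact: linear0.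
have [x <-] := quotmod_pi_surj q; rewrite plus_map_pi => /quotmod_pi_eq0/mod_plusP h.
(* Dropping the components at [H+] leaves the class of [x] unchanged and puts the representative
   into the kernel of [g] itself. *)
pose x' := \sum_(v | v \notin Hp) e v *: x.
have [|y hy] := (ex x').1.
  rewrite linear_sum big1 // => v; rewrite notin_setE => Hv.
  by rewrite linearZ; exact: h.
exists (quotmod_pi _ y); rewrite plus_map_pi hy.
apply/eqP; rewrite -subr_eq0 -linearB; apply/eqP/quotmod_pi_eq0/mod_plusP => v Hv.
rewrite scalerBr scaler_sumr (bigD1 v) ?notin_setE //= scale_idem.
rewrite big1 ?addr0 ?subrr // => w /andP[_ wv].
by rewrite scale_orth // eq_sym.
Qed.

Lemma plus_map_short_exact Z P M (i : {linear Z -> P}) (g : {linear P -> M})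
    (sZ : supp F U Z) (sP : supp F U P) (sM : supp F U M) :
  short_exact i g ->
  short_exact (as_assoc_map (quot_plus_supp sZ) (quot_plus_supp sP) (plus_map i))
              (as_assoc_map (quot_plus_supp sP) (quot_plus_supp sM) (plus_map g)).
Proof.
move=> [ii gs ex]; split.
- exact: (plus_map_inj ii).
- exact: (plus_map_surj gs).
- exact: (plus_map_exact ex).
Qed.

(** A Gamma-module has no component at [H+], so every map from [P] into one factors through
    [P/P+]. *)
Lemma heart_quot_projective P (sP : supp F U P) : projective P ->
  projective (heart_quot sP).
Proof.
move=> pP; apply: (descend_projective (q := quotmod_pi (mod_plus P))) => //.
  exact: quotmod_pi_surj.
move=> D f /annihilated_supp sD.
have [|g hg] := @quotmod_lift _ _ _ (mod_plus P) f; last by exists g.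
move=> x /mod_plusP h; refine (@eq0_local _ _ _ F D (f x) _) => v.
have [Hv|/h xv] := pselect (Hp v); last by rewrite -linearZ xv linear0.
by apply: sD => Hv'; case: Hv.
Qed.

Lemma heart_quot_pdim n M (sM : supp F U M) : pdim n M -> pdim n (heart_quot sM).
Proof.
elim: n M sM => [|n IH] M sM pM; first exact: heart_quot_projective.
have [Z [P [i [g [ex pP sP sZ]]]]] := supported_cover (@heart_succ_closed Q) sM.
exists (heart_quot sZ), (heart_quot sP),
  (as_assoc_map (quot_plus_supp sZ) (quot_plus_supp sP) (plus_map i)),
  (as_assoc_map (quot_plus_supp sP) (quot_plus_supp sM) (plus_map g)).
split; first exact: plus_map_short_exact.
  exact: heart_quot_projective.
by apply: IH; exact: pdim_syzygyS ex pP pM.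
Qed.

(** * Comparison of dimensions over Lambda and Gamma *)

Section Bounds.
Variable t : nat.
Hypothesis ht : longest_path_length (Hp `|` Hm `|` sub_o H) t.

(** The layer argument with [U] empty: after [t.+1] syzygies the support is empty, so the syzygy is
    zero. *)
Lemma plus_pdim M : supp F Hp M -> pdim t.+1 M.
Proof.
move=> sM.
have Hp_len p : supported_path Hp p -> (path_length p <= t)%N.
  by apply: longest_path_lengthP ht _ => v Hv; left; left.
have s0 : succ_closed (set0 : set (vertex Q)) by [].
have sp : succ_closed (set0 `|` Hp) by rewrite set0U; exact: heart_plus_succ_closed.
have d0 v : Hp v -> ~ (set0 : set (vertex Q)) v by move=> _ [].
have sM' : supp F (layer set0 Hp t.+1) M.
  by apply: supp_mono sM => v Hv; apply: (layer_full Hp_len); right.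
have [X [sX hX _ _]] := reduce_layers s0 sp d0 sM'.
apply: (hX 0%N); apply: projective_zero => x.
by refine (@eq0_local _ _ _ F X x _) => v; exact: sX.
Qed.

Lemma reduce_to_heart M : exists X,
  [/\ supp F U X, forall n, pdim n X -> pdim (n + t.+1) M,
      forall n, pdim n M -> pdim n X & finitely_generated M -> finitely_generated X].
Proof.
have D_len p : supported_path (~` U) p -> (path_length p <= t)%N.
  apply: longest_path_lengthP ht _ => v nU.
  by apply: outside_heart => Hv; apply: nU; left.
have UD : U `|` ~` U = setT by rewrite setUv.
apply: (reduce_layers (D := ~` U) (@heart_succ_closed Q)) => //.
  by rewrite UD.
by move=> v []; apply: (layer_full D_len); rewrite UD.
Qed.

Lemma eq_on_generators (T : Type) P N (b : T -> P) (f g : {linear P -> N}) :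
  (forall D : P -> Prop, D 0 -> (forall a s y, D y -> D (a *: b s + y)) ->
     forall y, D y) ->
  (forall s, f (b s) = g (b s)) -> f =1 g.
Proof.
move=> ind fg; apply: ind => [|a s y hy]; first by rewrite !linear0.
by rewrite !linearP fg hy.
Qed.

(* [P] is generated by elements supported at vertices of the heart, so that no
   nonzero endomorphism of [P] takes its values in [mod_plus P]. *)
Lemma heart_generated_cover M : supp F U M ->
  exists P (f : {linear P -> M}),
    [/\ projective P, supp F U P, forall y, exists x, plus_map f x = y
      & forall g g' : {linear P -> P},
          (forall x, g x - g' x \in mod_plus P) -> g =1 g'].
Proof.
move=> sM; pose T := {s : vertex Q * M | `[< H s.1 /\ e s.1 *: s.2 = s.2 >]}.
pose w (s : T) := (\val s).1.
have hw s : H (w s) /\ e (w s) *: (\val s).2 = (\val s).2.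
  exact: (asboolP _ (valP s)).
have [P [b [pP wb indP liftP]]] := @idempotent_projective Lam T (e \o w)
  (fun s => fr_idem F (w s)).
have [f hf] := liftP M (fun s => (\val s).2) (fun s => (hw s).2).
exists P, f; split=> //.
- move=> v hv; apply: indP => [|a s y hy]; first exact: scaler0.
  rewrite scalerDr hy addr0 -wb; apply: scale_nopath => p op tp.
  by apply: hv; rewrite -tp; apply: heart_succ_closed; rewrite op; left; exact: (hw s).1.
- move=> q; have [m <-] := quotmod_pi_surj q.
  have im h : exists x, f x = if `[< H h >] then e h *: m else 0.
    case: asboolP => Hh; last by exists 0; exact: linear0.
    have hs : `[< H (h, m).1 /\ e (h, m).1 *: (e h *: m) = e h *: m >].
      by apply/asboolP; split=> //; rewrite scale_idem.
    pose s : T := exist (fun s : vertex Q * M => `[< H s.1 /\ e s.1 *: s.2 = s.2 >])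
      (h, e h *: m) hs.
    by exists (b s); rewrite hf.
  (* The components at the heart suffice: those at [H+] vanish in [M/M+], and [M] has no others. *)
  have [x hx] := choice im.
  exists (quotmod_pi _ (\sum_h x h)); rewrite plus_map_pi; apply/eqP.
  rewrite -subr_eq0 -linearB; apply/eqP/quotmod_pi_eq0/mod_plusP => v Hv.
  rewrite linear_sum scalerBr scaler_sumr (bigD1 v) //= hx big1 => [|u uv].
    case: asboolP => [_|nH]; first by rewrite addr0 scale_idem subrr.
    by rewrite scaler0 addr0 sub0r (sM v) ?oppr0 // => -[].
  rewrite hx; case: asboolP => _; last exact: scaler0.
  by apply: scale_orth; rewrite eq_sym.
- move=> g g' gg'; apply: (eq_on_generators indP) => s; apply/eqP.
  rewrite -subr_eq0; have /mod_plusP h := gg' (b s).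
  have -> : g (b s) - g' (b s) = e (w s) *: (g (b s) - g' (b s)).
    have wbs : e (w s) *: b s = b s := wb s.
    by rewrite scalerBr -!linearZ wbs.
  by apply/eqP; apply: h => -[]; case: (hw s).
Qed.

(* The idempotent of [heart_quot sP] that splits off [heart_quot sM] lifts to an
   idempotent of [P]; with a cover of [mod_plus M], its image covers [M] with a
   kernel supported outside the heart. *)
Lemma heart_quot_projective_pdim M (sM : supp F U M) :
  projective (heart_quot sM) -> pdim t.+2 M.
Proof.
move=> pT; have [P [f [pP sP fs rigid]]] := heart_generated_cover sM.
pose Tf : {linear heart_quot sP -> heart_quot sM} :=
  as_assoc_map (quot_plus_supp sP) (quot_plus_supp sM) (plus_map f).
have [s hs] : exists s : {linear heart_quot sM -> heart_quot sP}, cancel s Tf.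
  exact: projective_section.
have [s' hs'] := undescend s.
have {hs} hs q : plus_map f (s' q) = q by rewrite hs'; exact: hs.
(* Projectivity of [P] lifts the idempotent [s' \o plus_map f] of [P/P+] to an endomorphism of
   [P]. *)
have [eps heps] := pP _ _ (quotmod_pi (mod_plus P))
  (s' \o (plus_map f \o quotmod_pi (mod_plus P))) (@quotmod_pi_surj _ _ _).
have pi_eps x : quotmod_pi (mod_plus P) (eps x) = s' (quotmod_pi (mod_plus M) (f x)).
  exact: etrans (heps x) (congr1 s' (plus_map_pi f x)).
have pi_f x : quotmod_pi (mod_plus M) (f (eps x)) = quotmod_pi (mod_plus M) (f x).
  by rewrite -plus_map_pi pi_eps hs.
(* A priori [eps] is idempotent only modulo [mod_plus P]; rigidity of [P] removes the error. *)
have epsK x : eps (eps x) = eps x.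
  apply: (rigid (eps \o eps) eps) => y; apply/quotmod_pi_eq0.
  rewrite linearB; apply/eqP; rewrite subr_eq0; apply/eqP.
  by rewrite /= !pi_eps pi_f.
have [r hr] : exists r : {linear P -> submod (im_sub eps)}, forall x, \val (r x) = eps x.
  by apply: linear_to_submod => x; apply/asboolP; exists x.
have epsV (y : submod (im_sub eps)) : eps (\val y) = \val y.
  by have /asboolP[z hz] := valP y; rewrite -hz epsK.
have pE : projective (submod (im_sub eps)).
  apply: (@projective_retract _ _ _ \val r) pP => y.
  by apply: val_inj; rewrite hr epsV.
have [Z' [P' [i' [g' [[_ gs' _] pP' sP' _]]]]] :=
  supported_cover (@heart_plus_succ_closed Q) (@mod_plus_supp M).
(* The image of [eps] reaches [M] only modulo [mod_plus M]; the cover [P'] of [mod_plus M] supplies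
   the rest. *)
pose G : {linear (submod (im_sub eps) * P')%type -> M} :=
  ((f \o \val) \o fst) \+ ((\val \o g') \o snd).
have Gs m : exists x, G x = m.
  have [x hx] := quotmod_pi_surj (s' (quotmod_pi (mod_plus M) m)).
  have hm : m - f (eps x) \in mod_plus M.
    apply/quotmod_pi_eq0; rewrite linearB; apply/eqP; rewrite subr_eq0; apply/eqP.
    by rewrite [RHS]pi_f -[RHS]plus_map_pi hx hs.
  have [y hy] := gs' (in_submod hm).
  by exists (r x, y); rewrite /G /= hr hy /= addrC subrK.
exists (submod (ker_sub G)), (submod (im_sub eps) * P')%type, \val, G.
split; [exact: short_exact_ker | exact: projective_prod |].
(* At [v] outside [H+], [P'] has no component, and the component [z] of [x] satisfies [f z = 0]. As
   [eps] is induced through [f] modulo [mod_plus P], [z = eps z] lies in [mod_plus P], hence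
   vanishes. *)
apply: plus_pdim => v Hv [[x y] /= xy]; apply: val_inj; rewrite linearZ linear0.
congr pair; last exact: sP'.
apply: val_inj; rewrite /=; set z := e v *: \val x.
have fz : f z = 0.
  have := eqP xy; rewrite /G /= => /(congr1 (fun m => e v *: m)).
  rewrite scaler0 scalerDr; have /mod_plusP -> // := valP (g' y).
  by rewrite addr0 /z linearZ.
have epsz : eps z = z by rewrite /z linearZ epsV.
have /mod_plusP/(_ v Hv) : z \in mod_plus P.
  by apply/quotmod_pi_eq0; rewrite -epsz pi_eps fz !linear0.
by rewrite /z scale_idem.
Qed.

Lemma heart_quot_pdim_conv n M (sM : supp F U M) :
  pdim n (heart_quot sM) -> pdim (n + t.+2) M.
Proof.
elim: n M sM => [|n IH] M sM pM; first exact: heart_quot_projective_pdim pM.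
have [Z [P [i [g [ex pP sP sZ]]]]] := supported_cover (@heart_succ_closed Q) sM.
exists Z, P, i, g; split=> //; apply: (IH Z sZ).
exact: pdim_syzygyS (plus_map_short_exact sZ sP sM ex) (heart_quot_projective pP) pM.
Qed.

Lemma inflate_supp (C : lmodType Gam) : supp F U (inflate C).
Proof.
by apply: supp_mono (annihilated_supp (@inflate_annihilated _ _ C)) => v; left.
Qed.

(** A Gamma-module has no component at [H+], so the quotient changes nothing: every Gamma-module
    arises from a Lambda-module supported on [U]. *)
Lemma heart_quot_inflate (C : lmodType Gam) :
  exists f : {linear heart_quot (@inflate_supp C) -> C},
    injective f /\ forall y, exists x, f x = y.
Proof.
have [|g hg] := @quotmod_lift _ _ _ (mod_plus (inflate C)) idfun.
  move=> x /mod_plusP h; refine (@eq0_local _ _ _ F (inflate C) x _) => v.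
  have [Hv|/h //] := pselect (Hp v).
  by apply: (annihilated_supp (@inflate_annihilated _ _ C)) => Hv'; case: Hv.
have gi : injective g.
  move=> q q'; have [x <-] := quotmod_pi_surj q.
  by have [x' <-] := quotmod_pi_surj q'; rewrite !hg => /= ->.
have [f hf] := from_inflate (supported_annihilated (quot_plus_supp (@inflate_supp C))) g.
exists f; split=> [q q'|y]; first by rewrite !hf => /gi.
have [q hq] : exists q, g q = y by exists (quotmod_pi (mod_plus (inflate C)) y).
by exists q; rewrite hf.
Qed.

Lemma heart_quot_fg M (sM : supp F U M) :
  finitely_generated M -> finitely_generated (heart_quot sM).
Proof.
move=> fgM; apply: descend_fg.
exact: (finitely_generated_surj (@quotmod_pi_surj _ _ (mod_plus M)) fgM).
Qed.

Lemma gldim_heart : gldim_finite Lam <-> gldim_finite Gam.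
Proof.
split=> -[n hn].
  exists n => C; apply/pd_leP; have [f [fi fs]] := heart_quot_inflate C.
  by apply: (pdim_iso fi fs); apply/heart_quot_pdim/pd_leP.
(* [t.+1] syzygies bring the support into [U]; [t.+2] is the bound when [X/X+] is projective, namely
   one cover and a kernel on [H+]. *)
exists (n + t.+2 + t.+1)%N => M; apply/pd_leP.
have [X [sX hX _ _]] := reduce_to_heart M; apply: hX.
exact/(heart_quot_pdim_conv (sM := sX))/pd_leP.
Qed.

Lemma findim_heart : findim_finite Lam <-> findim_finite Gam.
Proof.
split=> -[n hn].
  exists n => C fgC [k /pd_leP pC]; apply/pd_leP.
  have [f [fi fs]] := heart_quot_inflate C.
  apply: (pdim_iso fi fs); apply/heart_quot_pdim/pd_leP; apply: hn.
    exact: inflate_fg.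
  (* The bound over Lambda concerns modules of finite dimension only; any finite value for the
     inflated module will do. *)
  exists (k + t.+2)%N; apply/pd_leP/(heart_quot_pdim_conv (sM := @inflate_supp C)).
  have [f' [ff' f'f]] := linear_inverse fi fs.
  apply: (@pdim_iso _ _ _ _ f') pC; first exact: can_inj f'f.
  by move=> y; exists (f y).
exists (n + t.+2 + t.+1)%N => M fgM [k /pd_leP pM]; apply/pd_leP.
have [X [sX hX hX' fgX]] := reduce_to_heart M; apply: hX.
apply/(heart_quot_pdim_conv (sM := sX))/pd_leP; apply: hn.
  exact/heart_quot_fg/fgX.
by exists k; apply/pd_leP/heart_quot_pdim/hX'.
Qed.

End Bounds.
End HeartModules.

(** * Ext over the heart *)

Section ExtOverHeart.
Variables (K : fieldType) (Q : quiver) (I : ideal (path_alg K Q)).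
Local Notation Lam := (bound_alg I)^c.
Local Notation Gam := (assoc_alg I (heart Q))^c.
Variable F : frame K Lam Q.
Hypothesis eF : fr_e F = (fun v => vertex_elt I v).
Local Notation e := (fr_e F).
Local Notation H := (heart Q).
Local Notation Hp := (sub_plus H).
Local Notation Hm := (sub_minus H).
Local Notation U := (H `|` Hp).
Local Notation V := (H `|` Hm).
Variable t : nat.
Hypothesis ht : longest_path_length (Hp `|` Hm `|` sub_o H) t.
Implicit Types (M N P X Y : lmodType Lam).

Lemma outside_len (D : set (vertex Q)) p : D `<=` ~` H ->
  supported_path D p -> (path_length p <= t)%N.
Proof.
by move=> DH; apply: longest_path_lengthP ht _ => v /DH; exact: outside_heart.
Qed.

Lemma supp_notnot L X : supp F (~` ~` L) X -> supp F L X.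
Proof. by apply: supp_mono => v /contrapT. Qed.

Lemma outsideU p : supported_path (~` U) p -> (path_length p <= t)%N.
Proof. by apply: outside_len => v nU Hv; apply: nU; left. Qed.

Lemma outsideV p : supported_path (~` V) p -> (path_length p <= t)%N.
Proof. by apply: outside_len => v nV Hv; apply: nV; left. Qed.

Lemma min_res_heart M (P : min_proj_res M) k : supp F U (P (k + t.+1)%N).
Proof.
apply: supp_notnot; apply: (min_res_supp F outsideU).
exact: (succ_closedC (@heart_succ_closed Q)).
Qed.

Lemma syzygy_heart M (P : min_proj_res M) : supp F U (syzygy P t.+1).
Proof.
apply: supp_notnot; apply: (syzygy_supp F outsideU).
exact: (succ_closedC (@heart_succ_closed Q)).
Qed.

Lemma cosyzygy_heart N (E : min_inj_cores N) : supp F V (cosyzygy E t.+1).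
Proof.
apply: supp_notnot; apply: (cosyzygy_supp F outsideV).
exact: (pred_closedC (@heart_pred_closed Q)).
Qed.

Lemma A_mod_supp M (P : min_proj_res M) : supported H (A_mod t P).
Proof. exact: (quot_plus_supp eF (@syzygy_heart M P)). Qed.

Lemma mod_minus_supp Y : supp F V Y -> supported H (submod (mod_minus Y)).
Proof.
move=> sY; apply/(suppE eF) => v Hv [x xY].
have [Hv'|Hv'] := pselect (Hm v).
  by apply: val_inj; move/(mod_minusP eF): (xY) => /(_ v Hv').
by apply: val_inj; apply: sY => -[].
Qed.

Lemma B_mod_supp N (E : min_inj_cores N) : supported H (B_mod t E).
Proof. exact: (mod_minus_supp (@cosyzygy_heart N E)). Qed.

(** * Homomorphisms over Lambda and over Gamma *)

Section HomOverHeart.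
Variables (P Y : lmodType Lam) (sP : supp F U P) (sY : supp F V Y).
Local Notation TP := (heart_quot eF sP).
Local Notation BY := (as_assoc_mod (mod_minus_supp sY)).

Definition hom_heart (z : {linear P -> Y}) (u : {linear TP -> BY}) : Prop :=
  forall x, \val (u (quotmod_pi (mod_plus P) x) : submod (mod_minus Y)) = z x.

(** [Y] has no component at [H+], so [z] kills [P+]; [P] has none at [H-], so the image of [z] lies
    in [mod_minus Y]. *)
Lemma hom_heart_total z : exists u, hom_heart z u.
Proof.
have [x /(mod_plusP eF) h|z1 hz1] := @quotmod_lift _ _ _ (mod_plus P) z.
  refine (@eq0_local _ _ _ F Y (z x) _) => v.
  have [Hv|/h xv] := pselect (Hp v); last by rewrite -linearZ xv linear0.
  by apply: sY => -[Hv'|Hv']; [case: Hv | exact: heart_plus_minus Hv Hv'].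
have [|z2 hz2] := @linear_to_submod _ _ _ (mod_minus Y) z1.
  move=> q; have [x <-] := quotmod_pi_surj q; rewrite hz1.
  apply/(mod_minusP eF) => v Hv; rewrite -linearZ sP ?linear0 // => -[Hv'|Hv'].
    by case: Hv.
  exact: heart_plus_minus Hv' Hv.
exists (as_assoc_map (quot_plus_supp eF sP) (mod_minus_supp sY) z2) => x.
exact: etrans (hz2 _) (hz1 x).
Qed.

Lemma hom_heart_surj u : exists z, hom_heart z u.
Proof.
have [g hg] := undescend u.
exists (\val \o (g \o quotmod_pi (mod_plus P))) => x.
exact: (congr1 \val (esym (hg _))).
Qed.

End HomOverHeart.

Section HeartResolution.
Variables (M : lmodType Lam) (P : min_proj_res M).

Lemma syzygy_aug_ex :
  exists a : {linear P (0 + t.+1)%N -> submod (ker_sub (pr_bd P t))},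
    forall x, \val (a x) = pr_d P t x.
Proof.
by apply: (@linear_to_submod _ _ _ (ker_sub (pr_bd P t)) (pr_d P t)) => x;
  apply/eqP/pr_bd_d.
Qed.

Definition syzygy_aug : {linear P (0 + t.+1)%N -> syzygy P t.+1} :=
  projT1 (cid syzygy_aug_ex).

Lemma syzygy_augE x :
  \val (syzygy_aug x : submod (ker_sub (pr_bd P t))) = pr_d P t x.
Proof. exact: (projT2 (cid syzygy_aug_ex)). Qed.

Lemma syzygy_aug_surj y : exists x, syzygy_aug x = y.
Proof.
case: y => y hy; have [x hx] := (pr_bd_exact (P := P) (n := t) y).1 (eqP hy).
by exists x; apply: val_inj; rewrite [LHS]syzygy_augE.
Qed.

Lemma syzygy_aug_exact x :
  syzygy_aug x = 0 <-> exists y, pr_d P (0 + t.+1) y = x.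
Proof.
rewrite -(pr_exact (p := P) (n := t) x) -syzygy_augE.
split=> [-> //|h]; exact: val_inj.
Qed.

(** With the summands in this order, [n.+1 + t.+1] is convertible to [(n + t.+1).+1], so the
    differentials of [P] apply without casts. *)
Definition heart_res_obj n : lmodType Gam :=
  heart_quot eF (@min_res_heart M P n).

Definition heart_res_aug :
    {linear heart_res_obj 0 -> as_assoc_mod (@A_mod_supp M P)} :=
  as_assoc_map (quot_plus_supp eF (@min_res_heart M P 0)) (@A_mod_supp M P)
    (plus_map syzygy_aug).

Definition heart_res_d n : {linear heart_res_obj n.+1 -> heart_res_obj n} :=
  as_assoc_map (quot_plus_supp eF (@min_res_heart M P n.+1))
    (quot_plus_supp eF (@min_res_heart M P n)) (plus_map (pr_d P (n + t.+1)%N)).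

Lemma heart_res_projective n : projective (heart_res_obj n).
Proof. exact/heart_quot_projective/pr_projective. Qed.

Lemma heart_res_surj y : exists x, heart_res_aug x = y.
Proof. exact: (plus_map_surj syzygy_aug_surj). Qed.

Lemma heart_res_exact0 x :
  heart_res_aug x = 0 <-> exists y, heart_res_d 0 y = x.
Proof. exact: (plus_map_exact eF syzygy_aug_exact). Qed.

Lemma heart_res_exact n x :
  heart_res_d n x = 0 <-> exists y, heart_res_d n.+1 y = x.
Proof. exact: (plus_map_exact eF (@pr_exact _ _ P (n + t.+1)%N)). Qed.

Definition heart_res : proj_res (as_assoc_mod (@A_mod_supp M P)) :=
  @ProjRes Gam _ heart_res_obj heart_res_aug heart_res_d heart_res_projective
    heart_res_surj heart_res_exact0 heart_res_exact.

End HeartResolution.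

Section HeartResolutionMap.
Variables (M M' : lmodType Lam) (P : min_proj_res M) (P' : min_proj_res M').
Variables (f : {linear M -> M'}) (c : chain_map P P' f).

Definition heart_res_fun n : {linear heart_res P n -> heart_res P' n} :=
  as_assoc_map (quot_plus_supp eF (@min_res_heart M P n))
    (quot_plus_supp eF (@min_res_heart M' P' n)) (plus_map (c (n + t.+1)%N)).

Lemma heart_res_comm n x :
  pr_bd (heart_res P') n (heart_res_fun n x) =
  pr_tgt_map (as_assoc_map (@A_mod_supp M P) (@A_mod_supp M' P') (A_map t c))
    heart_res_fun n (pr_bd (heart_res P) n x).
Proof.
case: n x => [|n] q; last first.
  apply: plus_map_square q => x; exact: (cm_comm c (n := (n + t.+1).+1) x).
apply: plus_map_square q => x; apply: val_inj; rewrite [LHS]syzygy_augE.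
transitivity (c t (\val (syzygy_aug P x : submod (ker_sub (pr_bd P t))))) => //.
by rewrite syzygy_augE; exact: (cm_comm c (n := t.+1) x).
Qed.

Definition heart_res_map : chain_map (heart_res P) (heart_res P')
    (as_assoc_map (@A_mod_supp M P) (@A_mod_supp M' P') (A_map t c)) :=
  ChainMap heart_res_comm.

End HeartResolutionMap.

Section ExtComparisonOverHeart.
Variables (M N : lmodType Lam) (P : min_proj_res M) (E : min_inj_cores N) (m : nat).
Local Notation Y := (cosyzygy E t.+1).
Local Notation B := (as_assoc_mod (@B_mod_supp N E)).

Definition cocycle_heart (z : cocycle P Y (m.+1 + t.+1)%N)
    (u : cocycle (heart_res P) B m.+1) : Prop :=
  hom_heart (sP := @min_res_heart M P m.+1) (sY := @cosyzygy_heart N E)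
    (cocycle_fun z) (cocycle_fun u).

Lemma cocycle_heartB z u z' u' : cocycle_heart z u -> cocycle_heart z' u' ->
  cocycle_heart (z - z') (u - u').
Proof.
move=> h h' x; rewrite cocycle_funB [RHS]cocycle_funB.
have subE (a b : B) : \val (a - b : submod (mod_minus Y)) =
    \val (a : submod (mod_minus Y)) - \val (b : submod (mod_minus Y)) by [].
by rewrite [LHS]subE h h'.
Qed.

Lemma heart_res_d_pi n x :
  heart_res_d P n (quotmod_pi (mod_plus (P (n.+1 + t.+1)%N)) x) =
  quotmod_pi (mod_plus (P (n + t.+1)%N)) (pr_d P (n + t.+1)%N x).
Proof. exact: (plus_map_pi (pr_d P (n + t.+1)%N) x). Qed.

Lemma cocycle_heart_total z : exists u, cocycle_heart z u.
Proof.
have [u hu] := hom_heart_total (@min_res_heart M P m.+1) (@cosyzygy_heart N E)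
  (cocycle_fun z).
have [|w hw] := @mk_cocycle _ _ B (heart_res P) m.+1 u.
  move=> q; have [x <-] := @quotmod_pi_surj _ _ (mod_plus (P (m.+2 + t.+1)%N)) q.
  apply: val_inj; rewrite -[pr_d _ _ _]/(heart_res_d P m.+1 _) heart_res_d_pi.
  by rewrite [LHS]hu; exact: (cocycle_d z x).
by exists w => x; rewrite hw hu.
Qed.

Lemma cocycle_heart_surj u : exists z, cocycle_heart z u.
Proof.
have [z hz] := @hom_heart_surj _ _ (@min_res_heart M P m.+1) (@cosyzygy_heart N E)
  (cocycle_fun u).
have [|w hw] := @mk_cocycle _ _ Y P (m.+1 + t.+1)%N z.
  move=> x; rewrite -(hz (pr_d P (m.+1 + t.+1)%N x)) -heart_res_d_pi.
  by rewrite [cocycle_fun u _](cocycle_d u).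
by exists w => x; rewrite hw hz.
Qed.

(** The degree [m.+1] is positive, so primitives live on the term of index [m], where the
    correspondence of homomorphisms still holds and carries them over both ways. *)
Lemma cocycle_heart_coboundary z u : cocycle_heart z u ->
  z \in @coboundary_pred Lam M P (m.+1 + t.+1)%N Y <->
  u \in @coboundary_pred Gam _ (heart_res P) m.+1 B.
Proof.
move=> h; split=> /asboolP[y hy]; apply/asboolP.
  have [v hv] := hom_heart_total (@min_res_heart M P m) (@cosyzygy_heart N E) y.
  exists v => q; have [x <-] := @quotmod_pi_surj _ _ (mod_plus (P (m.+1 + t.+1)%N)) q.
  apply: val_inj; rewrite [LHS]h [LHS]hy.
  apply: etrans (esym (hv _)) _.
  by rewrite -[quotmod_pi _ _]heart_res_d_pi.
have [v hv] := @hom_heart_surj _ _ (@min_res_heart M P m) (@cosyzygy_heart N E) y.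
exists v => x; rewrite -[LHS]h hy.
apply: etrans _ (hv _).
by rewrite -[in RHS]heart_res_d_pi.
Qed.

Lemma ext_heart_iso :
  exists phi : {additive Ext_of P (m.+1 + t.+1)%N Y -> Ext_of (heart_res P) m.+1 B},
    bijective phi /\
    forall z u, cocycle_heart z u -> phi (ext_class z) = ext_class u.
Proof.
apply: ext_correspondence.
- exact: cocycle_heartB.
- exact: cocycle_heart_total.
- exact: cocycle_heart_surj.
- exact: cocycle_heart_coboundary.
Qed.

End ExtComparisonOverHeart.

Lemma cocycle_heart_natural M M' N N' (P : min_proj_res M) (P' : min_proj_res M')
    (E : min_inj_cores N) (E' : min_inj_cores N') (f : {linear M -> M'})
    (g : {linear N -> N'}) (c : chain_map P P' f) (d : cochain_map E E' g) m
    (z : cocycle P' (cosyzygy E t.+1) (m.+1 + t.+1)%N) u :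
  cocycle_heart z u ->
  cocycle_heart (cocycle_map c (cosyzygy_map d t.+1) z)
    (cocycle_map (heart_res_map c)
      (as_assoc_map (@B_mod_supp N E) (@B_mod_supp N' E') (B_map t d)) u).
Proof.
move=> h x.
rewrite -[RHS]/(cosyzygy_map d t.+1 (cocycle_fun z (c (m.+1 + t.+1)%N x))) -h.
congr (cosyzygy_map d t.+1 (\val (cocycle_fun u _ : submod _))).
exact: (plus_map_pi (c (m.+1 + t.+1)%N) x).
Qed.

Definition ext_heart_map M N (P : min_proj_res M) (E : min_inj_cores N) m :=
  projT1 (cid (ext_heart_iso P E m)).

Lemma ext_heart_map_natural M M' N N' (P : min_proj_res M) (P' : min_proj_res M')
    (E : min_inj_cores N) (E' : min_inj_cores N') (f : {linear M -> M'})
    (g : {linear N -> N'}) (c : chain_map P P' f) (d : cochain_map E E' g) m xi :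
  ext_heart_map P E' m (Ext_of_map c (cosyzygy_map d t.+1) xi) =
  Ext_of_map (heart_res_map c)
    (as_assoc_map (@B_mod_supp N E) (@B_mod_supp N' E') (B_map t d))
    (ext_heart_map P' E m xi).
Proof.
have [_ h] := projT2 (cid (ext_heart_iso P E' m)).
have [_ h'] := projT2 (cid (ext_heart_iso P' E m)).
have [z <-] := ext_class_surj xi; have [u zu] := cocycle_heart_total z.
have e1 := h _ _ (cocycle_heart_natural c d zu).
have e2 := h' _ _ zu.
apply: etrans (congr1 (ext_heart_map P E' m) (Ext_of_map_class c _ z)) _.
apply: etrans e1 _; apply: etrans (esym (Ext_of_map_class (heart_res_map c) _ u)) _.
by rewrite [ext_heart_map _ _ _ _]e2.
Qed.

(** The degree is written to be spent in order: the leading [t.+1] on cosyzygies of [N], then, the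
    rest being convertible to [m.+1 + t.+1], its [t.+1] on truncating [P]. The outer factors
    exchange standard resolutions for [P] and [heart_res P]. *)
Lemma ext_heart m : exists Phi : forall M N (P : min_proj_res M) (E : min_inj_cores N),
    {additive Ext (t.+1 + (m + t.+1).+1)%N M N ->
      Ext m.+1 (as_assoc_mod (@A_mod_supp M P)) (as_assoc_mod (@B_mod_supp N E))},
  (forall M N (P : min_proj_res M) (E : min_inj_cores N), bijective (Phi M N P E)) /\
  (forall M M' N N' (P : min_proj_res M) (P' : min_proj_res M')
     (E : min_inj_cores N) (E' : min_inj_cores N') (f : {linear M -> M'})
     (g : {linear N -> N'}) (c : chain_map P P' f) (d : cochain_map E E' g) xi,
   Phi M N' P E' (Ext_map f g xi) =
   Ext_map (as_assoc_map (@A_mod_supp M P) (@A_mod_supp M' P') (A_map t c))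
           (as_assoc_map (@B_mod_supp N E) (@B_mod_supp N' E') (B_map t d))
           (Phi M' N P' E xi)).
Proof.
have [S [Sb Sn]] := @natural_shift_iter Lam (m + t.+1)%N t.+1.
exists (fun M N (P : min_proj_res M) (E : min_inj_cores N) =>
  ext_compare (free_res _) (heart_res P) (as_assoc_mod (@B_mod_supp N E)) m \o
    (ext_heart_map P E m \o
      (S M N P E \o ext_compare P (free_res M) N (t + (m + t.+1).+1)%N))).
split=> [M N P E|M M' N N' P P' E E' f g c d xi].
  have [hb _] := projT2 (cid (ext_heart_iso P E m)).
  apply: (bij_comp (ext_compare_bij _ _ _ _)); apply: (bij_comp hb).
  exact: (bij_comp (Sb _ _ _ _) (ext_compare_bij _ _ _ _)).
have e1 := ext_compare_natural c (free_res_map f) g xi.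
have e2 := Sn _ _ _ _ _ _ _ _ _ _ c d (ext_compare P' (free_res M') N _ xi).
have e3 := ext_heart_map_natural c d
  (S M' N P' E (ext_compare P' (free_res M') N _ xi)).
have e := etrans (congr1 (ext_heart_map P E' m) (etrans (congr1 (S M N' P E') e1) e2)) e3.
apply: etrans (congr1 (ext_compare (free_res _) (heart_res P) _ m) e) _.
exact: ext_compare_natural.
Qed.

End ExtOverHeart.

Theorem theorem5p9 (K : fieldType) (Q : quiver) (I : ideal (path_alg K Q))
    (hI : admissible I) (t : nat)
    (ht : longest_path_length
            (sub_plus (heart Q) `|` sub_minus (heart Q) `|` sub_o (heart Q)) t) :
  [/\ gldim_finite (bound_alg I)^c <-> gldim_finite (assoc_alg I (heart Q))^c,
      findim_finite (bound_alg I)^c <-> findim_finite (assoc_alg I (heart Q))^c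
    & exists
        (hA : forall (M : lmodType (bound_alg I)^c) (P : min_proj_res M),
           supported (heart Q) (A_mod t P))
        (hB : forall (N : lmodType (bound_alg I)^c) (E : min_inj_cores N),
           supported (heart Q) (B_mod t E)),
      forall l : nat, (2 * t + 3 <= l)%N ->
      exists Phi : forall (M N : lmodType (bound_alg I)^c)
          (P : min_proj_res M) (E : min_inj_cores N),
          {additive Ext l M N ->
             Ext (l - 2 * t - 2)%N (as_assoc_mod (hA M P))
                                   (as_assoc_mod (hB N E))},
        (forall M N P E, bijective (Phi M N P E)) /\
        (forall (M M' N N' : lmodType (bound_alg I)^c)
            (P : min_proj_res M) (P' : min_proj_res M')
            (E : min_inj_cores N) (E' : min_inj_cores N')
            (f : {linear M -> M'}) (g : {linear N -> N'})
            (c : chain_map P P' f) (d : cochain_map E E' g)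
            (xi : Ext l M' N),
          Phi M N' P E' (Ext_map f g xi) =
          Ext_map (as_assoc_map (hA M P) (hA M' P') (A_map t c))
                  (as_assoc_map (hB N E) (hB N' E') (B_map t d))
                  (Phi M' N P' E xi))].
Proof.
have [F eF] := bound_frame hI.
split; first exact: (@gldim_heart K Q I F eF t ht).
  exact: (@findim_heart K Q I F eF t ht).
exists (@A_mod_supp K Q I F eF t ht), (@B_mod_supp K Q I F eF t ht) => l hl.
(* The excess over the bound, so that the degree over Gamma is [m.+1]. *)
pose m := (l - (2 * t + 3))%N.
have e : l = (t.+1 + (m + t.+1).+1)%N.
  by rewrite -(subnK hl) -/m mul2n -addnn addn3 !(addnS, addSn) addnCA.
have -> : (l - 2 * t - 2)%N = m.+1.
  have hm : (m + (2 * t + 3))%N = (m.+1 + (2 * t + 2))%N.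
    by rewrite addn3 addn2 addnS addSn.
  by rewrite -(subnK hl) -/m -subnDA hm addnK.
by rewrite e; exact: ext_heart.
Qed.
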